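(* Let $q\in\mathbb{N}^*$ and let $(Y_i,Z_i)_{i\ge 1}$ be a sequence of square-integrable i.i.d. random vectors in $\mathbb{R}^2$ such that the law of $Y_1$ has an absolutely continuous component. Let $(\beta_M^1,\dots,\beta_M^{q+1})_{M\ge 1}$ be a sequence of elements of $\mathbb{N}^{q+1}$ and $0<\beta^1<\cdots<\beta^{q+1}$ real numbers such that $\lim_{M\to\infty}\sqrt{M}\left(\frac{\beta_M^i}{M}-\beta^i\right)=0$ for every $i\in\{1,\dots,q+1\}$. Write $m_Y=\mathbb{E}(Y_1)$, $m_Z=\mathbb{E}(Z_1)$. Let $(x,z,y_1,\dots,y_q)\in\mathbb{R}^{q+2}$ and let $\phi:\mathbb{R}\to\mathbb{R}$ be a measurable function which is differentiable at $\beta^{q+1}m_Y$ and satisfies $\phi(\beta^{q+1}m_Y)\neq 0$. Assume that there exists $\tilde M\in\mathbb{N}$ such that $$\int_{\mathbb{R}}\frac{1}{|\phi(\beta^{q+1}m_Y+y)|^{q+1}}e^{-\tilde M y^2}\,dy<\infty .$$ For $M\ge1$ set $$\Phi_M=\phi\left(\frac{Y_1+\cdots+Y_{\beta_M^{q+1}}+x}{M}\right),\qquad R^{i,y_i}_{\beta_M}=\Phi_M\left(Y_1+\cdots+Y_{\beta_M^i}+y_i\right)\ (1\le i\le q),\qquad \theta=\phi(\beta^{q+1}m_Y)\,\beta^{q+1}m_Z .$$ Then, as $M\to\infty$, the random vector $$\left(\{R^{1,y_1}_{\beta_M}\},\dots,\{R^{q,y_q}_{\beta_M}\},\ \sqrt{M}\left(\Phi_M\cdot\frac{Z_1+\cdots+Z_{\beta_M^{q+1}}+z}{M}-\theta\right)\right)$$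 converges in distribution to $(U,T)$, where $U$ is uniformly distributed on $[0,1]^q$, $T$ is independent of $U$, and $T\sim\mathcal{N}(0,\sigma_T^2)$ with $\sigma_T^2=\beta^{q+1}\,v^T\Sigma_{(Y_1,Z_1)}v$, where $v=\left(\phi'(\beta^{q+1}m_Y)\beta^{q+1}m_Z,\ \phi(\beta^{q+1}m_Y)\right)^T$ and $\Sigma_{(Y_1,Z_1)}$ is the covariance matrix of $(Y_1,Z_1)$.
   Context: $\mathbb{N}^*$ is the set of natural numbers without $0$. Superscripts on $\beta^i$ and $\beta^i_M$ are indices, not powers. $\{r\}=r-\lfloor r\rfloor$ is the fractional part of the real number $r$. The law $\mu_Y$ of a random vector in $\mathbb{R}^d$ decomposes as $\mu_Y=\mu_{Y,c}+\mu_{Y,s}$ with $\mu_{Y,c}$ absolutely continuous with respect to Lebesgue measure and $\mu_{Y,s}$ singular; ''the law of $Y$ has an absolutely continuous component'' means $\mu_{Y,c}\neq 0$. $\mathcal{N}(0,0)$ denotes the Dirac mass at $0$. In the integral, $1/0=+\infty$, so finiteness forces $\phi\neq0$ Lebesgue-almost everywhere. *)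

(* Defs.v *)
From HB Require Import structures.
From mathcomp Require Import all_boot all_order all_algebra.
From mathcomp Require Import finmap.
From mathcomp Require Import all_classical all_reals all_analysis.

Set Implicit Arguments.
Unset Strict Implicit.
Unset Printing Implicit Defensive.

Import Order.TTheory GRing.Theory Num.Theory.
Import numFieldNormedType.Exports.

Local Open Scope classical_set_scope.
Local Open Scope ring_scope.

Definition fractional_part {R : realType} (r : R) : R := r - (Num.floor r)%:~R.

Section iid.
Context d (Omega : measurableType d) d' (S : measurableType d') (R : realType).
Implicit Types (P : probability Omega R) (X : nat -> Omega -> S).

Definition identically_distributed P X :=
  forall (i : nat) (A : set S), measurable A ->
    P (X i @^-1` A) = P (X 0%N @^-1` A).

Definition independent P X :=
  forall (J : {fset nat}) (A : nat -> set S),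
    (forall j, measurable (A j)) ->
    P (\bigcap_(j in [set` J]) (X j @^-1` A j)) =
    (\prod_(j <- J) P (X j @^-1` A j))%E.

Definition iid P X := identically_distributed P X /\ independent P X.

End iid.

Definition singular {R : realType}
    (mu : {measure set (measurableTypeR R) -> \bar R}) :=
  exists N : set (measurableTypeR R),
    [/\ measurable N, lebesgue_measure N = 0%E & mu (~` N) = 0%E].

(* mu = muc + mus is the Lebesgue decomposition of mu, which is unique; muc is
   the absolutely continuous component. *)
Definition has_ac_component {R : realType} (mu : set R -> \bar R) :=
  exists muc mus : {measure set (measurableTypeR R) -> \bar R},
    [/\ forall A, measurable A -> mu A = (muc A + mus A)%E,
        muc `<< lebesgue_measure,
        singular mus
      & exists2 A, measurable A & muc A <> 0%E].

Definition covariance_matrix d (Omega : measurableType d) (R : realType)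
    (P : probability Omega R) n (X : 'I_n -> Omega -> R) : 'M[R]_n :=
  \matrix_(i, j) fine (covariance P (X i) (X j)).

(* Convergence in distribution of the random elements X M, defined on
   (Omega, P), to the random element L, defined on another space (Omega', P'). *)
Definition cvg_in_distribution (R : realType) (V : topologicalType)
    d (Omega : measurableType d) (P : probability Omega R)
    d' (Omega' : measurableType d') (P' : probability Omega' R)
    (X : nat -> Omega -> V) (L : Omega' -> V) :=
  forall f : V -> R, continuous f -> (exists K, forall v, `|f v| <= K) ->
    (\int[P]_w (f (X M w))%:E)%E @[M --> \oo] --> (\int[P']_w (f (L w))%:E)%E.

Section cube.
Variable R : realType.

Definition tcons n (p : measurableTypeR R * n.-tuple (measurableTypeR R)) :
  n.+1.-tuple (measurableTypeR R) := [tuple of p.1 :: p.2].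

Lemma measurable_tcons n : measurable_fun [set: _] (@tcons n).
Proof. exact: measurable_cons. Qed.

HB.instance Definition _ n :=
  isMeasurableFun.Build _ _ _ _ (@tcons n) (@measurable_tcons n).

(* The uniform law on [0,1]^n, as the n-fold product of that on [0,1]. *)
Fixpoint uniform_cube n : probability (n.-tuple (measurableTypeR R)) R :=
  if n is m.+1 then
    distribution (uniform_prob (@ltr01 R) \x uniform_cube m)%E (@tcons m)
  else dirac [tuple].

End cube.

(* Here s2 is the variance, whereas normal_prob takes the standard deviation
   and is not the Dirac mass when the latter is zero. *)
Definition normal_law {R : realType} (m s2 : R) :
    probability (measurableTypeR R) R :=
  if s2 == 0 then [the probability (measurableTypeR R) R of @dirac _ (measurableTypeR R) m R]
  else [the probability (measurableTypeR R) R of normal_prob m (Num.sqrt s2)].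

(* Main.v *)
Require Import Defs.
From HB Require Import structures.
From mathcomp Require Import all_boot all_order all_algebra.
From mathcomp Require Import finmap.
From mathcomp Require Import all_classical all_reals all_analysis.
From mathcomp Require Import measurable_realfun.
From mathcomp Require Import ring lra.
Import Order.TTheory GRing.Theory Num.Theory.
Import numFieldNormedType.Exports.
Local Open Scope classical_set_scope.
Local Open Scope ring_scope.

Set Implicit Arguments.
Unset Strict Implicit.
Unset Printing Implicit Defensive.

(** Two effects at different scales explain the result. The last
coordinate T is a smooth function of averages of all the observations, and is
governed by the central limit theorem and the delta method: up to an error
small in probability it is a normalised sum of the centred variables
phi (A) (Z - m_Z) + phi' (A) B (Y - m_Y), where A = bq m_Y and B = bq m_Z
([clt_TM]). The fractional part of the i-th remainder, in contrast, is sensitive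
to a bounded number of the first observations, and T is not.

The sensitivity is quantified by exchanging the observations j and s + j for
j < N, where s is the number of terms in the i-th remainder. Such an exchange
preserves the law of the sample; as soon as the later sample sizes exceed s + N,
it also preserves Phi, T and all the later remainders, because these depend on
Y through sums containing both exchanged terms. Averaging over the exchanges
([swap_average]) bounds a Fourier coefficient of the i-th remainder, weighted by
any function H of those invariant quantities, by the expectation of the product
over j < N of |cos (pi k Phi (Y_j - Y_(s + j)))|. Since Phi tends to phi (A) <> 0
in probability, this is about rho^N, where rho < 1 as the law of Y has an
absolutely continuous component and is therefore not carried by a translated
lattice ([expect_cos_diff_lt1], [swap_small]).

Small Fourier coefficients mean equidistribution. By domination by Fejer kernels
a cell of length 1 / n receives at most mass 1 / n + o(1), in mean against every H
as above ([cell_equidistribution], [cell_bound]). As the bound is uniform in H,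
the coordinates can be removed one by one, beginning with the smallest sample
size: the probability that the q fractional parts lie in given cells, weighted by
h (T), is at most n^-q E h (T) + o(1) ([joint_cells]).

These upper bounds determine the limit. Approximating a continuous test function
by a step function in the cube coordinates gives the upper half of the
convergence of expectations, and the same argument for the opposite function
gives the lower half ([cvg_of_cells]). The limit is a product law, whence the
independence of U and T. Convergence in law on the line is derived from that of
the expectations of cos (u T + c), by Fejer means once more
([cvg_expect_of_cos]), and the Fourier transform of the normal law is computed by
solving the differential equation which it satisfies ([gcosE]). *)

(** * The Fejer kernel *)

Section fejer.
Context {R : realType}.
Implicit Types (v t : R) (n L : nat).

(** The squared modulus of the sum of the exp (2 i pi k v) over k < L, divided
    by L. The double sum of cosines is the form that expectations act on. *)
Definition fejer L v : R :=
  L%:R^-1 * \sum_(k < L) \sum_(l < L) cos (2 * pi * ((k%:R - l%:R) * v)).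

Lemma fejerE L v : fejer L v = L%:R^-1 *
  ((\sum_(k < L) cos (2 * pi * (k%:R * v))) ^+ 2 +
   (\sum_(k < L) sin (2 * pi * (k%:R * v))) ^+ 2).
Proof.
rewrite /fejer; congr (_ * _).
rewrite !expr2 !big_distrlr /= -big_split; apply: eq_bigr => k _ /=.
rewrite -big_split; apply: eq_bigr => l _ /=.
by rewrite mulrBl mulrBr cosB.
Qed.

Lemma fejer_ge0 L v : 0 <= fejer L v.
Proof. by rewrite fejerE mulr_ge0 ?invr_ge0// addr_ge0 ?sqr_ge0. Qed.

(** 2 sin a cos t = sin (t + a) - sin (t - a), so the sum telescopes. *)
Lemma sum_cos_telescope L v a :
  2 * sin a * (\sum_(k < L) cos (v + 2 * a * k%:R)) =
  sin (v - a + 2 * a * L%:R) - sin (v - a).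
Proof.
elim: L => [|L IH]; first by rewrite big_ord0 !mulr0 addr0 subrr.
rewrite big_ord_recr/= mulrDr IH.
have -> : v - a + 2 * a * L.+1%:R = v + 2 * a * L%:R + a by rewrite -(natr1 L); ring.
have -> : v - a + 2 * a * L%:R = v + 2 * a * L%:R - a by ring.
set t := v + _ * L%:R; rewrite (sinD t a) (sinB t a); ring.
Qed.

(** By telescoping, the sums of cosines and of sines in [fejerE] are both at
    most 1 / |sin (pi v)|. *)
Lemma fejer_le L v s : 0 < s -> s <= `|sin (pi * v)| ->
  fejer L v <= 2 / (L%:R * s ^+ 2).
Proof.
move=> s0 sv; rewrite fejerE.
have bnd (x : R) : `|2 * sin (pi * v) * x| <= 2 -> x ^+ 2 <= s ^- 2.
  rewrite !normrM ger0_norm// -mulrA => h.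
  have {}h : s * `|x| <= 1.
    have : `|sin (pi * v)| * `|x| <= 1 by lra.
    by move=> h'; apply: le_trans h'; rewrite ler_wpM2r.
  rewrite -[x ^+ 2]real_normK ?num_real// -exprVn ler_sqr ?nnegrE ?invr_ge0 ?(ltW s0)//.
  by rewrite -[leRHS]mul1r ler_pdivlMr// mulrC.
have c2 : (\sum_(k < L) cos (2 * pi * (k%:R * v))) ^+ 2 <= s ^- 2.
  apply: bnd; rewrite (eq_bigr (fun k : 'I_L => cos (0 + 2 * (pi * v) * k%:R))); last by move=> k _; congr cos; ring.
  rewrite sum_cos_telescope (le_trans (ler_normB _ _))//.
  by rewrite (_ : (2 : R) = 1 + 1)// lerD ?sin_max.
have s2 : (\sum_(k < L) sin (2 * pi * (k%:R * v))) ^+ 2 <= s ^- 2.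
  apply: bnd; rewrite (eq_bigr (fun k : 'I_L => cos (- (pi / 2) + 2 * (pi * v) * k%:R))); last by move=> k _; rewrite -cosBpihalf; congr cos; ring.
  rewrite sum_cos_telescope (le_trans (ler_normB _ _))//.
  by rewrite (_ : (2 : R) = 1 + 1)// lerD ?sin_max.
have [->|L0] := posnP L; first by rewrite mul0r !invr0 !(mul0r,mulr0).
rewrite invfM mulrCA ler_pM2l ?invr_gt0 ?ltr0n//; lra.
Qed.

Lemma sinDnpi (x : R) n : sin (x + 2 * pi * n%:R) = sin x.
Proof.
elim: n => [|n IH]; first by rewrite mulr0 addr0.
have E : pi *+ 2 = 2 * pi :> R by rewrite mulr2n; ring.
by rewrite -(natr1 n) mulrDr mulr1 addrA -{2}E sinD2pi IH.
Qed.

Lemma sin_pi_frac_neq0 (m L : nat) : (0 < m < L)%N -> sin (pi * (m%:R / L%:R)) != 0 :> R.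
Proof.
move=> /andP[m0 mL]; rewrite gt_eqF// sin_gt0_pi//.
have L0 : (0 : R) < L%:R by rewrite ltr0n (leq_trans _ mL).
rewrite mulr_gt0 ?pi_gt0 ?divr_gt0// ?ltr0n//=.
by rewrite gtr_pMr ?pi_gt0// ltr_pdivrMr// mul1r ltr_nat.
Qed.

Lemma sum_cos_grid (x : R) (m L : nat) : (0 < m < L)%N ->
  \sum_(i < L) cos (x + 2 * pi * (m%:R * (i%:R / L%:R))) = 0.
Proof.
move=> mL; have := sum_cos_telescope L x (pi * (m%:R / L%:R)).
have L0 : L%:R != 0 :> R by rewrite pnatr_eq0 -lt0n; case/andP: mL => m0 /ltnW; exact: leq_trans.
rewrite (_ : 2 * (pi * (m%:R / L%:R)) * L%:R = 2 * pi * m%:R); last by field.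
rewrite sinDnpi subrr => /eqP; rewrite !mulf_eq0 pnatr_eq0/= (negbTE (sin_pi_frac_neq0 mL))/=.
move/eqP => {2}<-; apply: eq_bigr => i _; congr (cos (_ + _)); ring.
Qed.

(** The frequencies k - l with k <> l are not multiples of L, so their cosines
    cancel over a grid of mesh 1 / L; the L diagonal terms remain. Fejer kernels
    centred on a grid are thus a partition of unity, up to the factor L. *)
Lemma fejer_grid L v : (0 < L)%N -> \sum_(i < L) fejer L (v - i%:R / L%:R) = L%:R.
Proof.
move=> L0; rewrite /fejer -mulr_sumr exchange_big/=.
under eq_bigr do rewrite exchange_big/=.
have H (k l : 'I_L) : \sum_(i < L) cos (2 * pi * ((k%:R - l%:R) * (v - i%:R / L%:R))) =
   (if l == k then L%:R else 0) :> R.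
  have [->|lk] := eqVneq l k.
    under eq_bigr do rewrite subrr mul0r mulr0 cos0.
    by rewrite sumr_const card_ord.
  have [kl|kl] := leqP k l.
    have m0 : (0 < l - k < L)%N.
      rewrite subn_gt0 ltn_neqAle kl andbT; apply/andP; split.
        by apply: contra lk => /eqP /val_inj ->.
      by rewrite (leq_ltn_trans (leq_subr _ _)).
    rewrite -[RHS](sum_cos_grid (2 * pi * ((k%:R - l%:R) * v)) m0).
    by apply: eq_bigr => i _; congr cos; rewrite natrB//; ring.
  have m0 : (0 < k - l < L)%N.
    by rewrite subn_gt0 kl (leq_ltn_trans (leq_subr _ _)).
  rewrite -[RHS](sum_cos_grid (- (2 * pi * ((k%:R - l%:R) * v))) m0).
  by apply: eq_bigr => i _; rewrite -cosN; congr cos; rewrite natrB ?(ltnW kl)//; ring.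
under eq_bigr => k _ do (under eq_bigr do rewrite H).
under eq_bigr do rewrite -big_mkcond big_pred1_eq.
by rewrite sumr_const card_ord mulrnAr mulVf// pnatr_eq0 -lt0n.
Qed.

End fejer.

(** * Expectations of bounded functions *)

Lemma le_of_eq (R : numDomainType) (a b : R) : a = b -> a <= b.
Proof. by move->. Qed.

Section comparison_sets.
Context d (T : measurableType d) {R : realType}.
Variables f g : T -> R.
Hypotheses (mf : measurable_fun [set: T] f) (mg : measurable_fun [set: T] g).

Lemma measurable_le_set : measurable [set x | f x <= g x].
Proof. by rewrite -[X in measurable X]setTI; exact: measurable_fun_ler. Qed.

Lemma measurable_lt_set : measurable [set x | f x < g x].
Proof. by rewrite -[X in measurable X]setTI; exact: measurable_fun_ltr. Qed.

End comparison_sets.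

(** Only u is confined to the compact set, so that the users need not enlarge
    it to make room for v. *)
Lemma compact_unif_continuous (R : realType) (V : pseudoMetricType R)
    (K : set V) (f : V -> R) (e : R) : compact K -> continuous f -> 0 < e ->
  exists2 r : R, 0 < r & forall u v, K u -> ball u r v -> `|f u - f v| < e.
Proof.
move=> /compact_near_coveringP cK cf e0.
have e20 : 0 < e / 2 by rewrite divr_gt0.
have [r /= r0 Hr] : \forall r \near (0 : R)^'+,
    K `<=` [set u | forall v, ball u r v -> `|f u - f v| < e].
  apply: (cK R (0:R)^'+ (fun r u => forall v, ball u r v -> `|f u - f v| < e)).
  move=> u Ku; have := cf u => /cvgrPdist_lt/(_ _ e20).
  rewrite -nbhs_ballE => -[r/= r0 Hr].
  have r20 : 0 < r / 2 by rewrite divr_gt0.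
  exists (ball u (r / 2), [set s | s < r / 2]) => /=.
    by split; [rewrite -nbhs_ballE; exists (r / 2)|exact: nbhs_right_lt].
  move=> [w s]/= [uw sr] v wv.
  have uv : ball u r v.
    by rewrite [r]splitr; apply: ball_triangle uw _; apply: le_ball wv; exact: ltW.
  have uw' : ball u r w by apply: le_ball uw; rewrite ler_pdivrMr// ler_peMr ?ltW// ltr1n.
  have := Hr _ uv; have := Hr _ uw' => /=.
  rewrite [e in _ -> _ -> _ < e]splitr => h1 h2.
  rewrite (_ : f w - f v = (f u - f v) - (f u - f w)); last by ring.
  by rewrite (le_lt_trans (ler_normB _ _))// ltrD.
exists (r / 2); first by rewrite divr_gt0.
move=> u v Ku uv; apply: (Hr (r / 2)) => //=.
- by rewrite sub0r normrN gtr0_norm ?divr_gt0// ltr_pdivrMr// ltr_pMr// ltr1n.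
- by rewrite divr_gt0.
Qed.

Section bounded_expectation.
Context d {T : measurableType d} {R : realType}.
Implicit Types f g : T -> R.

(** On bounded measurable functions expectations are linear and monotone
    without side conditions; almost all integrands below are of this kind. *)
Definition bmeas f := measurable_fun [set: T] f /\ exists K, forall w, `|f w| <= K.

Lemma bmeas_cst (c : R) : bmeas (fun _ => c).
Proof. by split => //; exists `|c|. Qed.

Lemma bmeas_unit f : measurable_fun [set: T] f -> (forall w, 0 <= f w <= 1) -> bmeas f.
Proof.
by move=> mf f01; split => //; exists 1 => w; have /andP[f0 f1] := f01 w; rewrite ger0_norm.
Qed.

Lemma bmeasD f g : bmeas f -> bmeas g -> bmeas (fun w => f w + g w).
Proof.
move=> [mf [K fK]] [mg [L gL]]; split; first exact: measurable_funD.
by exists (K + L) => w; rewrite (le_trans (ler_normD _ _))// lerD.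
Qed.

Lemma bmeasM f g : bmeas f -> bmeas g -> bmeas (fun w => f w * g w).
Proof.
move=> [mf [K fK]] [mg [L gL]]; split; first exact: measurable_funM.
by exists (K * L) => w; rewrite normrM ler_pM.
Qed.

Lemma bmeasN f : bmeas f -> bmeas (fun w => - f w).
Proof.
move=> [mf [K fK]]; split; first exact: measurableT_comp.
by exists K => w; rewrite normrN.
Qed.

Lemma bmeasB f g : bmeas f -> bmeas g -> bmeas (fun w => f w - g w).
Proof. by move=> bf bg; apply: bmeasD => //; exact: bmeasN. Qed.

Lemma bmeas_norm f : bmeas f -> bmeas (fun w => `|f w|).
Proof.
move=> [mf [K fK]]; split; first exact: measurableT_comp.
by exists K => w; rewrite normr_id.
Qed.

Lemma bmeas_sum I (s : seq I) (f : I -> T -> R) : (forall i, bmeas (f i)) ->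
  bmeas (fun w => \sum_(i <- s) f i w).
Proof.
move=> bf; elim: s => [|i s IH].
  by under eq_fun do rewrite big_nil; exact: bmeas_cst.
by under eq_fun do rewrite big_cons; exact: bmeasD.
Qed.

Lemma bmeas_prod I (s : seq I) (p : pred I) (f : I -> T -> R) :
  (forall i, bmeas (f i)) -> bmeas (fun w => \prod_(i <- s | p i) f i w).
Proof.
move=> bf; elim: s => [|i s IH].
  by under eq_fun do rewrite big_nil; exact: bmeas_cst.
under eq_fun do rewrite big_cons; case: (p i) => //.
exact: bmeasM.
Qed.

Lemma bmeas_indic (A : set T) : measurable A -> bmeas (\1_A).
Proof.
move=> mA; split => //; exists 1 => w.
by rewrite indicE normr_nat; case: (_ \in _); rewrite ?ler01.
Qed.

Lemma bmeas_cos f : measurable_fun [set: T] f -> bmeas (fun w => cos (f w)).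
Proof.
move=> mf; split; last by exists 1 => w; exact: cos_max.
apply: measurableT_comp => //; apply: continuous_measurable_fun.
exact: continuous_cos.
Qed.

Lemma bmeas_comp d' (T' : measurableType d') (g : T' -> T) f :
  bmeas f -> measurable_fun [set: T'] g ->
  measurable_fun [set: T'] (f \o g) /\ exists K, forall w, `|(f \o g) w| <= K.
Proof.
move=> [mf [K fK]] mg; split; last by exists K => w /=.
exact: measurableT_comp.
Qed.

Variable P : probability T R.

Lemma bmeas_integrable f : bmeas f -> P.-integrable [set: T] (EFin \o f).
Proof.
move=> [mf [K fK]]; apply: measurable_bounded_integrable => //.
  by rewrite -ge0_fin_numE// fin_num_measure.
exists K; split => [|L KL w _ /=]; first by rewrite num_real.
exact: le_trans (fK w) (ltW KL).
Qed.

Lemma expect_cst (c : R) : \int[P]_w c = c.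
Proof. by rewrite Rintegral_cst//= probability_setT mulr1. Qed.

Lemma expectD f g : bmeas f -> bmeas g ->
  \int[P]_w (f w + g w) = \int[P]_w f w + \int[P]_w g w.
Proof. by move=> bf bg; rewrite RintegralD//; exact: bmeas_integrable. Qed.

Lemma expectB f g : bmeas f -> bmeas g ->
  \int[P]_w (f w - g w) = \int[P]_w f w - \int[P]_w g w.
Proof. by move=> bf bg; rewrite RintegralB//; exact: bmeas_integrable. Qed.

Lemma expectZ (c : R) f : bmeas f -> \int[P]_w (c * f w) = c * \int[P]_w f w.
Proof. by move=> bf; rewrite RintegralZl//; exact: bmeas_integrable. Qed.

Lemma expect_sum I (s : seq I) (f : I -> T -> R) : (forall i, bmeas (f i)) ->
  \int[P]_w (\sum_(i <- s) f i w) = \sum_(i <- s) \int[P]_w f i w.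
Proof.
move=> bf; elim: s => [|i s IH].
  rewrite big_nil; under eq_Rintegral do rewrite big_nil.
  by rewrite expect_cst.
rewrite big_cons -IH -expectD//; last exact: bmeas_sum.
by under eq_Rintegral do rewrite big_cons.
Qed.

Lemma le_expect f g : bmeas f -> bmeas g -> (forall w, f w <= g w) ->
  \int[P]_w f w <= \int[P]_w g w.
Proof.
by move=> bf bg fg; apply: le_Rintegral => //; exact: bmeas_integrable.
Qed.

Lemma norm_expect_le f g : bmeas f -> bmeas g -> (forall w, `|f w| <= g w) ->
  `|\int[P]_w f w| <= \int[P]_w g w.
Proof.
move=> bf bg fg; apply: (le_trans (le_normr_Rintegral _ _)) => //.
  exact: bmeas_integrable.
by apply: le_expect => //; exact: bmeas_norm.
Qed.

Lemma expect_indic (A : set T) : measurable A -> \int[P]_w \1_A w = fine (P A).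
Proof. by move=> mA; rewrite /Rintegral integral_indic// setIT. Qed.

Lemma expectE f : bmeas f -> (\int[P]_w (f w)%:E = (\int[P]_w f w)%R%:E)%E.
Proof.
move=> bf; rewrite /Rintegral fineK//.
by apply: integrable_fin_num => //; exact: bmeas_integrable.
Qed.

End bounded_expectation.

Lemma expect_image d d' (T : measurableType d) (T' : measurableType d')
    (R : realType) (P : probability T R) (X : {mfun T >-> T'}) (f : T' -> R) :
  bmeas f -> \int[distribution P X]_t f t = \int[P]_w f (X w).
Proof.
move=> bf; have [mfX bX] := bmeas_comp bf (measurable_funPT X).
rewrite /Rintegral integral_distribution//; first by apply/measurable_EFinP; case: bf.
exact: (bmeas_integrable P (conj mfX bX)).
Qed.

Lemma bmeas_partial_expect d1 (T1 : measurableType d1) d2 (T2 : measurableType d2)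
    (R : realType) (mu : probability T1 R) (g : T1 * T2 -> R) : bmeas g ->
  bmeas (fun y => \int[mu]_x g (x, y)).
Proof.
move=> bg; have ig := bmeas_integrable (mu \x (\d_ (point : T2) : probability T2 R))%E bg.
have bgy y : bmeas (fun x => g (x, y)) by exact: (bmeas_comp bg (measurable_pair2 y)).
split.
  apply/measurable_EFinP.
  rewrite (_ : _ \o _ = (fubini_G mu (EFin \o g))); first exact: (measurable_fubini_G ig).
  by apply/funext => y /=; rewrite -expectE.
have [_ [K gK]] := bg; exists K => y; rewrite -(expect_cst mu K).
by apply: norm_expect_le => //; exact: bmeas_cst.
Qed.

(** This is how events of small probability are discarded. *)
Lemma bmeas_near_le d (T : measurableType d) (R : realType) (P : probability T R)
    (f g : T -> R) (A : set T) (e K : R) : bmeas f -> bmeas g -> measurable A ->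
  0 <= e -> (forall w, A w -> `|f w - g w| <= e) ->
  (forall w, `|f w - g w| <= K) ->
  `|\int[P]_w f w - \int[P]_w g w| <= e + K * fine (P (~` A)).
Proof.
move=> bf bg mA e0 hA hK.
have mCA : measurable (~` A) by exact: measurableC.
have bi : bmeas (fun w => K * \1_(~` A) w :> R).
  by apply: bmeasM; [exact: bmeas_cst|exact: bmeas_indic].
have -> : e + K * fine (P (~` A)) = \int[P]_w (e + K * \1_(~` A) w).
  rewrite expectD ?expect_cst ?expectZ ?expect_indic//;
    [exact: bmeas_indic|exact: bmeas_cst].
rewrite -expectB//; apply: norm_expect_le.
- exact: bmeasB.
- by apply: bmeasD => //; exact: bmeas_cst.
- move=> w; rewrite indicE; have [/set_mem Aw|Aw] := boolP (w \in A).
    by rewrite in_setC mem_set// mulr0 addr0 hA.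
  by rewrite in_setC Aw mulr1 (le_trans (hK w))// lerDr.
Qed.

(** * Fejer means of a continuous function *)

Section fejer_approximation.
Context {R : realType}.

(** A trigonometric polynomial in t, of period 2 B, that averages the values
    of h at the grid points of [-B, B] with the Fejer kernels as weights. *)
Definition fejer_mean (B : R) (h : R -> R) (L : nat) (t : R) : R :=
  L%:R^-1 * \sum_(i < L) h (- B + 2 * B * (i%:R / L%:R)) *
    fejer L ((t + B) / (2 * B) - i%:R / L%:R).

Lemma fejer_mean_01 B h L t : (0 < L)%N -> (forall s, 0 <= h s <= 1) ->
  0 <= fejer_mean B h L t <= 1.
Proof.
move=> L0 h01; rewrite /fejer_mean mulr_ge0 ?invr_ge0//=; last first.
  by apply: sumr_ge0 => i _; rewrite mulr_ge0 ?fejer_ge0//; case/andP: (h01 (- B + 2 * B * (i%:R / L%:R))).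
rewrite ler_pdivrMl ?ltr0n// mulr1 -[leRHS](fejer_grid ((t + B) / (2 * B)) L0).
apply: ler_sum => i _; rewrite ler_piMl ?fejer_ge0//.
by case/andP: (h01 (- B + 2 * B * (i%:R / L%:R))).
Qed.

(** t |-> sin (pi t) increases on [0, 1/2] and is symmetric about 1/2, so on
    [r, 1 - r] it is smallest at the ends. *)
Lemma sin_pi_ge (r v : R) : 0 < r -> r <= `|v| -> `|v| <= 1 - r ->
  sin (pi * r) <= `|sin (pi * v)|.
Proof.
move=> r0 rv v1; have r1 : r <= 1 - r by exact: le_trans v1.
have pi0 := @pi_gt0 R.
suff H (s : R) : r <= s -> s <= 1 - r -> sin (pi * r) <= sin (pi * s).
  have [v0|v0] := leP 0 v.
    by rewrite (le_trans _ (ler_norm _))// H// -(ger0_norm v0).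
  by rewrite -normrN -sinN -mulrN (le_trans _ (ler_norm _))// H// -(ltr0_norm v0).
move=> rs s1.
have aux (a b : R) : 0 < a -> a <= b -> b <= 1 / 2 -> sin (pi * a) <= sin (pi * b).
  move=> a0; rewrite le_eqVlt => /predU1P[->//|ab] b1.
  apply: ltW; rewrite ltr_sin ?in_itv/=.
  - by rewrite ltr_pM2l.
  - apply/andP; split; nra.
  - apply/andP; split; nra.
have [s2|s2] := leP s (1 / 2); first exact: aux.
have -> : sin (pi * s) = sin (pi * (1 - s)).
  by rewrite mulrBr mulr1 addrC sinDpi sinN opprK.
by apply: aux; lra.
Qed.

(** Grid points close to t contribute the oscillation of h, which is small by
    uniform continuity; at the others the kernel is of order 1 / L. The margin
    A + 1 keeps t away from -B and B, which the period identifies. *)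
Lemma fejer_mean_approx (h : R -> R) (A e : R) : continuous h ->
    (forall s, 0 <= h s <= 1) -> 0 < A -> 0 < e ->
  exists2 L, (0 < L)%N &
    forall t, `|t| <= A -> `|h t - fejer_mean (A + 1) h L t| <= e.
Proof.
move=> ch h01 A0 e0; set B := A + 1.
have B0 : 0 < B by rewrite addr_gt0.
have e20 : 0 < e / 2 by rewrite divr_gt0.
have [r r0 hr] := compact_unif_continuous (@segment_compact R (- A) A) ch e20.
pose s0 := Num.min r 1 / (2 * B).
have m1 : Num.min r 1 <= 1 by rewrite ge_min lexx orbT.
have mr : Num.min r 1 <= r by rewrite ge_min lexx.
have m0 : 0 < Num.min r 1 by rewrite lt_min r0 ltr01.
have s00 : 0 < s0 by rewrite divr_gt0// mulr_gt0.
have s1 : s0 * (2 * B) = Num.min r 1 by rewrite /s0 divfK// gt_eqF// mulr_gt0.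
pose s := sin (pi * s0).
have pi0 := @pi_gt0 R.
have s0lt : s0 < 1 by rewrite /s0 ltr_pdivrMr ?mulr_gt0//; rewrite /B; lra.
have s_gt0 : 0 < s.
  by apply: sin_gt0_pi; rewrite mulr_gt0//= gtr_pMr.
pose L := (Num.truncn (2 / (s ^+ 2 * (e / 2)))).+1.
have L0 : (0 < L)%N by [].
have LE : 2 / (L%:R * s ^+ 2) <= e / 2.
  have s2 : 0 < s ^+ 2 * (e / 2) by rewrite mulr_gt0 ?exprn_gt0.
  have := truncnS_gt (2 / (s ^+ 2 * (e / 2))); rewrite ltr_pdivrMr// => hL.
  rewrite ler_pdivrMr ?mulr_gt0 ?ltr0n ?exprn_gt0//.
  by rewrite (_ : e / 2 * _ = L%:R * (s ^+ 2 * (e / 2))) ?ltW//; ring.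
exists L => // t tA.
have -> : h t = L%:R^-1 * \sum_(i < L) h t * fejer L ((t + B) / (2 * B) - i%:R / L%:R).
  by rewrite -mulr_sumr fejer_grid// mulrCA mulVf ?mulr1// pnatr_eq0.
rewrite /fejer_mean -mulrBr -sumrB normrM gtr0_norm ?invr_gt0 ?ltr0n//.
rewrite ler_pdivrMl ?ltr0n//.
apply: (le_trans (ler_norm_sum _ _ _)).
have key (i : 'I_L) : `|h t * fejer L ((t + B) / (2 * B) - i%:R / L%:R) -
    h (- B + 2 * B * (i%:R / L%:R)) * fejer L ((t + B) / (2 * B) - i%:R / L%:R)| <=
    e / 2 * fejer L ((t + B) / (2 * B) - i%:R / L%:R) + e / 2.
  rewrite -mulrBl normrM (ger0_norm (fejer_ge0 _ _)).
  set ti := - B + _; set F := fejer _ _.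
  have F0 : 0 <= F by exact: fejer_ge0.
  have L0' : 0 < L%:R :> R by rewrite ltr0n.
  have i0 : 0 <= i%:R / L%:R :> R by rewrite divr_ge0.
  have i1 : i%:R / L%:R <= 1 :> R by rewrite ler_pdivrMr// mul1r ler_nat ltnW.
  have [tti|tti] := ltP `|t - ti| r.
    rewrite ler_wpDr ?(ltW e20)// ler_wpM2r// ltW// hr//=.
    by rewrite in_itv/= -ler_norml.
  rewrite -[leLHS]add0r; apply: lerD; first by apply: mulr_ge0 => //; exact: ltW.
  apply: (@le_trans _ _ (1 * F)).
    rewrite ler_wpM2r//; have := h01 t; have := h01 ti; move=> /andP[? ?] /andP[? ?].
    by rewrite ler_norml; apply/andP; split; lra.
  rewrite mul1r; apply: le_trans LE; apply: fejer_le => //.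
  have E : ((t + B) / (2 * B) - i%:R / L%:R) = (t - ti) / (2 * B).
    by rewrite /ti; field; rewrite !gt_eqF.
  apply: sin_pi_ge => //.
    rewrite E normrM [X in _ <= _ * X]gtr0_norm ?invr_gt0 ?mulr_gt0//.
    by rewrite ler_pM2r ?invr_gt0 ?mulr_gt0//; exact: le_trans tti.
  rewrite E normrM [X in _ * X <= _]gtr0_norm ?invr_gt0 ?mulr_gt0//.
  rewrite ler_pdivrMr ?mulr_gt0// mulrBl s1 mul1r.
  have : `|ti| <= B by rewrite ler_norml /ti; apply/andP; split; nra.
  have := ler_normB t ti; rewrite /B => *; lra.
apply: (le_trans (ler_sum _ (fun i _ => key i))).
rewrite big_split/= -mulr_sumr fejer_grid// sumr_const card_ord -mulr_natr; lra.
Qed.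

End fejer_approximation.

(** * Convergence in law from expectations of cosines *)

(** Properties stable under linear combinations pass from the functions
    cos (u t + c) to Fejer means; convergence of expectations is one. *)
Lemma fejer_mean_trig (R : realType) (D : (R -> R) -> Prop) (B : R) h L :
  (forall u c, D (fun t => cos (u * t + c))) ->
  (forall f g, D f -> D g -> D (fun t => f t + g t)) ->
  (forall c f, D f -> D (fun t => c * f t)) ->
  B != 0 -> D (fejer_mean B h L).
Proof.
move=> Dcos DD DZ B0.
have D0 : D (fun => 0).
  by rewrite (_ : (fun => 0) = (fun t => 0 * cos (0 * t + 0)));
    [exact: DZ|apply/funext => t; rewrite mul0r].
have Dsum I (s : seq I) f : (forall i, D (f i)) -> D (fun t => \sum_(i <- s) f i t).
  move=> Df; elim: s => [|i s IH]; first by under eq_fun do rewrite big_nil.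
  by under eq_fun do rewrite big_cons; exact: DD.
apply: (DZ); apply: (Dsum) => i; apply: (DZ); apply: (DZ); apply: (Dsum) => k; apply: (Dsum) => l.
rewrite (_ : (fun t => _) = (fun t => cos (pi * (k%:R - l%:R) / B * t +
  2 * pi * (k%:R - l%:R) * (2^-1 - i%:R / L%:R)))) //.
apply/funext => t; congr cos; rewrite mulrDl.
have L0 : (0 < L)%N by exact: leq_ltn_trans (ltn_ord i).
by field; rewrite B0 pnatr_eq0 -lt0n L0.
Qed.

(** The events n < |X| decrease to the empty set. *)
Lemma tight_one d (T : measurableType d) (R : realType) (P : probability T R)
    (X : T -> R) (e : R) : measurable_fun [set: T] X -> 0 < e ->
  exists2 A : R, 0 < A & fine (P [set w | A < `|X w|]) <= e.
Proof.
move=> mX e0; pose F n := [set w | n%:R < `|X w|].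
have mF n : measurable (F n).
  apply: measurable_lt_set => //.
  exact: measurableT_comp.
have Fcvg : P (F n) @[n --> \oo] --> P (\bigcap_n F n).
  apply: nonincreasing_cvg_mu => //.
  - by rewrite -ge0_fin_numE// fin_num_measure.
  - exact: bigcap_measurable.
  - apply/nonincreasing_seqP => n; apply/subsetPset => w; rewrite /F /=.
    by apply: le_lt_trans; rewrite ler_nat.
have F0 : \bigcap_n F n = set0.
  apply/seteqP; split => // w /(_ (Num.truncn `|X w|).+1 I); rewrite /F /=.
  by move=> /ltW; rewrite leNgt truncnS_gt.
move: Fcvg; rewrite F0 measure0 => Fcvg.
have Fcvg' : fine (P (F n)) @[n --> \oo] --> 0 by exact: fine_cvg.
have /cvgrPdist_lt/(_ _ e0)[N _ HN] := Fcvg'.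
exists N.+1%:R => //.
have := HN N.+1 (leqnSn N); rewrite /= sub0r normrN ger0_norm; first by exact: ltW.
exact: fine_ge0.
Qed.

Section cos_characterises_law.
Context d {T : measurableType d} d' {T' : measurableType d'} {R : realType}.
Variables (P : probability T R) (P' : probability T' R).
Variables (X : nat -> T -> R) (L : T' -> R).
Hypotheses (mX : forall n, measurable_fun [set: T] (X n))
           (mL : measurable_fun [set: T'] L).
Hypothesis tight : forall e : R, 0 < e -> exists2 A : R, 0 < A &
  \forall n \near \oo, fine (P [set w | A < `|X n w|]) <= e.
Hypothesis cvg_cos : forall u c : R, \int[P]_w cos (u * X n w + c) @[n --> \oo] -->
  (\int[P']_w cos (u * L w + c) : R).

(** The Levy continuity theorem when the limit law is given: by tightness only
    a segment matters, on which h is uniformly close to a Fejer mean, and for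
    that trigonometric polynomial convergence is the hypothesis. *)
Lemma cvg_expect_of_cos (h : R -> R) : continuous h -> (forall s, 0 <= h s <= 1) ->
  \int[P]_w h (X n w) @[n --> \oo] --> (\int[P']_w h (L w) : R).
Proof.
move=> ch h01; apply/cvgrPdist_le => e e0.
have e50 : 0 < e / 5 by rewrite divr_gt0.
have [A1 A10 HA1] := tight e50.
have [A2 A20 HA2] := tight_one P' mL e50.
pose A := Num.max A1 A2.
have A0 : 0 < A by rewrite lt_max A10.
have A1A : A1 <= A by rewrite le_max lexx.
have A2A : A2 <= A by rewrite le_max lexx orbT.
have [N N0 hN] := fejer_mean_approx ch h01 A0 e50.
set p := fejer_mean (A + 1) h N in hN.
pose D (f : R -> R) := [/\ forall n, bmeas (fun w => f (X n w)),
  bmeas (fun w => f (L w)) &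
  \int[P]_w f (X n w) @[n --> \oo] --> (\int[P']_w f (L w) : R)].
have [pX pL cvp] : D p.
  apply: fejer_mean_trig.
  - move=> u c; split => //.
    + by move=> n; apply: bmeas_cos; apply: measurable_funD => //; exact: measurable_funM.
    + by apply: bmeas_cos; apply: measurable_funD => //; exact: measurable_funM.
  - move=> f g [fX fL cf] [gX gL cg]; split.
    + by move=> n; exact: bmeasD.
    + exact: bmeasD.
    + rewrite expectD//; under eq_fun do rewrite expectD//.
      exact: cvgD.
  - move=> c f [fX fL cf]; split.
    + by move=> n; apply: bmeasM => //; exact: bmeas_cst.
    + by apply: bmeasM => //; exact: bmeas_cst.
    + rewrite expectZ//; under eq_fun do rewrite expectZ//.
      by apply: cvgM => //; exact: cvg_cst.
  - by rewrite gt_eqF// addr_gt0.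
have mh : measurable_fun [set: R] h by exact: continuous_measurable_fun.
have hX n : bmeas (fun w => h (X n w)) by apply: bmeas_unit => //; exact: measurableT_comp.
have hL : bmeas (fun w => h (L w)) by apply: bmeas_unit => //; exact: measurableT_comp.
have p01 t : 0 <= p t <= 1 by exact: fejer_mean_01.
have hp1 t : `|h t - p t| <= 1.
  have /andP[? ?] := p01 t; have /andP[? ?] := h01 t.
  by rewrite ler_norml; apply/andP; split; lra.
have approx d0 (S : measurableType d0) (Q : probability S R) (W : S -> R) A' :
    measurable_fun [set: S] W -> bmeas (fun w => h (W w)) -> bmeas (fun w => p (W w)) ->
    A' <= A -> fine (Q [set w | A' < `|W w|]) <= e / 5 ->
    `|\int[Q]_w h (W w) - \int[Q]_w p (W w)| <= 2 * (e / 5).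
  move=> mW bh bp A'A HA.
  have mS : measurable [set w | `|W w| <= A'].
    apply: measurable_le_set => //.
    exact: measurableT_comp.
  have /= := @bmeas_near_le _ _ _ Q _ _ _ (e / 5) 1 bh bp mS (ltW e50).
  have -> : ~` [set w | `|W w| <= A'] = [set w | A' < `|W w|].
    by apply/seteqP; split => w /=; rewrite ltNge => /negP.
  move=> H; apply: (le_trans (H _ _)).
  - by move=> w Ww; apply: hN; exact: le_trans A'A.
  - by move=> w.
  - by rewrite mul1r mulrDl mul1r lerD.
have HL := approx _ _ P' L A2 mL hL pL A2A HA2.
near=> n.
have HX : `|\int[P]_w h (X n w) - \int[P]_w p (X n w)| <= 2 * (e / 5).
  by apply: (approx _ _ P (X n) A1) => //; near: n.
have Hp : `|\int[P']_w p (L w) - \int[P]_w p (X n w)| <= e / 5.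
  by near: n; move/cvgrPdist_le : cvp => /(_ _ e50).
move: HL HX Hp; rewrite !ler_norml => /andP[a1 a2] /andP[a3 a4] /andP[a5 a6].
apply/andP; split; lra.
Unshelve. all: by end_near. Qed.

End cos_characterises_law.

(** * The Fourier transform of the normal law *)

Section pointwise_derivatives.
Context {R : realType}.
Implicit Types (f g : R -> R) (x a b : R).

Lemma is_derive_mul f g x a b : is_derive x 1 f a -> is_derive x 1 g b ->
  is_derive x 1 (fun t => f t * g t) (a * g x + f x * b).
Proof.
move=> df dg; have := is_deriveM df dg.
by rewrite /GRing.scale/= addrC [g x * a]mulrC.
Qed.

Lemma is_derive_add f g x a b : is_derive x 1 f a -> is_derive x 1 g b ->
  is_derive x 1 (fun t => f t + g t) (a + b).
Proof. by move=> df dg; exact: is_deriveD. Qed.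

Lemma is_derive_affine (u c x : R) : is_derive x 1 (fun t => u * t + c) u.
Proof.
have h := is_deriveD (is_deriveZ u (is_derive_id x 1)) (is_derive_cst c x 1).
by move: h; rewrite /GRing.scale/= mulr1 addr0.
Qed.

Lemma is_derive_compose f g x a b : is_derive x 1 f a -> is_derive (f x) 1 g b ->
  is_derive x 1 (fun t => g (f t)) (b * a).
Proof.
move=> df dg; apply: (@is_derive1_comp _ g f).
Qed.

Lemma is_derive_sqr (k x : R) : is_derive x 1 (fun t => k * t ^+ 2) (k * (2 * x)).
Proof.
have h := is_deriveZ k (@is_deriveX _ _ _ 2 x 1 1 (is_derive_id x 1)).
by move: h; rewrite /GRing.scale/= expr1 mulr1.
Qed.

End pointwise_derivatives.

Section gaussian_fourier.
Context {R : realType}.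
Variables (s : R) (s_gt0 : 0 < s).
Notation mu := (@lebesgue_measure R).
Notation phi := (normal_pdf 0 s).

Let s0 : s != 0. Proof. by rewrite gt_eqF. Qed.

Lemma normal_pdf0E x : phi x = normal_peak s * expR (- x ^+ 2 / (s ^+ 2 *+ 2)).
Proof. by rewrite normal_pdfE// /normal_fun subr0. Qed.

Lemma is_derive_normal_pdf (x : R) : is_derive x 1 phi (- (x / s ^+ 2 * phi x)).
Proof.
pose k := - (s ^+ 2 *+ 2)^-1.
rewrite (_ : normal_pdf 0 s = fun x => normal_peak s * expR (k * x ^+ 2)); last first.
  by apply/funext => y; rewrite normal_pdf0E /k; congr (_ * expR _); rewrite !mulNr mulrC.
have := is_derive_mul (is_derive_cst (normal_peak s) x 1)
  (is_derive_compose (is_derive_sqr k x) (is_derive_expR _)).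
move/is_derive_eq; apply.
by rewrite /cst /k -(mulr_natr (s ^+ 2)); field.
Qed.

(** Doubling the variance absorbs the factor |x|: if r = |x| / (2 s), then
    2 r <= 1 + r^2 <= exp (r^2). *)
Lemma normr_normal_fun_le (x : R) :
  `|x| * normal_fun 0 s x <= s * normal_fun 0 (Num.sqrt 2 * s) x.
Proof.
rewrite /normal_fun subr0 exprMn sqr_sqrtr//.
have s2 : s ^+ 2 != 0 by rewrite expf_neq0.
have -> : - x ^+ 2 / (s ^+ 2 *+ 2) =
    - x ^+ 2 / ((2 * s ^+ 2) *+ 2) - x ^+ 2 / (4 * s ^+ 2).
  by rewrite -(mulr_natr (s ^+ 2)) -(mulr_natr (2 * _)); field.
rewrite expRD mulrCA mulrC ler_wpM2r ?expR_ge0//.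
rewrite expRN ler_pdivrMr ?expR_gt0// mulrC.
have := expR_ge1Dx (x ^+ 2 / (4 * s ^+ 2)).
have -> : x ^+ 2 / (4 * s ^+ 2) = (`|x| / (2 * s)) ^+ 2.
  by rewrite expr_div_n real_normK ?num_real// exprMn; congr (_ / (_ * _)); ring.
set v := expR _; set r := `|x| / (2 * s) => h.
have -> : `|x| = s * (2 * r) by rewrite /r; field.
rewrite [v * s]mulrC ler_wpM2l ?(ltW s_gt0)// (le_trans _ h)//.
by have := sqr_ge0 (r - 1); nra.
Qed.

Lemma integrable_normr_normal_pdf :
  mu.-integrable [set: R] (EFin \o (fun x => `|x| * phi x)).
Proof.
have s20 : Num.sqrt 2 * s != 0 :> R by rewrite mulf_neq0// gt_eqF// sqrtr_gt0.
pose k := normal_peak s * s / normal_peak (Num.sqrt 2 * s).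
have pk : 0 < normal_peak (Num.sqrt 2 * s) by rewrite normal_peak_gt0.
have ig : mu.-integrable [set: R] (EFin \o (fun x => k * normal_pdf 0 (Num.sqrt 2 * s) x)).
  rewrite (_ : EFin \o _ = (fun x => k%:E * (normal_pdf 0 (Num.sqrt 2 * s) x)%:E)%E)//.
  by apply: integrableZl => //; exact: integrable_normal_pdf.
apply: le_integrable ig => //.
  apply/measurable_EFinP/measurable_funM => //; exact: measurable_normal_pdf.
move=> x _ /=; rewrite lee_fin ger0_norm ?mulr_ge0 ?normal_pdf_ge0//.
rewrite (le_trans _ (ler_norm _))// !normal_pdfE//.
have -> : k * (normal_peak (Num.sqrt 2 * s) * normal_fun 0 (Num.sqrt 2 * s) x) =
   normal_peak s * (s * normal_fun 0 (Num.sqrt 2 * s) x).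
  by rewrite /k; field; rewrite gt_eqF.
by rewrite mulrCA ler_wpM2l ?normal_peak_ge0// normr_normal_fun_le.
Qed.

Lemma normr_normal_pdf_le (x : R) : `|x| * phi x <= normal_peak s * s.
Proof.
rewrite normal_pdfE// mulrCA ler_wpM2l ?normal_peak_ge0//.
rewrite (le_trans (normr_normal_fun_le x))// ler_piMr ?(ltW s_gt0)//.
rewrite /normal_fun -[leRHS]expR0 ler_expR mulNr oppr_le0 mulr_ge0 ?sqr_ge0//.
by rewrite invr_ge0 mulrn_wge0// sqr_ge0.
Qed.

Lemma integrable_bounded_normal_pdf (f : R -> R) : bmeas f ->
  mu.-integrable [set: R] (EFin \o (fun x => f x * phi x)).
Proof.
move=> [mf [K fK]].
have ig : mu.-integrable [set: R] (EFin \o (fun x => K * phi x)).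
  rewrite (_ : EFin \o _ = (fun x => K%:E * (phi x)%:E)%E)//.
  by apply: integrableZl => //; exact: integrable_normal_pdf.
apply: le_integrable ig => //.
  apply/measurable_EFinP/measurable_funM => //; exact: measurable_normal_pdf.
move=> x _ /=; rewrite lee_fin !normrM ler_wpM2r// (le_trans (fK x))//.
exact: ler_norm.
Qed.

(** The density is the Radon-Nikodym derivative of the normal law, which is
    unique up to a negligible set. *)
Lemma expect_normal (f : R -> R) : bmeas f ->
  \int[normal_prob 0 s]_x f x = \int[mu]_x (f x * phi x).
Proof.
move=> bf; rewrite /Rintegral; congr fine.
have bi := bmeas_integrable (normal_prob 0 s) bf.
rewrite -(Radon_Nikodym_change_of_variables (normal_prob_dominates 0 s))//=.
under [RHS]eq_integral do rewrite EFinM.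
apply: ae_eq_integral => //.
- apply: emeasurable_funM => //; first by apply/measurable_EFinP; case: bf.
  apply: (measurable_int mu).
  by apply: Radon_Nikodym_integrable; exact: normal_prob_dominates.
- apply: emeasurable_funM => //=; first by apply/measurable_EFinP; case: bf.
  by apply/measurable_EFinP; exact: measurable_normal_pdf.
- apply: ae_eqe_mul2l => /=.
  rewrite Radon_NikodymE//=; first exact: normal_prob_dominates.
  move=> abmu; case: cid => /= h [h1 h2 h3].
  apply: integral_ae_eq => //=.
  + by apply/measurable_EFinP; exact: measurable_normal_pdf.
  + by move=> E E01 mE; rewrite -h3.
Qed.

Section ode.
Variable c : R.

Let bsin (u : R) : bmeas (fun x : R => sin (u * x + c)).
Proof.
split; last by exists 1 => x; exact: sin_max.
apply: measurableT_comp; first by apply: continuous_measurable_fun; exact: continuous_sin.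
by apply: measurable_funD => //; exact: measurable_funM.
Qed.

Let bcos (u : R) : bmeas (fun x : R => cos (u * x + c)).
Proof. by apply: bmeas_cos; apply: measurable_funD => //; exact: measurable_funM. Qed.

Let isin (u : R) : mu.-integrable [set: R]
  (EFin \o (fun x => x * sin (u * x + c) * phi x)).
Proof.
apply: le_integrable integrable_normr_normal_pdf => //.
  apply/measurable_EFinP/measurable_funM; last exact: measurable_normal_pdf.
  by apply: measurable_funM => //; case: (bsin u).
move=> x _ /=; rewrite lee_fin !normrM normr_id ler_wpM2r//.
by rewrite ler_piMr// sin_max.
Qed.

Let icos (u : R) := integrable_bounded_normal_pdf (bcos u).

(** The phase c covers the cosine and the sine transforms at once, in place of
    complex exponentials. *)
Definition gcos (u : R) := \int[mu]_x (cos (u * x + c) * phi x).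

(** Since phi' x = - x phi x / s^2, both sides come from the integral of the
    derivative of sin (u x + c) phi x, which is zero because |x| phi x is
    bounded. *)
Lemma integral_by_parts_gauss (u : R) :
  \int[mu]_x (x * sin (u * x + c) * phi x) = s ^+ 2 * u * gcos u.
Proof.
pose g x := sin (u * x + c) * phi x.
pose g' x := u * (cos (u * x + c) * phi x) - (s ^+ 2)^-1 * (x * sin (u * x + c) * phi x).
have dg (x : R) : is_derive x 1 g (g' x).
  have d1 := is_derive_normal_pdf x.
  have := is_derive_mul (is_derive_compose (is_derive_affine u c x) (is_derive_sin _)) d1.
  move/is_derive_eq; apply.
  by rewrite /g'; field.
have ig' : mu.-integrable [set: R] (EFin \o g').
  rewrite (_ : EFin \o g' = (fun x => (u%:E * (cos (u * x + c) * phi x)%:E) -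
     ((s ^+ 2)^-1%:E * (x * sin (u * x + c) * phi x)%:E))%E)//.
  by apply: integrableB => //; apply: integrableZl => //; [exact: icos|exact: isin].
have cg' : continuous g'.
  move=> x; apply: cvgB.
    apply: cvgM; first exact: cvg_cst.
    apply: cvgM; last exact: continuous_normal_pdf.
    apply: (@continuous_comp _ _ _ (fun x : R => u * x + c) cos); last exact: continuous_cos.
    by apply: cvgD; [apply: cvgM; [exact: cvg_cst|exact: cvg_id]|exact: cvg_cst].
  apply: cvgM; first exact: cvg_cst.
  apply: cvgM; last exact: continuous_normal_pdf.
  apply: cvgM; first exact: cvg_id.
  apply: (@continuous_comp _ _ _ (fun x : R => u * x + c) sin); last exact: continuous_sin.
  by apply: cvgD; [apply: cvgM; [exact: cvg_cst|exact: cvg_id]|exact: cvg_cst].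
have FTC n : (\int[mu]_(x in `[(- n.+1%:R)%R, n.+1%:R]) (g' x)%:E =
    (g n.+1%:R - g (- n.+1%:R))%:E)%E.
  rewrite (@continuous_FTC2 _ g' g) ?EFinB//.
  - by rewrite -subr_gt0 opprK addr_gt0.
  - by apply: continuous_subspaceT => x; exact: cg'.
  - have cg x : {for x, continuous g}.
      by apply/differentiable_continuous/derivable1_diffP; exact: ex_derive.
    split.
    + by move=> x _; exact: ex_derive.
    + exact/cvg_at_right_filter/cg.
    + exact/cvg_at_left_filter/cg.
  - by move=> x _; rewrite derive1E derive_val.
have lim1 : (\int[mu]_(x in `[(- n.+1%:R)%R, n.+1%:R]) (g' x)%:E)%E @[n --> \oo]
     --> (\int[mu]_x (g' x)%:E)%E.
  under eq_fun do rewrite integral_mkcond.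
  apply: (@dominated_cvg _ _ _ mu [set: R] measurableT _ _ (abse \o (EFin \o g'))) => //.
  - move=> n; apply/(measurable_restrictT _ _).1 => //; apply: measurable_funTS; exact: (measurable_int mu ig').
  - move=> x _; apply: cvg_near_cst.
    exists (Num.truncn `|x|).+1 => // n /= hn; rewrite patchE mem_set//= in_itv/= -ler_norml.
    by apply: ltW; apply: (lt_le_trans (truncnS_gt _)); rewrite ler_nat ltnW// ltnS.
  - exact: (integrable_abse ig').
  - move=> n x _ /=; rewrite patchE; case: ifP => // _.
    by rewrite abse0.
have lim2 : (\int[mu]_(x in `[(- n.+1%:R)%R, n.+1%:R]) (g' x)%:E)%E @[n --> \oo] --> 0%E.
  under eq_fun do rewrite FTC.
  apply: cvg_EFin; first by apply: nearW.
  have lim3 : (2 * (normal_peak s * s)) * n.+1%:R^-1 @[n --> \oo] --> (0 : R).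
    rewrite -[X in _ --> X](mulr0 (2 * (normal_peak s * s))).
    by apply: cvgM; [exact: cvg_cst|exact: cvg_harmonic].
  apply: (@squeeze_cvgr _ _ _ _ (fun n => - ((2 * (normal_peak s * s)) * n.+1%:R^-1))
     (fun n => (2 * (normal_peak s * s)) * n.+1%:R^-1)) => //; last first.
    by rewrite -[X in _ --> X]oppr0; exact: cvgN.
  apply: nearW => n; rewrite -ler_norml /=.
  have n0 : 0 < n.+1%:R :> R by [].
  have gb x : `|x| = n.+1%:R -> `|g x| <= normal_peak s * s / n.+1%:R.
    move=> xn; rewrite ler_pdivlMr// normrM mulrAC (ger0_norm (normal_pdf_ge0 _ _ _)).
    have := normr_normal_pdf_le x; rewrite xn => h.
    rewrite -mulrA (le_trans _ h)// ler_piMl ?sin_max//.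
    by rewrite mulr_ge0// normal_pdf_ge0.
  rewrite (le_trans (ler_normB _ _))// -mulrA mulrDl mul1r lerD//; apply: gb;
    by rewrite ?normrN gtr0_norm.
have E := cvg_unique (@ereal_hausdorff R) lim1 lim2.
have : \int[mu]_x g' x = 0 by rewrite /Rintegral E.
rewrite /g' RintegralB//; last 2 first.
  rewrite (_ : EFin \o _ = (fun x => (u%:E * (cos (u * x + c) * phi x)%:E))%E)//.
  by apply: integrableZl => //; exact: icos.
  rewrite (_ : EFin \o _ = (fun x => ((s ^+ 2)^-1%:E * (x * sin (u * x + c) * phi x)%:E))%E)//.
  by apply: integrableZl => //; exact: isin.
have := @RintegralZl _ _ _ mu _ _ u measurableT (icos u) => ->.
have := @RintegralZl _ _ _ mu _ _ (s ^+ 2)^-1 measurableT (isin u) => ->.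
rewrite -/(gcos u) => /eqP; rewrite subr_eq0 => /eqP H.
by rewrite -mulrA H mulrA mulfV ?mul1r// expf_neq0.
Qed.

(** Differentiation under the integral sign, dominated by |x| phi x. *)
Lemma is_derive_gcos (u : R) : is_derive u 1 gcos (- (s ^+ 2 * u * gcos u)).
Proof.
pose f (u x : R) := cos (u * x + c) * phi x.
have df (v x : R) : is_derive v 1 (f ^~ x) (- (x * sin (v * x + c) * phi x)).
  have da : is_derive v 1 (fun t => t * x + c) x.
    by rewrite (_ : (fun t => _) = fun t => x * t + c);
      [exact: is_derive_affine|apply/funext => t; rewrite mulrC].
  have := is_derive_mul (is_derive_compose da (is_derive_cos _)) (is_derive_cst (phi x) v 1).
  move/is_derive_eq; apply.
  by rewrite /cst; ring.
have Iu : u \in `](u - 1), (u + 1)[ by rewrite in_itv/= ltrBlDr ltrDl ltr01.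
have H1 x : `](u - 1), (u + 1)[%classic x -> mu.-integrable [set: R] (EFin \o f x).
  by move=> _; exact: icos.
have H2 v x : `](u - 1), (u + 1)[%classic v -> [set: R] x -> derivable (f ^~ x) v 1.
  by move=> _ _; exact: ex_derive.
have H3 (x : R) : 0 <= `|x| * phi x by rewrite mulr_ge0// normal_pdf_ge0.
have H4 v x : `](u - 1), (u + 1)[%classic v -> [set: R] x ->
    `|partial1of2 f v x| <= `|x| * phi x.
  move=> _ _; rewrite partial1of2E derive_val normrN !normrM.
  rewrite (ger0_norm (normal_pdf_ge0 _ _ _)) ler_wpM2r ?normal_pdf_ge0//.
  by rewrite ler_piMr// sin_max.
have D1 := @derivable_under_integral _ _ _ mu f _ measurableT _ _ _ Iu H1 H2 _ H3
  integrable_normr_normal_pdf H4.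
have D2 := @differentiation_under_integral _ _ _ mu f _ measurableT _ _ _ Iu H1 H2 _ H3
  integrable_normr_normal_pdf H4.
apply: DeriveDef => //.
rewrite -derive1E /gcos D2 -integral_by_parts_gauss.
rewrite -mulN1r; have := @RintegralZl _ _ _ mu _ _ (-1) measurableT (isin u) => <-.
apply: eq_Rintegral => x _ /=.
by rewrite partial1of2E derive_val mulN1r.
Qed.

(** By [is_derive_gcos] the product of gcos u and exp (s^2 u^2 / 2) has zero
    derivative. *)
Lemma gcosE (u : R) : gcos u = expR (- (s ^+ 2 * u ^+ 2 / 2)) * cos c.
Proof.
pose k (v : R) := expR (s ^+ 2 * v ^+ 2 / 2) * gcos v.
have dk (v : R) : is_derive v 1 k 0.
  have dg := is_derive_gcos v.
  have de : is_derive v 1 (fun v => s ^+ 2 * v ^+ 2 / 2) (s ^+ 2 * v).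
    rewrite (_ : (fun t => _) = fun t => s ^+ 2 / 2 * t ^+ 2); last by apply/funext => t; ring.
    by apply: (is_derive_eq (is_derive_sqr _ _)); field.
  have := is_derive_mul (is_derive_compose de (is_derive_expR _)) dg.
  move/is_derive_eq; apply; ring.
have kc : k u = k 0.
  by apply: is_derive_0_is_cst.
have -> : gcos u = expR (- (s ^+ 2 * u ^+ 2 / 2)) * k u.
  by rewrite /k mulrA -expRD addNr expR0 mul1r.
rewrite kc /k expr0n/= mulr0 mul0r expR0 mul1r /gcos; congr (_ * _).
under eq_Rintegral do rewrite mul0r add0r.
rewrite RintegralZl//; last exact: integrable_normal_pdf.
by rewrite /Rintegral integral_normal_pdf/= mulr1.
Qed.

End ode.

Lemma expect_cos_normal (u c : R) :
  \int[normal_prob 0 s]_x cos (u * x + c) = expR (- (s ^+ 2 * u ^+ 2 / 2)) * cos c.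
Proof.
rewrite expect_normal; first exact: gcosE.
by apply: bmeas_cos; apply: measurable_funD => //; exact: measurable_funM.
Qed.

End gaussian_fourier.

(** * Laws of tuples of i.i.d. observations *)

Section tuple_laws.
Context d (S : measurableType d) {R : realType}.

Definition boxes n : set (set (n.-tuple S)) :=
  [set B | exists2 A : 'I_n -> set S, (forall i, measurable (A i)) &
    B = [set t | forall i, A i (tnth t i)]].

Lemma measurable_box n (A : 'I_n -> set S) : (forall i, measurable (A i)) ->
  measurable [set t : n.-tuple S | forall i, A i (tnth t i)].
Proof.
move=> mA.
rewrite (_ : [set t | _] = \bigcap_(i in [set: 'I_n]) ((fun t : n.-tuple S => tnth t i) @^-1` A i)).
  apply: fin_bigcap_measurable; first exact: finite_finset.
  move=> i _; rewrite -[X in measurable X]setTI; exact: measurable_tnth.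
by apply/seteqP; split => [t h i _|t h i]; [exact: h|exact: (h i I)].
Qed.

(** Boxes are stable under intersection and generate the product
    sigma-algebra. *)
Lemma measure_unique_boxes n (m1 m2 : probability (n.-tuple S) R) :
  (forall A : 'I_n -> set S, (forall i, measurable (A i)) ->
    m1 [set t | forall i, A i (tnth t i)] = m2 [set t | forall i, A i (tnth t i)]) ->
  forall B, measurable B -> m1 B = m2 B.
Proof.
move=> m12 B mB.
apply: (@measure_unique _ _ _ (@boxes n) (fun=> setT)) => //.
- apply/seteqP; split; last first.
    apply: smallest_sub; first exact: sigma_algebra_measurable.
    by move=> _ [A mA ->]; exact: measurable_box.
  apply: smallest_sub; first exact: smallest_sigma_algebra.
  move=> C; rewrite -bigcup_seq => -[/= i _ [D mD <-]].
  apply: sub_sigma_algebra; exists (fun j => if j == i then D else setT).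
    by move=> j; case: ifP.
  apply/seteqP; split => [t [_ /= Dt] j|t /= h].
    by case: eqVneq => // ->.
  by split => //; have := h i; rewrite eqxx.
- move=> _ _ [A1 mA1 ->] [A2 mA2 ->]; exists (fun i => A1 i `&` A2 i).
    by move=> i; exact: measurableI.
  apply/seteqP; split => [t [h1 h2] i|t h]; first by split.
  by split => i; have [] := h i.
- by move=> i; exists (fun=> setT) => //; apply/seteqP; split.
- by apply/seteqP; split => // t _; exists 0%N.
- by move=> _ [A mA ->]; exact: m12.
- by move=> _; rewrite -ge0_fin_numE// fin_num_measure.
Qed.

Definition cons_tuple_pair n (p : S * n.-tuple S) : n.+1.-tuple S :=
  [tuple of p.1 :: p.2].

Lemma measurable_cons_tuple_pair n : measurable_fun [set: _] (@cons_tuple_pair n).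
Proof. exact: measurable_cons. Qed.

HB.instance Definition _ n :=
  isMeasurableFun.Build _ _ _ _ (@cons_tuple_pair n) (@measurable_cons_tuple_pair n).

Variable mu : probability S R.

(** Adding one coordinate at a time makes expectations computable by
    recursion on n. *)
Fixpoint iid_law n : probability (n.-tuple S) R :=
  if n is m.+1 then distribution (mu \x iid_law m)%E (@cons_tuple_pair m)
  else dirac [tuple].

Lemma iid_law_box n (A : 'I_n -> set S) : (forall i, measurable (A i)) ->
  iid_law n [set t | forall i, A i (tnth t i)] = (\prod_(i < n) mu (A i))%E.
Proof.
elim: n A => [|n IH] A mA /=.
  by rewrite big_ord0 diracE mem_set//= => -[].
rewrite /distribution /pushforward big_ord_recl.
rewrite (_ : _ @^-1` _ = A ord0 `*` [set t | forall i, A (lift ord0 i) (tnth t i)]).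
  rewrite [LHS](product_measure1E mu (iid_law n))//; last by apply: (measurable_box (A := fun i => A (lift ord0 i))) => i; exact: mA.
  by congr (_ * _)%E; exact: (IH (fun i => A (lift ord0 i)) (fun i => mA _)).
apply/seteqP; split => [[x t] /= h|[x t] /= [h0 h] i].
  by split => [|i]; [exact: (h ord0)|have := h (lift ord0 i); rewrite tnthS].
by case: (unliftP ord0 i) => [j ->|->//]; rewrite tnthS.
Qed.

Lemma expect_iid_lawS n (F : n.+1.-tuple S -> R) : bmeas F ->
  \int[iid_law n.+1]_t F t = \int[iid_law n]_t \int[mu]_x F [tuple of x :: t].
Proof.
move=> bF; have bF2 : bmeas (F \o @cons_tuple_pair n).
  exact: bmeas_comp bF (@measurable_cons_tuple_pair n).
have intF := bmeas_integrable (mu \x iid_law n)%E bF2.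
rewrite /= expect_image// /Rintegral -(integral21_prod_meas1 intF); congr fine.
apply: eq_integral => t _; rewrite /fubini_G /=.
exact: (expectE mu (bmeas_comp bF2 (measurable_pair2 t))).
Qed.

Lemma bmeas_expect_cons n (F : n.+1.-tuple S -> R) : bmeas F ->
  bmeas (fun t : n.-tuple S => \int[mu]_x F [tuple of x :: t]).
Proof.
move=> bF; have bF2 : bmeas (F \o @cons_tuple_pair n).
  exact: bmeas_comp bF (@measurable_cons_tuple_pair n).
exact: (bmeas_partial_expect mu bF2).
Qed.

Lemma integral_iid_lawS n (F : n.+1.-tuple S -> \bar R) :
  measurable_fun [set: n.+1.-tuple S] F -> (forall t, 0 <= F t)%E ->
  (\int[iid_law n.+1]_t F t = \int[iid_law n]_t \int[mu]_x F [tuple of x :: t])%E.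
Proof.
move=> mF F0; rewrite /= ge0_integral_distribution// fubini_tonelli2//; last by move=> ?; exact: F0.
by apply: measurableT_comp => //; exact: measurable_cons_tuple_pair.
Qed.

End tuple_laws.

Section sample.
Context d (S : measurableType d) {R : realType} d' (Omega : measurableType d').
Variables (P : probability Omega R) (X : nat -> Omega -> S).
Hypothesis mX : forall n, measurable_fun [set: Omega] (X n).

(** The map s selects the observations; as long as it is injective, the law of
    the tuple does not depend on it. This is exchangeability. *)
Definition sample n (s : 'I_n -> nat) (w : Omega) : n.-tuple S :=
  [tuple X (s i) w | i < n].

Lemma measurable_sample n (s : 'I_n -> nat) :
  measurable_fun [set: Omega] (@sample n s).
Proof.
apply/measurable_fun_tnthP => i.
by rewrite (_ : _ \o _ = X (s i))//; apply/funext => w /=; rewrite tnth_mktuple.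
Qed.

HB.instance Definition _ n (s : 'I_n -> nat) :=
  isMeasurableFun.Build _ _ _ _ (@sample n s) (@measurable_sample n s).

Let X0 : {mfun Omega >-> S} := mfun_Sub (mem_set (mX 0%N)).

Hypothesis iidX : iid P X.

Definition law0 : probability S R := distribution P X0.

(** Independence and identical distribution determine the mass of every box. *)
Lemma sample_law n (s : 'I_n -> nat) : injective s ->
  forall B, measurable B -> distribution P (@sample n s) B = iid_law law0 n B.
Proof.
move=> inj_s; apply: measure_unique_boxes => A mA.
rewrite iid_law_box//.
(* The side of the box that constrains the k-th observation, if any. *)
pose A' k := if [pick i | s i == k] is Some i then A i else setT.
have A'E i : A' (s i) = A i.
  rewrite /A'; case: pickP => [j /eqP/inj_s -> //|/(_ i)].
  by rewrite eqxx.
have mA' k : measurable (A' k) by rewrite /A'; case: pickP.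
have [idX indX] := iidX.
pose J := [fset s i | i in 'I_n]%fset.
transitivity (P (\bigcap_(j in [set` J]) (X j @^-1` A' j))).
  rewrite /distribution /pushforward; congr (P _).
  apply/seteqP; split => [w /= h _ /imfsetP[i _ ->]|w h i] /=.
    by rewrite A'E; have := h i; rewrite tnth_mktuple.
  rewrite tnth_mktuple -A'E; apply: (h (s i)).
  by rewrite /=; apply/imfsetP; exists i.
rewrite indX// big_imfset/=; last by move=> i j _ _; exact: inj_s.
rewrite big_enum/=; apply: eq_bigr => i _.
by rewrite A'E idX.
Qed.

Lemma expect_sample n (s : 'I_n -> nat) (F : n.-tuple S -> R) : injective s ->
  bmeas F -> \int[P]_w F (sample s w) = \int[iid_law law0 n]_t F t.
Proof.
move=> inj_s bF; rewrite -(expect_image P (sample s))//.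
rewrite /Rintegral; congr fine; apply: eq_measure_integral => B mB _.
exact: sample_law.
Qed.

End sample.

(** * Taylor bounds for the sine and the cosine *)

Section trigonometric_taylor.
Context {R : realType}.
Implicit Types y : R.

(** The mean value inequality, by which each Taylor bound below follows from
    the previous one. *)
Lemma le_norm_of_derive (f df : R -> R) (K y : R) : f 0 = 0 ->
  (forall t : R, is_derive t 1 f (df t)) -> (forall t : R, `|t| <= `|y| -> `|df t| <= K) ->
  `|f y| <= K * `|y|.
Proof.
move=> f0 fdf dfK.
have cf (t : R) : {for t, continuous f}.
  by apply/differentiable_continuous/derivable1_diffP; exact: ex_derive.
have cs (a b : R) : {within `[a, b], continuous f}.
  by apply: continuous_subspaceT => t; exact: cf.
have [y0|y0] := leP 0 y.
  have [c cy E] := @MVT_segment R f df 0 y y0 (fun t _ => fdf t) (cs _ _).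
  move: E; rewrite f0 !subr0 => ->; rewrite normrM ler_wpM2r// dfK//.
  move: cy; rewrite in_itv/= => /andP[c0 cy].
  by rewrite ger0_norm// ger0_norm.
have [c cy E] := @MVT_segment R f df y 0 (ltW y0) (fun t _ => fdf t) (cs _ _).
move: E; rewrite f0 !sub0r => E.
rewrite -normrN E normrM normrN ler_wpM2r// dfK//.
move: cy; rewrite in_itv/= => /andP[c0 cy].
by rewrite ler0_norm// ltr0_norm// lerN2.
Qed.

Lemma norm_sin_le y : `|sin y| <= `|y|.
Proof.
rewrite -[leRHS]mul1r; apply: (le_norm_of_derive (f := sin) (df := cos)); first exact: sin0.
by move=> t _; exact: cos_max.
Qed.

Lemma onem_cos_le y : 0 <= 1 - cos y <= y ^+ 2 / 2.
Proof.
have -> : 1 - cos y = 2 * sin (y / 2) ^+ 2.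
  have -> : cos y = cos ((y / 2) *+ 2) by congr cos; rewrite -mulr_natr; field.
  by rewrite cos_mulr2n cos2sin2 -[(1 - _) *+ 2]mulr_natr; ring.
rewrite mulr_ge0 ?sqr_ge0//=.
have : sin (y / 2) ^+ 2 <= (y / 2) ^+ 2.
  rewrite -[leLHS]real_normK ?num_real// -[leRHS]real_normK ?num_real//.
  by rewrite ler_sqr ?nnegrE// norm_sin_le.
by rewrite expr_div_n => h; lra.
Qed.

Lemma norm_sin_sub_le3 y : `|sin y - y| <= `|y| ^+ 3.
Proof.
have D (t : R) : is_derive t 1 (fun t => sin t - t) (cos t - 1).
  exact: (is_derive_add (is_derive_sin t) (is_deriveNid t 1)).
have f0 : (fun t => sin t - t) 0 = 0 :> R by rewrite sin0 subrr.
rewrite [leRHS]exprSr; apply: (le_norm_of_derive f0 D) => t ty.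
have /andP[h1 h2] := onem_cos_le t.
  rewrite distrC ger0_norm// (le_trans h2)//.
  have : `|t| ^+ 2 <= `|y| ^+ 2 by rewrite ler_sqr ?nnegrE.
  by rewrite -[t ^+ 2]real_normK ?num_real//; have := sqr_ge0 `|t|; lra.
Qed.

(** The cubic bound for |y| <= 1 and the triangle inequality beyond; being
    quadratic, it can be dominated by a second moment. *)
Lemma norm_sin_sub_le2 y : `|sin y - y| <= 2 * y ^+ 2.
Proof.
rewrite -[y ^+ 2]real_normK ?num_real//.
have n0 := normr_ge0 y.
have [y1|y1] := leP `|y| 1.
  by rewrite (le_trans (norm_sin_sub_le3 y))// exprS; nra.
by rewrite (le_trans (ler_normB _ _))//; have := norm_sin_le y; nra.
Qed.

Lemma norm_cos_taylor_le4 y : `|cos y - 1 + y ^+ 2 / 2| <= `|y| ^+ 4.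
Proof.
have D (t : R) : is_derive t 1 (fun t => cos t - 1 + t ^+ 2 / 2) (- sin t + t).
  rewrite (_ : (fun t => _) = (fun t => cos t + (2^-1 * t ^+ 2 + (-1)))); last first.
    by apply/funext => u; field.
  have d1 : is_derive t 1 (fun u => 2^-1 * u ^+ 2 + (-1)) (2^-1 * (2 * t) + 0).
    exact: (is_derive_add (is_derive_sqr 2^-1 t) (is_derive_cst (-1 : R) t 1)).
  have d2 : is_derive t 1 (fun u => cos u + (2^-1 * u ^+ 2 + (-1)))
      (- sin t + (2^-1 * (2 * t) + 0)).
    exact: (is_derive_add (is_derive_cos t) d1).
  by apply: (is_derive_eq d2); field.
have f0 : (fun t => cos t - 1 + t ^+ 2 / 2) 0 = 0 :> R.
  by rewrite cos0 subrr expr0n/= mul0r addr0.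
rewrite [leRHS]exprSr; apply: (le_norm_of_derive f0 D) => t ty.
rewrite addrC -opprB normrN (le_trans (norm_sin_sub_le3 t))//.
  by rewrite lerXn2r ?nnegrE.
Qed.

Lemma norm_cos_taylor_le2 y : `|cos y - 1 + y ^+ 2 / 2| <= y ^+ 2.
Proof.
have /andP[h1 h2] := onem_cos_le y; have := sqr_ge0 y => h3.
by rewrite ler_norml; apply/andP; split; lra.
Qed.

Lemma norm_cos_sub_le (s t : R) : `|cos s - cos t| <= `|s - t|.
Proof.
pose f r := cos (r + t) - cos t.
have D (r : R) : is_derive r 1 f (- sin (r + t)).
  have d1 : is_derive r 1 (fun r => r + t) (1 + 0).
    exact: (is_derive_add (is_derive_id r 1) (is_derive_cst t r 1)).
  rewrite addr0 in d1.
  have d2 := is_derive_compose d1 (is_derive_cos (r + t)).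
  have d3 := is_derive_add d2 (is_derive_cst (- cos t : R) r 1).
  by apply: (is_derive_eq d3); rewrite mulr1 addr0.
have f0 : f 0 = 0 by rewrite /f add0r subrr.
have := @le_norm_of_derive f _ 1 (s - t) f0 D.
rewrite /f subrK mul1r; apply => r _.
by rewrite normrN sin_max.
Qed.

End trigonometric_taylor.

Section power_limit.
Context {R : realType}.

(** The inequality 1 + x <= exp x at x = - w and at x = w / (1 - w). *)
Lemma onem_pow_bounds (w : R) n : 0 <= w -> w < 1 ->
  expR (- (n%:R * (w / (1 - w)))) <= (1 - w) ^+ n <= expR (- (n%:R * w)).
Proof.
move=> w0 w1; have w1' : 0 < 1 - w by rewrite subr_gt0.
have E (x : R) : expR (- (n%:R * x)) = expR (- x) ^+ n by rewrite -mulrN expRM_natl.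
rewrite !E; apply/andP; split; last first.
  by apply: lerXn2r; rewrite ?nnegrE ?expR_ge0 ?(ltW w1')//; exact: expR_ge1Dx.
apply: lerXn2r; rewrite ?nnegrE ?expR_ge0 ?(ltW w1')//.
rewrite expRN -[leRHS]invrK lef_pV2 ?posrE ?expR_gt0 ?invr_gt0//.
have Ei : (1 - w)^-1 = 1 + w / (1 - w) by field; rewrite gt_eqF.
by rewrite {1}Ei; exact: expR_ge1Dx.
Qed.

Lemma cvg_onem_pow (w : nat -> R) (m : nat -> nat) (l : R) :
  (forall n, 0 <= w n) -> w n @[n --> \oo] --> 0 ->
  (m n)%:R * w n @[n --> \oo] --> l ->
  (1 - w n) ^+ m n @[n --> \oo] --> expR (- l).
Proof.
move=> w0 cw cmw.
have w1 : \forall n \near \oo, w n < 1 by exact: (cvgr_lt 0).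
apply: (@squeeze_cvgr _ _ _ _ (fun n => expR (- ((m n)%:R * (w n / (1 - w n)))))
   (fun n => expR (- ((m n)%:R * w n)))).
- near=> n; apply: onem_pow_bounds => //; near: n; exact: w1.
- apply: continuous_cvg; first exact: continuous_expR.
  apply: cvgN.
  have H : ((m n)%:R * w n) * (1 - w n)^-1 @[n --> \oo] --> l * (1 - 0)^-1.
    apply: cvgM => //; apply: cvgV; first by rewrite subr0.
    by apply: cvgB => //; exact: cvg_cst.
  by move: H; rewrite subr0 invr1 mulr1; under eq_fun do rewrite -mulrA.
- apply: continuous_cvg; first exact: continuous_expR.
  exact: cvgN.
Unshelve. all: by end_near. Qed.

End power_limit.

(** * Sums of centred square-integrable variables *)

Section centred_sums.
Context d (S : measurableType d) {R : realType} (mu : probability S R).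
Variable f : S -> R.
Hypotheses (mf : measurable_fun [set: S] f)
  (f2 : mu.-integrable [set: S] (EFin \o (fun x => f x ^+ 2)))
  (f0 : \int[mu]_x f x = 0).

Let v := \int[mu]_x (f x ^+ 2).

Lemma integrable_of_sqr : mu.-integrable [set: S] (EFin \o f).
Proof.
have i1 : mu.-integrable [set: S] (EFin \o (fun x => 1 + f x ^+ 2)).
  rewrite (_ : EFin \o _ = (fun x => 1%:E + (f x ^+ 2)%:E)%E)//.
  by apply: integrableD => //; exact: (bmeas_integrable mu (bmeas_cst 1)).
apply: le_integrable i1 => //; first exact/measurable_EFinP.
move=> x _ /=; rewrite lee_fin [leRHS]ger0_norm ?addr_ge0 ?sqr_ge0//.
rewrite -[f x ^+ 2]real_normK ?num_real//.
by have := normr_ge0 (f x); have := sqr_ge0 (`|f x| - 1); nra.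
Qed.

Lemma variance_centred_ge0 : 0 <= v.
Proof. by apply: Rintegral_ge0 => x _; exact: sqr_ge0. Qed.

Definition tsum n (t : n.-tuple S) := \sum_(i < n) f (tnth t i).

Lemma measurable_tsum n : measurable_fun [set: n.-tuple S] (@tsum n).
Proof.
apply: measurable_sum => i; apply: (measurableT_comp mf).
exact: measurable_tnth.
Qed.

Lemma tsum_cons n x (t : n.-tuple S) : tsum [tuple of x :: t] = f x + tsum t.
Proof.
rewrite /tsum big_ord_recl; congr (_ + _).
by apply: eq_bigr => i _; rewrite tnthS.
Qed.

(** The cross terms vanish because f is centred. *)
Lemma integral_tsum_sqr n :
  (\int[iid_law mu n]_t (tsum t ^+ 2)%:E = (n%:R * v)%:E)%E.
Proof.
elim: n => [|n IH].
  rewrite mul0r; under eq_integral do rewrite /tsum big_ord0 expr0n/=.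
  by rewrite integral0.
rewrite integral_iid_lawS; last 2 first.
- apply/measurable_EFinP; apply: measurable_funX; exact: measurable_tsum.
- by move=> t; rewrite lee_fin sqr_ge0.
rewrite (eq_integral (fun t : n.-tuple S => v%:E + (tsum t ^+ 2)%:E)%E).
  rewrite ge0_integralD//.
  - rewrite integral_cst//= probability_setT mule1 IH -EFinD; congr EFin.
    by rewrite -natr1; ring.
  - by move=> t _; rewrite lee_fin variance_centred_ge0.
  - by move=> t _; rewrite lee_fin sqr_ge0.
  - by apply/measurable_EFinP; apply: measurable_funX; exact: measurable_tsum.
move=> t _.
have iA : mu.-integrable [set: S] (EFin \o (fun x => 2 * tsum t * f x)).
  rewrite (_ : EFin \o _ = (fun x => (2 * tsum t)%:E * (f x)%:E)%E)//.
  by apply: integrableZl => //; exact: integrable_of_sqr.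
have iC : mu.-integrable [set: S] (EFin \o (fun x : S => tsum t ^+ 2)).
  exact: (bmeas_integrable mu (bmeas_cst _)).
have iB : mu.-integrable [set: S] (EFin \o (fun x => 2 * tsum t * f x + tsum t ^+ 2)).
  by rewrite (_ : EFin \o _ = (fun x => (2 * tsum t * f x)%:E + (tsum t ^+ 2)%:E)%E)//;
    exact: integrableD.
have E : \int[mu]_x (f x ^+ 2 + (2 * tsum t * f x + tsum t ^+ 2)) = v + tsum t ^+ 2.
  rewrite RintegralD// RintegralD// RintegralZl//; last exact: integrable_of_sqr.
  by rewrite f0 mulr0 add0r expect_cst.
rewrite -EFinD -E /Rintegral fineK.
  apply: eq_integral => x _; rewrite tsum_cons; congr EFin; ring.
apply: integrable_fin_num => //.
rewrite (_ : (fun x => _) = (fun x => (f x ^+ 2)%:E + (2 * tsum t * f x + tsum t ^+ 2)%:E)%E)//.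
exact: integrableD.
Qed.

(** Chebyshev's inequality. *)
Lemma tail_tsum n (K : R) : 0 < K ->
  fine (iid_law mu n [set t | K <= `|tsum t|]) <= n%:R * v / K ^+ 2.
Proof.
move=> K0.
have mt : measurable_fun [set: n.-tuple S] (fun t => `|tsum t|).
  by apply: measurableT_comp => //; exact: measurable_tsum.
have mA : measurable [set t : n.-tuple S | K <= `|tsum t|].
  exact: measurable_le_set.
have H : ((K ^+ 2)%:E * iid_law mu n [set t | (K <= `|tsum t|)%R] <= (n%:R * v)%:E)%E.
  have -> : iid_law mu n [set t | K <= `|tsum t|] =
      (\int[iid_law mu n]_t (\1_[set t | (K <= `|tsum t|)%R] t)%:E)%E.
    by rewrite integral_indic// setIT.
  rewrite -integral_tsum_sqr.
  rewrite -ge0_integralZl//; last 2 first.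
    by apply/measurable_EFinP; exact: measurable_indic.
    by rewrite lee_fin sqr_ge0.
  apply: ge0_le_integral => //.
  - by move=> t _; rewrite mule_ge0// lee_fin sqr_ge0.
  - by apply: measurable_funeM; apply/measurable_EFinP; exact: measurable_indic.
  - by apply/measurable_EFinP; apply: measurable_funX; exact: measurable_tsum.
  - move=> t _; rewrite indicE -EFinM lee_fin.
    have [/set_mem/= Kt|_] := boolP (_ \in _); last by rewrite mulr0 sqr_ge0.
    rewrite mulr1 -[leRHS]real_normK ?num_real// ler_sqr ?nnegrE// ltW//.
rewrite ler_pdivlMr ?exprn_gt0// -lee_fin mulrC EFinM fineK//.
exact: fin_num_measure.
Qed.

(** The quartic Taylor bound gives pointwise convergence of the integrands, the
    quadratic one dominates them by f^2. *)
Lemma cvg_cos_taylor (h : nat -> R) : h n @[n --> \oo] --> 0 -> (forall n, h n != 0) ->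
  (\int[mu]_x cos (h n * f x) - 1 + h n ^+ 2 * v / 2) / h n ^+ 2 @[n --> \oo] --> 0.
Proof.
move=> ch h0.
pose G n x := (cos (h n * f x) - 1 + (h n * f x) ^+ 2 / 2) / h n ^+ 2.
have bc n : bmeas (fun x => cos (h n * f x)) by apply: bmeas_cos; exact: measurable_funM.
have GE n : (\int[mu]_x cos (h n * f x) - 1 + h n ^+ 2 * v / 2) / h n ^+ 2 =
    \int[mu]_x G n x.
  have i1 : mu.-integrable [set: S] (EFin \o (fun x => cos (h n * f x) - 1)).
    by apply: bmeas_integrable; apply: bmeasB => //; exact: bmeas_cst.
  have i2 : mu.-integrable [set: S] (EFin \o (fun x => h n ^+ 2 / 2 * f x ^+ 2)).
    rewrite (_ : EFin \o _ = (fun x => (h n ^+ 2 / 2)%:E * (f x ^+ 2)%:E)%E)//.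
    exact: integrableZl.
  rewrite /G; under [RHS]eq_Rintegral do rewrite exprMn [h n ^+ 2 * _ / 2]mulrAC.
  rewrite RintegralZr//; last exact: (integrableD measurableT i1 i2).
  congr (_ / _); rewrite RintegralD// RintegralZl// expectB//; last exact: bmeas_cst.
  by rewrite expect_cst mulrAC.
under eq_fun do rewrite GE.
have mG n : measurable_fun [set: S] (G n).
  apply: measurable_funM => //; apply: measurable_funD.
    by apply: measurable_funB => //; case: (bc n).
  by apply: measurable_funM => //; apply: measurable_funX; exact: measurable_funM.
suff H : (\int[mu]_x (G n x)%:E)%E @[n --> \oo] --> 0%:E by exact: (fine_cvg H).
have <- : (\int[mu]_(x in [set: S]) (cst 0%E x : \bar R) = 0%:E)%E by exact: integral0.
apply: (@dominated_cvg _ _ _ mu [set: S] measurableT (fun n => EFin \o G n) _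
  (EFin \o (fun x => f x ^+ 2))) => //.
- by move=> n; exact/measurable_EFinP.
- move=> x _; apply: cvg_EFin; first by apply: nearW.
  have lim : `|h n| ^+ 2 * `|f x| ^+ 4 @[n --> \oo] --> 0.
    have c4 : (fun _ : nat => `|f x| ^+ 4) @ \oo --> `|f x| ^+ 4 by exact: cvg_cst.
    have H : `|h n| * `|h n| * `|f x| ^+ 4 @[n --> \oo] --> `|0 : R| * `|0 : R| * `|f x| ^+ 4.
      exact: (cvgM (cvgM (cvg_norm ch) (cvg_norm ch)) c4).
    rewrite (_ : (fun n => _) = (fun n => `|h n| * `|h n| * `|f x| ^+ 4)).
      by rewrite normr0 !mul0r in H.
    by apply/funext => n; rewrite expr2.
  apply: norm_cvg0; apply: (@squeeze_cvgr _ _ _ _ (fun=> 0)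
    (fun n => `|h n| ^+ 2 * `|f x| ^+ 4)) => //; last exact: cvg_cst.
  apply: nearW => n /=; rewrite normr_ge0/= /G normrM normfV normrX.
  have hn : 0 < `|h n| ^+ 2 by rewrite exprn_gt0// normr_gt0.
  rewrite ler_pdivrMr// (le_trans (norm_cos_taylor_le4 _))// normrM exprMn.
  by apply: le_of_eq; ring.
- move=> n x _ /=; rewrite lee_fin /G normrM normfV normrX.
  have hn : 0 < `|h n| ^+ 2 by rewrite exprn_gt0// normr_gt0.
  rewrite ler_pdivrMr// (le_trans (norm_cos_taylor_le2 _))//.
  by rewrite exprMn mulrC real_normK ?num_real.
Qed.

(** As for the cosine; the linear term disappears because f is centred. *)
Lemma cvg_sin_taylor (h : nat -> R) : h n @[n --> \oo] --> 0 -> (forall n, h n != 0) ->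
  (\int[mu]_x sin (h n * f x)) / h n ^+ 2 @[n --> \oo] --> 0.
Proof.
move=> ch h0.
pose G n x := (sin (h n * f x) - h n * f x) / h n ^+ 2.
have bc n : bmeas (fun x => sin (h n * f x)).
  under eq_fun do rewrite -cosBpihalf.
  by apply: bmeas_cos; apply: measurable_funB => //; exact: measurable_funM.
have GE n : (\int[mu]_x sin (h n * f x)) / h n ^+ 2 = \int[mu]_x G n x.
  have i2 : mu.-integrable [set: S] (EFin \o (fun x => h n * f x)).
    rewrite (_ : EFin \o _ = (fun x => (h n)%:E * (f x)%:E)%E)//.
    by apply: integrableZl => //; exact: integrable_of_sqr.
  have i1 := bmeas_integrable mu (bc n).
  rewrite /G RintegralZr//; last exact: (integrableB measurableT i1 i2).
  congr (_ / _); rewrite RintegralB// RintegralZl//; last exact: integrable_of_sqr.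
  by rewrite f0 mulr0 subr0.
under eq_fun do rewrite GE.
have mG n : measurable_fun [set: S] (G n).
  apply: measurable_funM => //; apply: measurable_funB; first by case: (bc n).
  exact: measurable_funM.
suff H : (\int[mu]_x (G n x)%:E)%E @[n --> \oo] --> 0%:E by exact: (fine_cvg H).
have <- : (\int[mu]_(x in [set: S]) (cst 0%E x : \bar R) = 0%:E)%E by exact: integral0.
apply: (@dominated_cvg _ _ _ mu [set: S] measurableT (fun n => EFin \o G n) _
  (EFin \o (fun x => 2 * f x ^+ 2))) => //.
- by move=> n; exact/measurable_EFinP.
- move=> x _; apply: cvg_EFin; first by apply: nearW.
  have lim : `|h n| * `|f x| ^+ 3 @[n --> \oo] --> 0.
    have c3 : (fun _ : nat => `|f x| ^+ 3) @ \oo --> `|f x| ^+ 3 by exact: cvg_cst.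
    have H : `|h n| * `|f x| ^+ 3 @[n --> \oo] --> `|0 : R| * `|f x| ^+ 3.
      exact: (cvgM (cvg_norm ch) c3).
    by rewrite normr0 mul0r in H.
  apply: norm_cvg0; apply: (@squeeze_cvgr _ _ _ _ (fun=> 0)
    (fun n => `|h n| * `|f x| ^+ 3)) => //; last exact: cvg_cst.
  apply: nearW => n /=; rewrite normr_ge0/= /G normrM normfV normrX.
  have hn : 0 < `|h n| ^+ 2 by rewrite exprn_gt0// normr_gt0.
  rewrite ler_pdivrMr// (le_trans (norm_sin_sub_le3 _))// normrM exprMn.
  by apply: le_of_eq; ring.
- rewrite (_ : EFin \o _ = (fun x => 2%:E * (f x ^+ 2)%:E)%E)//.
  exact: integrableZl.
- move=> n x _ /=; rewrite lee_fin /G normrM normfV normrX.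
  have hn : 0 < `|h n| ^+ 2 by rewrite exprn_gt0// normr_gt0.
  rewrite ler_pdivrMr// (le_trans (norm_sin_sub_le2 _))//.
  by rewrite exprMn real_normK ?num_real// [h n ^+ 2 * _]mulrC mulrA.
Qed.

(** By the addition formula, one more observation multiplies the expectation by
    1 - w up to an error e, whatever the phase c; the n errors add up. *)
Lemma expect_cos_tsum (h w e : R) n : 0 <= w <= 1 ->
  `|\int[mu]_x cos (h * f x) - (1 - w)| + `|\int[mu]_x sin (h * f x)| <= e ->
  forall c, `|\int[iid_law mu n]_t cos (h * tsum t + c) - (1 - w) ^+ n * cos c| <= n%:R * e.
Proof.
move=> /andP[w0 w1] He; have e0 : 0 <= e by apply: le_trans He; rewrite addr_ge0.
have bct k c : bmeas (fun t : k.-tuple S => cos (h * tsum t + c)).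
  apply: bmeas_cos; apply: measurable_funD => //; apply: measurable_funM => //.
  exact: measurable_tsum.
elim: n => [|n IH] c.
  under eq_Rintegral do rewrite /tsum big_ord0 mulr0 add0r.
  by rewrite expect_cst expr0 mul1r subrr normr0 mul0r.
rewrite expect_iid_lawS//.
have bs : bmeas (fun x => sin (h * f x)).
  under eq_fun do rewrite -cosBpihalf.
  by apply: bmeas_cos; apply: measurable_funB => //; exact: measurable_funM.
have bc : bmeas (fun x => cos (h * f x)) by apply: bmeas_cos; exact: measurable_funM.
have E (t : n.-tuple S) : \int[mu]_x cos (h * tsum [tuple of x :: t] + c) =
    (\int[mu]_x cos (h * f x)) * cos (h * tsum t + c) -
    (\int[mu]_x sin (h * f x)) * sin (h * tsum t + c).
  transitivity (\int[mu]_x (cos (h * tsum t + c) * cos (h * f x)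
                  - sin (h * tsum t + c) * sin (h * f x))).
    apply: eq_Rintegral => x _; rewrite tsum_cons.
    rewrite (_ : h * (f x + tsum t) + c = h * f x + (h * tsum t + c)); last by ring.
    by rewrite cosD [X in X - _]mulrC [X in _ - X]mulrC.
  rewrite expectB ?expectZ//; last 2 first.
  - by apply: bmeasM => //; exact: bmeas_cst.
  - by apply: bmeasM => //; exact: bmeas_cst.
  - by rewrite [X in X - _]mulrC [X in _ - X]mulrC.
have step : `|\int[iid_law mu n]_t \int[mu]_x cos (h * tsum [tuple of x :: t] + c) -
   (1 - w) * \int[iid_law mu n]_t cos (h * tsum t + c)| <= e.
  have bE : bmeas (fun t : n.-tuple S => \int[mu]_x cos (h * tsum [tuple of x :: t] + c)).
    exact: (bmeas_expect_cons mu (bct n.+1 c)).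
  have bZ : bmeas (fun t : n.-tuple S => (1 - w) * cos (h * tsum t + c)).
    by apply: bmeasM => //; exact: bmeas_cst.
  have <- := expectZ (iid_law mu n) (1 - w) (bct n c).
  have <- := expectB (iid_law mu n) bE bZ.
  rewrite -[leRHS](expect_cst (iid_law mu n) e); apply: norm_expect_le.
  - exact: bmeasB.
  - exact: bmeas_cst.
  move=> t; rewrite E; set a := \int[mu]_x cos _; set b := \int[mu]_x sin _.
  rewrite (_ : _ - _ = (a - (1 - w)) * cos (h * tsum t + c) - b * sin (h * tsum t + c)); last by ring.
  rewrite (le_trans (ler_normB _ _))// (le_trans _ He)//.
  by rewrite !normrM lerD// ler_piMr// ?cos_max ?sin_max.
rewrite exprS -mulrA.
have -> : n.+1%:R * e = e + n%:R * e by rewrite -natr1; ring.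
have H2 : `|(1 - w) * \int[iid_law mu n]_t cos (h * tsum t + c) -
   (1 - w) * ((1 - w) ^+ n * cos c)| <= n%:R * e.
  rewrite -mulrBr normrM (le_trans _ (IH c))// ler_piMl//.
  by rewrite ger0_norm; lra.
rewrite (le_trans (ler_distD ((1 - w) * \int[iid_law mu n]_t cos (h * tsum t + c)) _ _))//.
exact: lerD.
Qed.

End centred_sums.

(** * The central limit theorem *)

Lemma expect_cos_normal_law (R : realType) (s2 u c : R) : 0 <= s2 ->
  \int[normal_law 0 s2]_x cos (u * x + c) = expR (- (s2 * u ^+ 2 / 2)) * cos c.
Proof.
move=> s20; rewrite /normal_law; have [->|s2n0] := eqVneq s2 0.
  rewrite /Rintegral integral_dirac//; last first.
    apply/measurable_EFinP.
    by have [] := @bmeas_cos _ (measurableTypeR R) R (fun x => u * x + c)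
      (measurable_funD (measurable_funM (measurable_cst _) (@measurable_id _ _ _)) (measurable_cst _)).
  by rewrite diracT mul1e/= mulr0 add0r !mul0r oppr0 expR0 mul1r.
have s2p : 0 < s2 by rewrite lt_neqAle eq_sym s2n0.
by rewrite expect_cos_normal ?sqrtr_gt0// sqr_sqrtr.
Qed.

Section central_limit.
Context d (S : measurableType d) {R : realType} d' (Omega : measurableType d').
Variables (P : probability Omega R) (X : nat -> Omega -> S).
Hypothesis mX : forall n, measurable_fun [set: Omega] (X n).
Hypothesis iidX : iid P X.
Notation mu := (law0 P mX).
Variable f : S -> R.
Hypotheses (mf : measurable_fun [set: S] f)
  (f2 : mu.-integrable [set: S] (EFin \o (fun x => f x ^+ 2)))
  (f0 : \int[mu]_x f x = 0).
Variables (m : nat -> nat) (b : R).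
Hypothesis cm : (m M)%:R / M%:R @[M --> \oo] --> b.

Let v := \int[mu]_x (f x ^+ 2).

Definition nsum (M : nat) w := (Num.sqrt M%:R)^-1 * \sum_(k < m M) f (X k w).

Lemma measurable_nsum M : measurable_fun [set: Omega] (nsum M).
Proof.
apply: measurable_funM => //; apply: measurable_sum => k.
exact: (measurableT_comp mf).
Qed.

Lemma tsum_sample n w : tsum f (sample X (@nat_of_ord n) w) = \sum_(k < n) f (X k w).
Proof. by apply: eq_bigr => i _; rewrite tnth_mktuple. Qed.

Lemma tail_nsum M (K : R) : (0 < M)%N -> 0 < K ->
  fine (P [set w | K <= `|nsum M w|]) <= (m M)%:R / M%:R * v / K ^+ 2.
Proof.
move=> M0 K0; have sM : 0 < Num.sqrt M%:R :> R by rewrite sqrtr_gt0 ltr0n.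
have KM : 0 < K * Num.sqrt M%:R by rewrite mulr_gt0.
have := tail_tsum mf f2 f0 (m M) KM.
rewrite -(sample_law mX iidX (@ord_inj (m M))); last first.
  apply: measurable_le_set => //.
  by apply: measurableT_comp => //; exact: measurable_tsum.
rewrite exprMn sqr_sqrtr// /distribution /pushforward.
rewrite (_ : _ @^-1` _ = [set w | K <= `|nsum M w|]).
  move=> h; apply: (le_trans h); apply: le_of_eq.
  by rewrite -/v; field; rewrite !gt_eqF//= ltr0n.
apply/seteqP; split => w /=; rewrite tsum_sample /nsum normrM gtr0_norm ?invr_gt0//.
  by rewrite ler_pdivlMl// mulrC.
by rewrite ler_pdivlMl// mulrC.
Qed.

Lemma tight_nsum (e : R) : 0 < e -> exists2 K : R, 0 < K &
  \forall M \near \oo, fine (P [set w | K <= `|nsum M w|]) <= e.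
Proof.
move=> e0.
have v0 : 0 <= v by exact: variance_centred_ge0.
have b0 : 0 <= b.
  by apply: (cvgr_to_ge cm); apply: nearW => M; rewrite divr_ge0.
pose K := 1 + (b + 1) * v / e.
have K1 : 1 <= K by rewrite lerDl divr_ge0 ?(ltW e0)// mulr_ge0// addr_ge0.
have K0 : 0 < K by exact: lt_le_trans K1.
exists K => //; near=> M.
have mb : (m M)%:R / M%:R <= b + 1.
  by near: M; apply: (cvgr_le b cm); rewrite ltrDl ltr01.
have M0 : (0 < M)%N by near: M; exact: nbhs_infty_gt.
rewrite (le_trans (tail_nsum M0 K0))// ler_pdivrMr ?exprn_gt0//.
rewrite (@le_trans _ _ ((b + 1) * v))// ?ler_wpM2r//.
rewrite (@le_trans _ _ (e * K))//.
  by rewrite /K mulrDr mulr1 mulrCA mulfV ?gt_eqF// mulr1 lerDr ltW.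
by rewrite ler_pM2l// expr2 ler_peMl// ltW.
Unshelve. all: by end_near. Qed.

(** [expect_cos_tsum] with h = u / sqrt M and w = h^2 v / 2: the power
    (1 - w)^(m M) tends to exp (- b v u^2 / 2), and m M times the error of one
    step tends to 0 by the Taylor limits. *)
Lemma cvg_cos_nsum (u c : R) :
  \int[P]_w cos (u * nsum M w + c) @[M --> \oo] --> expR (- (b * v * u ^+ 2 / 2)) * cos c.
Proof.
have [->|u0] := eqVneq u 0.
  under eq_fun do under eq_Rintegral do rewrite mul0r add0r.
  under eq_fun do rewrite expect_cst.
  by rewrite expr0n/= mulr0 mul0r oppr0 expR0 mul1r; exact: cvg_cst.
(* The shifted index avoids dividing by the square root of 0. *)
rewrite -cvg_shiftS.
pose h n : R := u / Num.sqrt n.+1%:R.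
have sM n : 0 < Num.sqrt n.+1%:R :> R by rewrite sqrtr_gt0 ltr0n.
have h0 n : h n != 0 by rewrite mulf_neq0// invr_neq0// gt_eqF.
have h2 n : h n ^+ 2 = u ^+ 2 / n.+1%:R by rewrite expr_div_n sqr_sqrtr.
have ch2 : h n ^+ 2 @[n --> \oo] --> (0 : R).
  under eq_fun do rewrite h2.
  have H : u ^+ 2 * n.+1%:R^-1 @[n --> \oo] --> u ^+ 2 * (0 : R).
    by apply: cvgM; [exact: cvg_cst|exact: cvg_harmonic].
  by rewrite mulr0 in H.
have ch : h n @[n --> \oo] --> (0 : R).
  have H : Num.sqrt (h n ^+ 2) @[n --> \oo] --> Num.sqrt (0 : R).
    by apply: continuous_cvg ch2; exact: sqrt_continuous.
  rewrite sqrtr0 in H; apply: norm_cvg0.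
  rewrite (_ : (fun n => _) = (fun n => Num.sqrt (h n ^+ 2)))//.
  by apply/funext => n; rewrite sqrtr_sqr.
have cmS : (m n.+1)%:R / n.+1%:R @[n --> \oo] --> b by move: cm; rewrite -cvg_shiftS.
have v0 : 0 <= v by exact: variance_centred_ge0.
pose w n := h n ^+ 2 * v / 2.
have w0 n : 0 <= w n by rewrite /w divr_ge0// mulr_ge0// sqr_ge0.
have cw : w n @[n --> \oo] --> (0 : R).
  have H : h n ^+ 2 * (v / 2) @[n --> \oo] --> 0 * (v / 2).
    by apply: cvgM => //; exact: cvg_cst.
  by rewrite mul0r in H; under eq_fun do rewrite /w -mulrA.
have cmw : (m n.+1)%:R * w n @[n --> \oo] --> b * v * u ^+ 2 / 2.
  have H : ((m n.+1)%:R / n.+1%:R) * (v * u ^+ 2 / 2) @[n --> \oo] --> b * (v * u ^+ 2 / 2).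
    by apply: cvgM => //; exact: cvg_cst.
  rewrite (_ : b * v * u ^+ 2 / 2 = b * (v * u ^+ 2 / 2)); last by ring.
  rewrite (_ : (fun n => _) = (fun n => ((m n.+1)%:R / n.+1%:R) * (v * u ^+ 2 / 2)))//.
  by apply/funext => n; rewrite /w h2; ring.
have cpow := cvg_onem_pow w0 cw cmw.
pose a n := \int[mu]_x cos (h n * f x).
pose s n := \int[mu]_x sin (h n * f x).
pose e n := `|a n - (1 - w n)| + `|s n|.
have ce : (m n.+1)%:R * e n @[n --> \oo] --> (0 : R).
  have c1 := cvg_cos_taylor mf f2 ch h0.
  have c2 := cvg_sin_taylor mf f2 f0 ch h0.
  have H : ((m n.+1)%:R / n.+1%:R) * u ^+ 2 * (`|(a n - 1 + h n ^+ 2 * v / 2) / h n ^+ 2|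
      + `|s n / h n ^+ 2|) @[n --> \oo] --> b * u ^+ 2 * (`|0 : R| + `|0 : R|).
    apply: cvgM; first by apply: cvgM => //; exact: cvg_cst.
    by apply: cvgD; exact: cvg_norm.
  rewrite normr0 addr0 mulr0 in H.
  rewrite (_ : (fun n => _) = (fun n => ((m n.+1)%:R / n.+1%:R) * u ^+ 2 *
     (`|(a n - 1 + h n ^+ 2 * v / 2) / h n ^+ 2| + `|s n / h n ^+ 2|)))//.
  apply/funext => n; rewrite /e !normrM !normfV normrX.
  rewrite real_normK ?num_real// -mulrDl -[X in X / _ * _]mulr1.
  rewrite (_ : a n - (1 - w n) = a n - 1 + h n ^+ 2 * v / 2); last by rewrite /w; ring.
  rewrite h2; field.
  by rewrite u0 andbT gt_eqF// ltr_wpDr//.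
have bound : \forall n \near \oo,
   `|\int[P]_x cos (u * nsum n.+1 x + c) - (1 - w n) ^+ m n.+1 * cos c| <= (m n.+1)%:R * e n.
  near=> n.
  have w1 : w n <= 1 by near: n; apply: (cvgr_le 0).
  have := @expect_cos_tsum _ _ _ mu f mf (h n) (w n) (e n) (m n.+1) _ (lexx _) c.
  rewrite w0 w1 => /(_ isT).
  rewrite -(expect_sample mX iidX (@ord_inj (m n.+1))); last first.
    apply: bmeas_cos; apply: measurable_funD => //; apply: measurable_funM => //.
    exact: measurable_tsum.
  rewrite (_ : \int[P]_x cos (u * nsum n.+1 x + c) =
     \int[P]_w0 cos (h n * tsum f (sample X (@nat_of_ord (m n.+1)) w0) + c))//.
  by apply: eq_Rintegral => w' _; rewrite tsum_sample /nsum /h mulrA.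
have cpow' : (1 - w n) ^+ m n.+1 * cos c @[n --> \oo] --> expR (- (b * v * u ^+ 2 / 2)) * cos c.
  by apply: cvgM => //; exact: cvg_cst.
have cdiff : \int[P]_x cos (u * nsum n.+1 x + c) - (1 - w n) ^+ m n.+1 * cos c
    @[n --> \oo] --> (0 : R).
  apply: norm_cvg0; apply: (@squeeze_cvgr _ _ _ _ (fun=> 0) (fun n => (m n.+1)%:R * e n)) => //.
    by near=> n; rewrite normr_ge0/=; near: n.
  exact: cvg_cst.
have H : (\int[P]_x cos (u * nsum n.+1 x + c) - (1 - w n) ^+ m n.+1 * cos c) +
    (1 - w n) ^+ m n.+1 * cos c @[n --> \oo] --> 0 + expR (- (b * v * u ^+ 2 / 2)) * cos c.
  exact: cvgD.
rewrite add0r in H; apply: cvg_trans H; apply: near_eq_cvg.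
by apply: nearW => n /=; rewrite subrK.
Unshelve. all: by end_near. Qed.

End central_limit.

(** * The delta method for the last coordinate *)

(** First-order expansion of (a, b) |-> phi (a) b at (A, B), uniform over
    bounded increments. Caratheodory's criterion writes phi (A + h) - phi A as
    g (A + h) h with g continuous at A, which gives the remainder in closed
    form. *)
Lemma delta_expansion (R : realType) (phi : R -> R) (A B D K e : R) :
  is_derive A 1 phi D -> 0 < K -> 0 < e ->
  exists2 r0 : R, 0 < r0 & forall r a b, 0 < r -> r < r0 -> `|a| <= K -> `|b| <= K ->
    `|(phi (A + r * a) * (B + r * b) - phi A * B) / r - (phi A * b + D * B * a)| <= e /\
    `|phi (A + r * a) - phi A| <= e.
Proof.
move=> /is_derive1_caratheodory[g [gE cg gA]] K0 e0.
pose c := K * `|B| + 1.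
have c0 : 0 < c by rewrite ltr_wpDl// mulr_ge0// ltW.
pose eta := Num.min 1 (e / (2 * c)).
have eta0 : 0 < eta by rewrite lt_min ltr01 divr_gt0// mulr_gt0.
have eta1 : eta <= 1 by rewrite ge_min lexx.
have eta2 : eta <= e / (2 * c) by rewrite ge_min lexx orbT.
have /cvgrPdist_lt/(_ _ eta0) := cg; rewrite -nbhs_ballE => -[s /= s0 Hs].
pose k := (`|D| + 1) * (K ^+ 2 + K).
have D1 : 0 < `|D| + 1 by rewrite ltr_wpDl.
have k0 : 0 < k by apply: mulr_gt0 => //; rewrite addr_gt0 ?exprn_gt0.
exists (Num.min (s / K) (e / (2 * k))).
  by rewrite lt_min !divr_gt0// mulr_gt0.
move=> r a b r0; rewrite lt_min => /andP[rs rk] aK bK.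
set h := r * a.
have hs : `|h| < s.
  rewrite /h normrM gtr0_norm// (le_lt_trans (ler_wpM2l (ltW r0) aK))//.
  by rewrite -ltr_pdivlMr.
have gD : `|g (A + h) - D| <= eta.
  have := Hs (A + h); rewrite /ball/= opprD addNKr normrN => /(_ hs).
  by rewrite gA distrC => /ltW.
have gn : `|g (A + h)| <= `|D| + 1.
  rewrite -[g _](subrK D) (le_trans (ler_normD _ _))// addrC lerD2l.
  exact: le_trans eta1.
have phiE : phi (A + h) = phi A + g (A + h) * h.
  by have := gE (A + h); rewrite [A + h - A]addrAC subrr add0r => <-; rewrite [RHS]addrC subrK.
have rk2 : r * k <= e / 2.
  have : r * (2 * k) < e by rewrite -ltr_pdivlMr// mulr_gt0.
  by lra.
split.
  rewrite phiE /h.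
  set G := g _ in gD gn *.
  rewrite (_ : _ - _ = (G - D) * a * B + G * r * a * b); last first.
    by field; rewrite gt_eqF.
  rewrite (le_trans (ler_normD _ _))// [e]splitr lerD//.
    rewrite !normrM (@le_trans _ _ (eta * c))//.
      rewrite -mulrA ler_pM// ?mulr_ge0// /c.
      by rewrite (@le_trans _ _ (K * `|B|)) ?ler_wpM2r// lerDl.
    by move: eta2; rewrite ler_pdivlMr ?mulr_gt0// => h2; lra.
  rewrite !normrM (gtr0_norm r0) (le_trans _ rk2)//.
  rewrite (_ : `|G| * r * `|a| * `|b| = r * (`|G| * (`|a| * `|b|))); last by ring.
  rewrite ler_pM2l// /k ler_pM// ?mulr_ge0//.
  rewrite (@le_trans _ _ (K * K)) ?ler_pM// -expr2 lerDl ltW//.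
rewrite phiE addrAC subrr add0r normrM /h normrM (gtr0_norm r0).
rewrite (@le_trans _ _ ((`|D| + 1) * (r * K)))//.
  by rewrite ler_pM// ?mulr_ge0 ?(ltW r0)// ler_pM2l.
rewrite (@le_trans _ _ (r * k))//; last by lra.
rewrite (_ : r * k = (`|D| + 1) * (r * (K ^+ 2 + K))); last by rewrite /k; ring.
by rewrite ler_pM2l// ler_pM2l// lerDr sqr_ge0.
Qed.

Section delta_method.
Context d (S : measurableType d) {R : realType} d' (Omega : measurableType d').
Variables (P : probability Omega R) (X : nat -> Omega -> S).
Hypothesis mX : forall n, measurable_fun [set: Omega] (X n).
Hypothesis iidX : iid P X.
Notation mu := (law0 P mX).
Variables (y z : S -> R) (mY mZ : R).
Hypotheses (my : measurable_fun [set: S] y) (mz : measurable_fun [set: S] z).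
Let fY p := y p - mY.
Let fZ p := z p - mZ.
Hypotheses (fY2 : mu.-integrable [set: S] (EFin \o (fun p => fY p ^+ 2)))
  (fZ2 : mu.-integrable [set: S] (EFin \o (fun p => fZ p ^+ 2)))
  (fY0 : \int[mu]_p fY p = 0) (fZ0 : \int[mu]_p fZ p = 0).
Variables (m : nat -> nat) (b : R).
Hypothesis cm : Num.sqrt M%:R * ((m M)%:R / M%:R - b) @[M --> \oo] --> 0.
Variables (x0 z0 : R) (phi : R -> R) (D : R).
Let A := b * mY.
Let B := b * mZ.
Hypotheses (mphi : measurable_fun [set: R] phi) (dphi : is_derive A 1 phi D).

Let fX p := phi A * fZ p + D * B * fY p.

Definition PhiM M w := phi ((\sum_(k < m M) y (X k w) + x0) / M%:R).
Definition TM M w := Num.sqrt M%:R *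
  (PhiM M w * ((\sum_(k < m M) z (X k w) + z0) / M%:R) - phi A * B).

Let mfY : measurable_fun [set: S] fY. Proof. exact: measurable_funB. Qed.
Let mfZ : measurable_fun [set: S] fZ. Proof. exact: measurable_funB. Qed.
Let mfX : measurable_fun [set: S] fX.
Proof. by apply: measurable_funD; apply: measurable_funM. Qed.

Lemma measurable_PhiM M : measurable_fun [set: Omega] (PhiM M).
Proof.
apply: (measurableT_comp mphi); apply: measurable_funM => //.
apply: measurable_funD => //; apply: measurable_sum => k.
exact: (measurableT_comp my).
Qed.

Lemma measurable_TM M : measurable_fun [set: Omega] (TM M).
Proof.
apply: measurable_funM => //; apply: measurable_funB => //.
apply: measurable_funM; first exact: measurable_PhiM.
apply: measurable_funM => //; apply: measurable_funD => //; apply: measurable_sum => k.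
exact: (measurableT_comp mz).
Qed.

Lemma cvg_sqrt_inv : (Num.sqrt M%:R)^-1 @[M --> \oo] --> (0 : R).
Proof.
apply/cvgrPdist_le => e e0; near=> M.
rewrite sub0r normrN ger0_norm ?invr_ge0 ?sqrtr_ge0//.
rewrite -[leRHS]invrK lef_pV2 ?posrE ?invr_gt0//; last first.
  by rewrite sqrtr_gt0 ltr0n; near: M; exact: nbhs_infty_gt.
rewrite -[leLHS]ger0_norm ?invr_ge0 ?(ltW e0)// -sqrtr_sqr ler_wsqrtr//.
by near: M; exact: nbhs_infty_ger.
Unshelve. all: by end_near. Qed.

Lemma cvg_ratio : (m M)%:R / M%:R @[M --> \oo] --> b.
Proof.
have H : (Num.sqrt M%:R)^-1 * (Num.sqrt M%:R * ((m M)%:R / M%:R - b)) + b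
    @[M --> \oo] --> 0 * 0 + b.
  by apply: cvgD; [exact: (cvgM cvg_sqrt_inv cm)|exact: cvg_cst].
rewrite mul0r add0r in H; apply: cvg_trans H; apply: near_eq_cvg; near=> M.
have M0 : (0 < M)%N by near: M; exact: nbhs_infty_gt.
by rewrite mulrA mulVf ?mul1r ?subrK// gt_eqF// sqrtr_gt0 ltr0n.
Unshelve. all: by end_near. Qed.

(* offsets *)
Let oY M := Num.sqrt M%:R * ((m M)%:R / M%:R - b) * mY + (Num.sqrt M%:R)^-1 * x0.
Let oZ M := Num.sqrt M%:R * ((m M)%:R / M%:R - b) * mZ + (Num.sqrt M%:R)^-1 * z0.

Let cvg_offset (c1 c2 : R) : Num.sqrt M%:R * ((m M)%:R / M%:R - b) * c1 +
  (Num.sqrt M%:R)^-1 * c2 @[M --> \oo] --> (0 : R).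
Proof.
have H : Num.sqrt M%:R * ((m M)%:R / M%:R - b) * c1 +
  (Num.sqrt M%:R)^-1 * c2 @[M --> \oo] --> 0 * c1 + 0 * c2.
  by apply: cvgD; apply: cvgM; [exact: cm|exact: cvg_cst|exact: cvg_sqrt_inv|exact: cvg_cst].
by rewrite !mul0r addr0 in H.
Qed.

(** The offset collects the error made in replacing m M / M by b and the
    constant o; both vanish in the limit. *)
Let average_decomposition (g : S -> R) (c o : R) M w : (0 < M)%N ->
  (\sum_(k < m M) g (X k w) + o) / M%:R = b * c + (Num.sqrt M%:R)^-1 *
    (nsum X (fun p => g p - c) m M w + (Num.sqrt M%:R * ((m M)%:R / M%:R - b) * c +
     (Num.sqrt M%:R)^-1 * o)).
Proof.
move=> M0; rewrite /nsum sumrB sumr_const card_ord.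
have s0 : Num.sqrt M%:R != 0 :> R by rewrite gt_eqF// sqrtr_gt0 ltr0n.
have s2 : M%:R = Num.sqrt M%:R ^+ 2 :> R by rewrite sqr_sqrtr.
rewrite -[c *+ _]mulr_natl; move: s0 s2; set s := Num.sqrt M%:R; clearbody s => s0 s2.
by rewrite s2; field.
Qed.

(** Where the normalised sums of Y and of Z are both at most K, which fails with
    small probability, [delta_expansion] applies with r = 1 / sqrt M. *)
Lemma delta_good_event (e : R) : 0 < e -> \forall M \near \oo,
  exists G : set Omega, [/\ measurable G, fine (P (~` G)) <= e &
    forall w, G w -> `|TM M w - nsum X fX m M w| <= e /\ `|PhiM M w - phi A| <= e].
Proof.
move=> e0.
have cr := cvg_ratio.
have e20 : 0 < e / 2 by rewrite divr_gt0.
have [KY KY0 HY] := tight_nsum iidX mfY fY2 fY0 cr e20.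
have [KZ KZ0 HZ] := tight_nsum iidX mfZ fZ2 fZ0 cr e20.
pose K := Num.max KY KZ + 1.
have KYK : KY + 1 <= K by rewrite lerD2r le_max lexx.
have KZK : KZ + 1 <= K by rewrite lerD2r le_max lexx orbT.
have K0 : 0 < K by rewrite (lt_le_trans _ KYK)// addr_gt0.
have [r0 r00 Hr] := delta_expansion B dphi K0 e20.
have coX : phi A * oZ M + D * B * oY M @[M --> \oo] --> (0 : R).
  have H : phi A * oZ M + D * B * oY M @[M --> \oo] --> phi A * 0 + D * B * 0.
    by apply: cvgD; apply: cvgM; [exact: cvg_cst|exact: cvg_offset
                                 |exact: cvg_cst|exact: cvg_offset].
  by rewrite !mulr0 addr0 in H.
near=> M.
have M0 : (0 < M)%N by near: M; exact: nbhs_infty_gt.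
have sM0 : 0 < Num.sqrt M%:R :> R by rewrite sqrtr_gt0 ltr0n.
have rM : (Num.sqrt M%:R)^-1 < r0.
  by near: M; exact: (cvgr_lt 0 cvg_sqrt_inv).
have oY1 : `|oY M| <= 1.
  by near: M; have /cvgrPdist_le/(_ _ ltr01) := cvg_offset mY x0;
    apply: filterS => M; rewrite sub0r normrN.
have oZ1 : `|oZ M| <= 1.
  by near: M; have /cvgrPdist_le/(_ _ ltr01) := cvg_offset mZ z0;
    apply: filterS => M; rewrite sub0r normrN.
have oX1 : `|phi A * oZ M + D * B * oY M| <= e / 2.
  by near: M; have /cvgrPdist_le/(_ _ e20) := coX;
    apply: filterS => M; rewrite sub0r normrN.
have PY : fine (P [set w | KY <= `|nsum X fY m M w|]) <= e / 2 by near: M.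
have PZ : fine (P [set w | KZ <= `|nsum X fZ m M w|]) <= e / 2 by near: M.
have mEY : measurable [set w | KY <= `|nsum X fY m M w|].
  apply: measurable_le_set => //.
  by apply: measurableT_comp => //; exact: measurable_nsum.
have mEZ : measurable [set w | KZ <= `|nsum X fZ m M w|].
  apply: measurable_le_set => //.
  by apply: measurableT_comp => //; exact: measurable_nsum.
exists (~` ([set w | KY <= `|nsum X fY m M w|] `|` [set w | KZ <= `|nsum X fZ m M w|])).
split.
- by apply: measurableC; exact: measurableU.
- rewrite setCK -lee_fin fineK ?fin_num_measure//; last exact: measurableU.
  rewrite (le_trans (measureU2 _ _ _))// [e in leRHS]splitr EFinD.
  by apply: leeD; rewrite -[leLHS]fineK ?lee_fin// fin_num_measure.
move=> w /= /not_orP[/negP + /negP].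
rewrite -!ltNge => nY nZ.
have aK : `|nsum X fY m M w + oY M| <= K.
  by rewrite (le_trans (ler_normD _ _))// (le_trans _ KYK)// lerD// ltW.
have bK : `|nsum X fZ m M w + oZ M| <= K.
  by rewrite (le_trans (ler_normD _ _))// (le_trans _ KZK)// lerD// ltW.
have rM0 : 0 < (Num.sqrt M%:R)^-1 :> R by rewrite invr_gt0.
have [H1 H2] := Hr _ _ _ rM0 rM aK bK.
have EA := average_decomposition y mY x0 w M0.
have EB := average_decomposition z mZ z0 w M0.
have PE : PhiM M w = phi (A + (Num.sqrt M%:R)^-1 * (nsum X fY m M w + oY M)).
  by rewrite /PhiM EA.
split; last by rewrite PE (le_trans H2)// ler_pdivrMr// ler_peMr// ?ler1n// ltW.
have TE : TM M w = (phi (A + (Num.sqrt M%:R)^-1 * (nsum X fY m M w + oY M)) *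
   (B + (Num.sqrt M%:R)^-1 * (nsum X fZ m M w + oZ M)) - phi A * B) / (Num.sqrt M%:R)^-1.
  by rewrite /TM PE EB invrK [RHS]mulrC.
have XE : phi A * (nsum X fZ m M w + oZ M) + D * B * (nsum X fY m M w + oY M) =
  nsum X fX m M w + (phi A * oZ M + D * B * oY M).
  have -> : nsum X fX m M w = phi A * nsum X fZ m M w + D * B * nsum X fY m M w.
    rewrite /nsum /fX big_split/= -!mulr_sumr; ring.
  ring.
rewrite -TE XE in H1.
rewrite (_ : TM M w - nsum X fX m M w =
  (TM M w - (nsum X fX m M w + (phi A * oZ M + D * B * oY M)))
   + (phi A * oZ M + D * B * oY M)); last by ring.
by rewrite (le_trans (ler_normD _ _))// [e]splitr lerD.
Unshelve. all: by end_near. Qed.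

Lemma integrable_fX2 : mu.-integrable [set: S] (EFin \o (fun p => fX p ^+ 2)).
Proof.
have i1 : mu.-integrable [set: S] (EFin \o (fun p =>
    2 * (phi A) ^+ 2 * fZ p ^+ 2 + 2 * (D * B) ^+ 2 * fY p ^+ 2)).
  rewrite (_ : EFin \o _ = (fun p => (2 * (phi A) ^+ 2)%:E * (fZ p ^+ 2)%:E +
     (2 * (D * B) ^+ 2)%:E * (fY p ^+ 2)%:E)%E)//.
  by apply: integrableD => //; apply: integrableZl.
apply: le_integrable i1 => //; first by apply/measurable_EFinP; exact: measurable_funX.
move=> p _ /=; rewrite lee_fin ger0_norm ?sqr_ge0// ger0_norm; last first.
  by rewrite addr_ge0// mulr_ge0 ?sqr_ge0// mulr_ge0// sqr_ge0.
rewrite /fX -subr_ge0.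
have -> : 2 * phi A ^+ 2 * fZ p ^+ 2 + 2 * (D * B) ^+ 2 * fY p ^+ 2 -
    (phi A * fZ p + D * B * fY p) ^+ 2 = (phi A * fZ p - D * B * fY p) ^+ 2 by ring.
exact: sqr_ge0.
Qed.

Lemma expect_fX0 : \int[mu]_p fX p = 0.
Proof.
have iY := integrable_of_sqr mfY fY2.
have iZ := integrable_of_sqr mfZ fZ2.
have i1 : mu.-integrable [set: S] (EFin \o (fun p => phi A * fZ p)).
  rewrite (_ : EFin \o _ = (fun p => (phi A)%:E * (fZ p)%:E)%E)//.
  exact: integrableZl.
have i2 : mu.-integrable [set: S] (EFin \o (fun p => D * B * fY p)).
  rewrite (_ : EFin \o _ = (fun p => (D * B)%:E * (fY p)%:E)%E)//.
  exact: integrableZl.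
by rewrite /fX RintegralD// !RintegralZl// fY0 fZ0 !mulr0 addr0.
Qed.

(** T differs from a normalised sum of the centred variables fX by a quantity
    that is small in probability, so that tightness and the limits of cosine
    expectations carry over from nsum. *)
Lemma clt_TM (h : R -> R) : continuous h -> (forall s, 0 <= h s <= 1) ->
  \int[P]_w h (TM M w) @[M --> \oo] -->
    \int[normal_law 0 (b * \int[mu]_p (fX p ^+ 2))]_t h t.
Proof.
have cr := cvg_ratio.
have v0 : 0 <= \int[mu]_p (fX p ^+ 2) by apply: Rintegral_ge0 => p _; exact: sqr_ge0.
have b0 : 0 <= b.
  by apply: (cvgr_to_ge cr); apply: nearW => M; rewrite divr_ge0.
apply: cvg_expect_of_cos => //.
- exact: measurable_TM.
- move=> e e0.
  have e20 : 0 < e / 2 by rewrite divr_gt0.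
  have [K K0 HK] := tight_nsum iidX mfX integrable_fX2 expect_fX0 cr e20.
  exists (K + e / 2); first by rewrite addr_gt0.
  have HG := delta_good_event e20.
  near=> M.
  have PK : fine (P [set w | K <= `|nsum X fX m M w|]) <= e / 2 by near: M.
  have [G [mG PG GT]] : exists G : set Omega, [/\ measurable G, fine (P (~` G)) <= e / 2 &
    forall w, G w -> `|TM M w - nsum X fX m M w| <= e / 2 /\ `|PhiM M w - phi A| <= e / 2].
    by near: M.
  have mEX : measurable [set w | K <= `|nsum X fX m M w|].
    apply: measurable_le_set => //.
    by apply: measurableT_comp => //; exact: measurable_nsum.
  have mET : measurable [set w | K + e / 2 < `|TM M w|].
    apply: measurable_lt_set => //.
    by apply: measurableT_comp => //; exact: measurable_TM.
  rewrite -lee_fin fineK ?fin_num_measure//.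
  rewrite (@le_trans _ _ (P ([set w | K <= `|nsum X fX m M w|] `|` ~` G)))//.
    apply: le_measure; rewrite ?inE//; first by apply: measurableU => //; exact: measurableC.
    move=> w /= Tw; have [Gw|] := pselect (G w); last by right.
    left; have [H _] := GT _ Gw.
    have := ler_normD (nsum X fX m M w) (TM M w - nsum X fX m M w).
    by rewrite addrC subrK; lra.
  rewrite (le_trans (measureU2 _ _ _))//; first exact: measurableC.
  rewrite [e in leRHS]splitr EFinD.
  apply: leeD; rewrite -[leLHS]fineK ?lee_fin//; apply: fin_num_measure => //.
  exact: measurableC.
move=> u c; rewrite expect_cos_normal_law ?mulr_ge0//.
have cL : \int[P]_w cos (u * nsum X fX m M w + c) @[M --> \oo] -->
    expR (- (b * \int[mu]_p (fX p ^+ 2) * u ^+ 2 / 2)) * cos c.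
  exact: (cvg_cos_nsum iidX mfX integrable_fX2 expect_fX0 cr).
apply/cvgrPdist_le => e e0.
pose e' := e / (2 * (`|u| + 3)).
have u3 : 0 < `|u| + 3 by rewrite ltr_wpDl.
have e'0 : 0 < e' by rewrite divr_gt0// mulr_gt0.
have e20 : 0 < e / 2 by rewrite divr_gt0.
have e'E : e' * (`|u| + 3) = e / 2 by rewrite /e'; field; rewrite gt_eqF.
have HG := delta_good_event e'0.
move/cvgrPdist_le : cL => /(_ _ e20) HL.
near=> M.
have [G [mG PG GT]] : exists G : set Omega, [/\ measurable G, fine (P (~` G)) <= e' &
    forall w, G w -> `|TM M w - nsum X fX m M w| <= e' /\ `|PhiM M w - phi A| <= e'].
  by near: M.
have bT : bmeas (fun w => cos (u * TM M w + c)).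
  by apply: bmeas_cos; apply: measurable_funD => //; apply: measurable_funM => //;
    exact: measurable_TM.
have bL : bmeas (fun w => cos (u * nsum X fX m M w + c)).
  by apply: bmeas_cos; apply: measurable_funD => //; apply: measurable_funM => //;
    exact: measurable_nsum.
have H1 : `|\int[P]_w cos (u * nsum X fX m M w + c) - \int[P]_w cos (u * TM M w + c)|
    <= `|u| * e' + 2 * fine (P (~` G)).
  apply: bmeas_near_le => //.
  - by rewrite mulr_ge0// ltW.
  - move=> w Gw; have [H _] := GT _ Gw.
    rewrite (le_trans (norm_cos_sub_le _ _))// (_ : _ - _ = u * (nsum X fX m M w - TM M w)); last by ring.
    by rewrite normrM ler_wpM2l// distrC.
  - move=> w; rewrite (le_trans (ler_normB _ _))//.
    by rewrite (_ : (2 : R) = 1 + 1)// lerD ?cos_max.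
have H2 : `|expR (- (b * \int[mu]_p (fX p ^+ 2) * u ^+ 2 / 2)) * cos c -
     \int[P]_w cos (u * nsum X fX m M w + c)| <= e / 2 by near: M.
rewrite (le_trans (ler_distD (\int[P]_w cos (u * nsum X fX m M w + c)) _ _))//.
rewrite [e]splitr lerD// (le_trans H1)// -e'E mulrDr [e' * _]mulrC lerD2l.
by rewrite mulrC (@le_trans _ _ (e' * 2)) ?ler_wpM2r// ler_wpM2l ?(ltW e'0)// ler_nat.
Unshelve. all: by end_near. Qed.

End delta_method.

(** * Exchanging observations *)

Lemma cos_average (R : realType) (a d : R) :
  (cos a + cos (a + d)) / 2 = cos (a + d / 2) * cos (d / 2).
Proof.
have -> : cos a = cos ((a + d / 2) - d / 2) by congr cos; ring.
have -> : cos (a + d) = cos ((a + d / 2) + d / 2) by congr cos; field.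
by set t := a + d / 2; rewrite (cosB t) (cosD t); field.
Qed.

Lemma norm_prod_sub_le (R : realType) (I : Type) (s : seq I) (a b : I -> R) (e : R) :
  (forall i, 0 <= a i <= 1) -> (forall i, 0 <= b i <= 1) ->
  (forall i, `|a i - b i| <= e) ->
  `|\prod_(i <- s) a i - \prod_(i <- s) b i| <= (size s)%:R * e.
Proof.
move=> a01 b01 ab; elim: s => [|i s IH]; first by rewrite !big_nil subrr normr0 mul0r.
rewrite !big_cons.
have pb : `|\prod_(j <- s) b j| <= 1.
  have /andP[h1 h2] : 0 <= \prod_(j <- s) b j <= 1.
    elim: s {IH} => [|j s IH]; first by rewrite big_nil ler01 lexx.
    rewrite big_cons; have /andP[? ?] := b01 j; have /andP[? ?] := IH.
    by rewrite mulr_ge0//= mulr_ile1.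
  by rewrite ger0_norm.
have /andP[a0 a1] := a01 i.
rewrite (_ : _ - _ = a i * (\prod_(j <- s) a j - \prod_(j <- s) b j) +
  (a i - b i) * \prod_(j <- s) b j); last by ring.
rewrite (le_trans (ler_normD _ _))// (_ : (size (i :: s))%:R * e = (size s)%:R * e + e); last first.
  by rewrite /= -natr1; ring.
rewrite !normrM lerD//.
  by rewrite (le_trans _ IH)// ler_piMl// ger0_norm.
by rewrite (le_trans _ (ab i))// ler_piMr.
Qed.

Lemma measurable_nth d (S : measurableType d) n k :
  measurable_fun [set: n.-tuple S] (fun t : n.-tuple S => nth point t k).
Proof.
have [kn|kn] := ltnP k n.
  rewrite (_ : (fun t => _) = (fun t : n.-tuple S => tnth t (Ordinal kn))).
    exact: measurable_tnth.
  by apply/funext => t; rewrite (tnth_nth point).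
rewrite (_ : (fun t => _) = (fun=> point)) //.
by apply/funext => t; rewrite nth_default// size_tuple.
Qed.

Section swap.
Context d (S : measurableType d) {R : realType} d' (Omega : measurableType d').
Variables (P : probability Omega R) (X : nat -> Omega -> S).
Hypothesis mX : forall n, measurable_fun [set: Omega] (X n).
Hypothesis iidX : iid P X.
Notation mu := (law0 P mX).
Variable y : S -> R.
Hypothesis my : measurable_fun [set: S] y.

Definition coord n k (t : n.-tuple S) : R := y (nth point t k).

Lemma measurable_coord n k : measurable_fun [set: n.-tuple S] (@coord n k).
Proof.
exact: (measurableT_comp my (@measurable_nth _ S n k)).
Qed.

Definition swapn s j k := if k == j then (s + j)%N else if k == (s + j)%N then j else k.

Definition swap_tuple n s j (t : n.-tuple S) : n.-tuple S :=
  [tuple nth point t (swapn s j i) | i < n].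

Lemma swapn_inj s j : injective (swapn s j).
Proof.
apply: (can_inj (g := swapn s j)) => k; rewrite /swapn.
have [->|kj] := eqVneq k j; first by rewrite eqxx; case: eqP => // ->.
have [->|ks] := eqVneq k (s + j)%N; first by rewrite eqxx.
by rewrite (negbTE kj) (negbTE ks).
Qed.

Lemma swapn_lt n s j k : (s + j < n)%N -> (k < n)%N -> (swapn s j k < n)%N.
Proof.
move=> sj kn; rewrite /swapn; case: ifP => // _; case: ifP => // _.
exact: leq_ltn_trans (leq_addl s j) sj.
Qed.

Definition obs n (w : Omega) : n.-tuple S := sample X (@nat_of_ord n) w.

Lemma nth_obs n k w : (k < n)%N -> nth point (obs n w) k = X k w.
Proof. by move=> kn; rewrite (nth_map (Ordinal kn)) ?size_enum_ord// nth_enum_ord. Qed.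

Lemma coord_swap n s j k (t : n.-tuple S) : (k < n)%N ->
  coord k (swap_tuple s j t) = coord (swapn s j k) t.
Proof.
move=> kn; rewrite /coord; congr y.
by rewrite (nth_map (Ordinal kn)) ?size_enum_ord// nth_enum_ord.
Qed.

Lemma expect_swap n s j (F : n.-tuple S -> R) : (s + j < n)%N -> bmeas F ->
  \int[P]_w F (swap_tuple s j (obs n w)) = \int[P]_w F (obs n w).
Proof.
move=> sj bF; rewrite /obs (expect_sample mX iidX (@ord_inj n) bF).
rewrite -(expect_sample mX iidX (s := fun i : 'I_n => swapn s j i) _ bF); last first.
  by move=> i1 i2 /swapn_inj/val_inj.
apply: eq_Rintegral => w _; congr F; apply: eq_from_tnth => i.
by rewrite !tnth_mktuple -/(obs n w) nth_obs// swapn_lt.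
Qed.

Lemma measurable_obs n : measurable_fun [set: Omega] (obs n).
Proof. exact: measurable_sample. Qed.

Definition swap_invariant n s N (F : n.-tuple S -> R) :=
  forall j t, (j < N)%N -> F (swap_tuple s j t) = F t.

Section swap_average.
Variables (n s N : nat).
Hypotheses (Ns : (N <= s)%N) (sNn : (s + N <= n)%N).
Variables (Psi psi H : n.-tuple S -> R).
Hypotheses (mPsi : measurable_fun [set: n.-tuple S] Psi)
  (mpsi : measurable_fun [set: n.-tuple S] psi)
  (mH : measurable_fun [set: n.-tuple S] H).
Hypotheses (H1 : forall t, `|H t| <= 1) (sPsi : swap_invariant s N Psi)
  (spsi : swap_invariant s N psi) (sH : swap_invariant s N H).

Let Delta j (t : n.-tuple S) := coord j t - coord (s + j) t.
Let Q J (t : n.-tuple S) := \sum_(k < s) coord k t - \sum_(j < J) Delta j t / 2.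

Let mDelta j : measurable_fun [set: n.-tuple S] (Delta j).
Proof. by apply: measurable_funB; exact: measurable_coord. Qed.

Let mQ J : measurable_fun [set: n.-tuple S] (Q J).
Proof.
apply: measurable_funB; apply: measurable_sum => k; first exact: measurable_coord.
by apply: measurable_funM.
Qed.

Let bH : bmeas H. Proof. by split => //; exists 1. Qed.

Let bcosQ J : bmeas (fun t => cos (Psi t * Q J t + psi t)).
Proof. by apply: bmeas_cos; apply: measurable_funD => //; exact: measurable_funM. Qed.

Let bcosD j : bmeas (fun t => cos (Psi t * Delta j t / 2)).
Proof. by apply: bmeas_cos; apply: measurable_funM => //; exact: measurable_funM. Qed.

(** Exchanging observations J and s + J preserves the law of the sample and
    every factor except the first cosine, where it replaces one summand. The
    average of the two versions is a product of cosines by [cos_average]. After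
    J exchanges the argument is Q J, in which each Y j with j < J has been
    replaced by the mean of Y j and Y (s + j). *)
Lemma swap_average J : (J <= N)%N ->
  \int[P]_w (cos (Psi (obs n w) * (\sum_(k < s) coord k (obs n w)) + psi (obs n w)) * H (obs n w)) =
  \int[P]_w (cos (Psi (obs n w) * Q J (obs n w) + psi (obs n w)) *
    (\prod_(j < J) cos (Psi (obs n w) * Delta j (obs n w) / 2)) * H (obs n w)).
Proof.
elim: J => [_|J IH JN].
  by apply: eq_Rintegral => w _; rewrite /Q !big_ord0 subr0 mulr1.
rewrite IH ?(ltnW JN)//.
pose F t := cos (Psi t * Q J t + psi t) *
    (\prod_(j < J) cos (Psi t * Delta j t / 2)) * H t.
have bF : bmeas F.
  by apply: bmeasM => //; apply: bmeasM => //; exact: bmeas_prod.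
have sJ : (s + J < n)%N by rewrite (leq_trans _ sNn)// ltn_add2l.
have Js : (J < s)%N by exact: leq_trans Ns.
have Jn : (J < n)%N by rewrite (leq_ltn_trans _ sJ)// leq_addl.
have bFs : bmeas (F \o swap_tuple s J).
  apply: bmeas_comp bF _; apply/measurable_fun_tnthP => i.
  rewrite (_ : _ \o _ = (fun t : n.-tuple S => tnth t (Ordinal (swapn_lt sJ (ltn_ord i))))).
    exact: measurable_tnth.
  by apply/funext => t /=; rewrite tnth_mktuple (tnth_nth point).
have mo := @measurable_obs n.
have E1 := expect_swap sJ bF.
have -> : \int[P]_w F (obs n w) =
   \int[P]_w (2^-1 * (F (obs n w) + F (swap_tuple s J (obs n w)))).
  rewrite expectZ; last by apply: bmeasD; [exact: bmeas_comp bF mo|exact: bmeas_comp bFs mo].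
  rewrite expectD; [|exact: bmeas_comp bF mo|exact: bmeas_comp bFs mo].
  by rewrite E1; field.
apply: eq_Rintegral => w _; move: (obs n w) => t.
have cs k : (k < n)%N -> k != J -> k != (s + J)%N -> coord k (swap_tuple s J t) = coord k t.
  by move=> kn k1 k2; rewrite coord_swap// /swapn (negbTE k1) (negbTE k2).
have c1 : coord J (swap_tuple s J t) = coord (s + J) t.
  by rewrite coord_swap// /swapn eqxx.
have cD (j : 'I_J) : Delta j (swap_tuple s J t) = Delta j t.
  have jJ := ltn_ord j.
  rewrite /Delta; congr (_ - _); apply: cs.
  - exact: ltn_trans jJ Jn.
  - by rewrite ltn_eqF.
  - by rewrite ltn_eqF// (leq_trans jJ)// leq_addl.
  - by rewrite (ltn_trans _ sJ)// ltn_add2l.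
  - by rewrite gtn_eqF// (leq_trans Js)// leq_addr.
  - by rewrite eqn_add2l ltn_eqF.
have QE : Q J (swap_tuple s J t) = Q J t - Delta J t.
  rewrite /Q (eq_bigr (fun j : 'I_J => Delta j t / 2)); last by move=> j _; rewrite cD.
  rewrite (bigD1 (Ordinal Js))//= c1 [in RHS](bigD1 (Ordinal Js))//=.
  rewrite (eq_bigr (fun k : 'I_s => coord k t)); first by rewrite /Delta; ring.
  move=> k /negP kJ; apply: cs.
  - by rewrite (leq_trans (ltn_ord k))// (leq_trans _ sNn)// leq_addr.
  - by apply/negP => /eqP E; apply: kJ; apply/eqP/val_inj.
  - by rewrite ltn_eqF// (leq_trans (ltn_ord k))// leq_addr.
rewrite /F sH// sPsi// spsi// QE.
rewrite [X in _ + cos _ * X * _](eq_bigr (fun j : 'I_J => cos (Psi t * Delta j t / 2))); last first.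
  by move=> j _; rewrite cD.
set p := \prod_(j < J) _.
rewrite big_ord_recr/= -/p.
have Qr : Q J.+1 t = Q J t - Delta J t / 2.
  by rewrite /Q big_ord_recr/=; ring.
rewrite Qr.
have := cos_average (Psi t * Q J t + psi t) (- (Psi t * Delta J t)).
rewrite (_ : Psi t * Q J t + psi t + - (Psi t * Delta J t) =
  Psi t * (Q J t - Delta J t) + psi t); last by ring.
rewrite (_ : Psi t * Q J t + psi t + - (Psi t * Delta J t) / 2 =
  Psi t * (Q J t - Delta J t / 2) + psi t); last by field.
rewrite (_ : - (Psi t * Delta J t) / 2 = - (Psi t * Delta J t / 2)); last by field.
rewrite cosN => E.
rewrite (_ : cos (Psi t * (Q J t - Delta J t / 2) + psi t) *
  (p * cos (Psi t * Delta J t / 2)) * H t = (cos (Psi t * (Q J t - Delta J t / 2) + psi t) *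
  cos (Psi t * Delta J t / 2)) * p * H t); last by ring.
by rewrite -E; field.
Qed.

Lemma swap_bound :
  `|\int[P]_w (cos (Psi (obs n w) * (\sum_(k < s) coord k (obs n w)) + psi (obs n w)) * H (obs n w))|
   <= \int[P]_w \prod_(j < N) `|cos (Psi (obs n w) * (y (X j w) - y (X (s + j) w)) / 2)|.
Proof.
have mo := @measurable_obs n.
rewrite (swap_average (leqnn N)); apply: norm_expect_le.
- have bF : bmeas (fun t => cos (Psi t * Q N t + psi t) *
    (\prod_(j < N) cos (Psi t * Delta j t / 2)) * H t).
    by apply: bmeasM => //; apply: bmeasM => //; exact: bmeas_prod.
  exact: (bmeas_comp bF mo).
- apply: bmeas_prod => j; apply: bmeas_norm; apply: bmeas_cos.
  apply: measurable_funM => //; apply: measurable_funM.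
    exact: measurableT_comp.
  by apply: measurable_funB; exact: (measurableT_comp my).
move=> w; rewrite !normrM -[leRHS]mulr1 ler_pM ?mulr_ge0//.
rewrite -[leRHS]mul1r ler_pM ?cos_max// normr_prod le_eqVlt; apply/orP; left; apply/eqP.
apply: eq_bigr => j _; rewrite /Delta /coord !nth_obs//.
  by rewrite (leq_trans _ sNn)// ltn_add2l.
by rewrite (leq_trans (ltn_ord j))// (leq_trans _ sNn)// leq_addl.
Qed.

End swap_average.

(** The N pairs formed by X j and X (s + j), j < N, are i.i.d. *)
Lemma expect_pair_product (g : S -> S -> R) (s N : nat) :
  (N <= s)%N -> (forall x x', 0 <= g x x' <= 1) ->
  measurable_fun [set: S * S] (fun p => g p.1 p.2) ->
  \int[P]_w \prod_(j < N) g (X j w) (X (s + j)%N w) =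
    (\int[mu]_x' \int[mu]_x g x x') ^+ N.
Proof.
move=> Ns g01 mg.
pose G N (t : N.*2.-tuple S) := \prod_(j < N) g (nth point t j.*2) (nth point t j.*2.+1).
have bG M : bmeas (@G M).
  apply: bmeas_prod => j; apply: bmeas_unit => //.
  apply: (measurableT_comp mg (f := fun p => g p.1 p.2)
    (g := fun t : M.*2.-tuple S => (nth point t j.*2, nth point t j.*2.+1))).
  by apply: measurable_fun_pair; exact: measurable_nth.
have GE M : \int[iid_law mu M.*2]_t G M t = (\int[mu]_x' \int[mu]_x g x x') ^+ M.
  elim: M => [|M IH].
    by under eq_Rintegral do rewrite /G big_ord0; rewrite expect_cst.
  rewrite (@expect_iid_lawS _ S R mu M.*2.+1 _ (bG M.+1)).
  have b2 := bmeas_expect_cons mu (bG M.+1).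
  rewrite (expect_iid_lawS mu b2).
  have E (t : M.*2.-tuple S) (x x' : S) :
      G M.+1 [tuple of x :: [tuple of x' :: t]] = G M t * g x x'.
    by rewrite /G big_ord_recl/= mulrC; congr (_ * _).
  have bg x' : bmeas (fun x => g x x').
    by apply: bmeas_unit => //; exact: (measurableT_comp mg (measurable_pair2 x')).
  have bgg : bmeas (fun x' => \int[mu]_x g x x').
    have bp : bmeas (fun p : S * S => g p.1 p.2) by exact: bmeas_unit.
    exact: (bmeas_partial_expect mu bp).
  transitivity (\int[iid_law mu M.*2]_t ((\int[mu]_x' \int[mu]_x g x x') * G M t)).
    apply: eq_Rintegral => t _.
    rewrite mulrC -expectZ//; apply: eq_Rintegral => x' _.
    by rewrite -expectZ//; apply: eq_Rintegral => x _; rewrite E.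
  by rewrite (expectZ _ _ (bG M)) exprS IH.
(* Entries 2 j and 2 j + 1 of the tuple are X j and X (s + j). *)
pose sg (i : 'I_N.*2) : nat := if odd i then (s + i./2)%N else i./2.
have sg_inj : injective sg.
  move=> i1 i2; rewrite /sg => E; apply: val_inj => /=.
  have hlt (i : 'I_N.*2) : (i./2 < s)%N.
    by rewrite (leq_trans _ Ns)// ltn_half_double.
  rewrite -[LHS]odd_double_half -[RHS]odd_double_half; move: E.
  have h1 := hlt i1; have h2 := hlt i2.
  case: ifP => o1; case: ifP => o2; rewrite ?o1 ?o2.
  - by move=> /addnI ->.
  - by move=> E; move: h2; rewrite -E ltnNge leq_addr.
  - by move=> E; move: h1; rewrite E ltnNge leq_addr.
  - by move=> ->.
rewrite -GE -(expect_sample mX iidX sg_inj (bG N)).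
apply: eq_Rintegral => w _; rewrite /G; apply: eq_bigr => j _.
have j2 : (j.*2 < N.*2)%N by rewrite ltn_double.
have j21 : (j.*2.+1 < N.*2)%N by rewrite -doubleS leq_double.
have E k (hk : (k < N.*2)%N) : nth point (sample X sg w) k = X (sg (Ordinal hk)) w.
  by rewrite -[k]/(nat_of_ord (Ordinal hk)) -tnth_nth tnth_mktuple.
rewrite (E _ j2) (E _ j21).
by rewrite /sg /= odd_double/= doubleK uphalf_double.
Qed.

End swap.

(** * Decay due to the absolutely continuous component *)

Section not_lattice.
Context {R : realType}.

(** Countable sets are Lebesgue-negligible. *)
Lemma ac_component_not_countable (nu : set R -> \bar R) (C : set R) :
  (forall A, measurable A -> 0 <= nu A)%E ->
  has_ac_component nu -> countable C -> nu (~` C) <> 0%E.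
Proof.
move=> nu0 [muc [mus [nuE muc_leb _ [A mA muA]]]] cC nuC; apply: muA.
have mC : measurable C by exact: countable_measurable.
have muC : muc C = 0%E.
  move/null_content_dominatesP : muc_leb => /(_ C mC); apply.
  exact: countable_lebesgue_measure0.
have muCC : muc (~` C) = 0%E.
  apply/eqP; rewrite eq_le measure_ge0 andbT -nuC nuE; last exact: measurableC.
  by rewrite leeDl.
apply/eqP; rewrite eq_le measure_ge0 andbT.
rewrite (@le_trans _ _ (muc (C `|` ~` C)))//.
  by rewrite setUv le_measure ?inE.
by rewrite (le_trans (measureU2 _ _ _))//; [exact: measurableC|rewrite [leLHS](_ : _ = 0%E)//; rewrite [X in (X + _)%E]muC [X in (_ + X)%E]muCC adde0].
Qed.

Lemma sin_intpi (k : int) : sin (k%:~R * pi) = 0 :> R.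
Proof.
have sk (j : nat) : sin (j%:R * pi) = 0 :> R.
  elim: j => [|j IH]; first by rewrite mul0r sin0.
  by rewrite -natr1 mulrDl mul1r sinDpi IH oppr0.
case: k => j; first exact: sk.
by rewrite NegzE mulrNz mulNr sinN sk oppr0.
Qed.

Lemma sin_eq0_int (z : R) : sin z = 0 -> exists k : int, z = k%:~R * pi.
Proof.
move=> sz; have pi0 := @pi_gt0 R.
pose k := Num.floor (z / pi); exists k.
pose r := z - k%:~R * pi.
have r0 : 0 <= r by rewrite subr_ge0 -ler_pdivlMr// floor_le.
have r1 : r < pi.
  rewrite ltrBlDr -[X in X + _]mul1r -mulrDl -ltr_pdivrMr// addrC.
  by have := floorD1_gt (z / pi); rewrite intrD.
have sr : sin r = 0 by rewrite /r sinB sz sin_intpi mul0r mulr0 subr0.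
move: r0; rewrite le_eqVlt => /predU1P[r0|r0].
  by apply/eqP; rewrite -subr_eq0 -/r -r0.
have : 0 < sin r by apply: sin_gt0_pi; rewrite r0.
by rewrite sr ltxx.
Qed.

Lemma measurable_neq0 d (T : measurableType d) (f : T -> R) :
  measurable_fun [set: T] f -> measurable [set x | f x != 0].
Proof.
move=> mf; rewrite (_ : [set x | _] = [set: T] `&` f @^-1` (~` [set 0])).
  by apply: mf => //; exact: measurableC.
rewrite setTI; apply/seteqP; split => x /=; first by move=> /eqP.
by move=> fx; exact/eqP.
Qed.

Lemma expect_eq0_ae d (T : measurableType d) (P : probability T R) (f : T -> R) :
  bmeas f -> (forall x, 0 <= f x) -> \int[P]_x f x <= 0 ->
  P [set x | f x != 0] = 0%E.
Proof.
move=> bf f0 If.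
have If0 : \int[P]_x f x = 0.
  by apply/eqP; rewrite eq_le If/=; exact: Rintegral_ge0.
have mf : measurable_fun [set: T] (EFin \o f) by apply/measurable_EFinP; case: bf.
have : (\int[P]_x `|(EFin \o f) x| = 0)%E.
  under eq_integral do rewrite /= ger0_norm//.
  by rewrite expectE// If0.
move/(ae_eq_integral_abs P measurableT mf) => [N [mN PN sub]].
apply/eqP; rewrite eq_le measure_ge0 andbT -PN le_measure ?inE//.
  by apply: measurable_neq0; case: bf.
move=> x /= fx; apply: sub => /= /(_ I) [E].
by move: fx; rewrite E eqxx.
Qed.

(** If the expectation were 1, then for some fixed x' the cosine would be 1 or
    -1 for almost every x, so that y would almost surely take its values in a
    translated lattice; this is excluded by the absolutely continuous
    component. *)
Lemma expect_cos_diff_lt1 d (S : measurableType d) (mu : probability S R) (y : S -> R) (t : R) :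
  measurable_fun [set: S] y -> has_ac_component (fun A => mu (y @^-1` A)) -> t != 0 ->
  \int[mu]_x' \int[mu]_x `|cos (t * (y x - y x') / 2)| < 1.
Proof.
move=> my acy t0; rewrite ltNge; apply/negP => H.
pose g x x' := `|cos (t * (y x - y x') / 2)|.
have mg : measurable_fun [set: S * S] (fun p => t * (y p.1 - y p.2) / 2).
  apply: measurable_funM => //; apply: measurable_funM => //.
  by apply: measurable_funB; apply: (measurableT_comp my).
have bp : bmeas (fun p : S * S => g p.1 p.2) by apply: bmeas_norm; exact: bmeas_cos.
have bg x' : bmeas (fun x => g x x').
  exact: (bmeas_comp bp (measurable_pair2 x')).
have bgg : bmeas (fun x' => \int[mu]_x g x x') by exact: (bmeas_partial_expect mu bp).
have gle x' : \int[mu]_x g x x' <= 1.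
  rewrite -[leRHS](expect_cst mu 1); apply: le_expect => //; first exact: bmeas_cst.
  by move=> x; exact: cos_max.
have Z1 : mu [set x' | 1 - \int[mu]_x g x x' != 0] = 0%E.
  apply: expect_eq0_ae.
  - by apply: bmeasB => //; exact: bmeas_cst.
  - by move=> x'; rewrite subr_ge0.
  - by rewrite expectB//; [rewrite expect_cst subr_le0|exact: bmeas_cst].
have [x' Hx'] : exists x', 1 - \int[mu]_x g x x' = 0.
  apply: contrapT => nx.
  have E : [set x' | 1 - \int[mu]_x g x x' != 0] = setT.
    by apply/seteqP; split => // x' _ /=; apply/eqP => h; apply: nx; exists x'.
  by move: Z1; rewrite E probability_setT => /eqP; rewrite onee_eq0.
have Z2 : mu [set x | 1 - g x x' != 0] = 0%E.
  apply: expect_eq0_ae.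
  - by apply: bmeasB => //; exact: bmeas_cst.
  - by move=> x; rewrite subr_ge0 cos_max.
  - by rewrite expectB//; [rewrite expect_cst Hx'|exact: bmeas_cst].
(* The values of y at which the cosine against x' is 1 or -1. *)
pose C := [set y x' + 2 * (k%:~R * pi) / t | k in [set: int]].
have cC : countable C by apply: card_le_trans (card_image_le _ _) _; exact: countableP.
apply: (@ac_component_not_countable _ C _ acy cC).
  by move=> A mA; exact: measure_ge0.
have mC : measurable C by exact: countable_measurable.
apply/eqP; rewrite eq_le measure_ge0 andbT -Z2 le_measure ?inE//.
- by rewrite -[X in measurable X]setTI; apply: my => //; exact: measurableC.
- by apply: measurable_neq0; apply: measurable_funB => //; case: (bg x').
move=> x /= nC; apply/eqP => /eqP; rewrite subr_eq0 => /eqP/esym/cos1sin0/sin_eq0_int[k kE].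
apply: nC; exists k => //; rewrite -kE.
by field.
Qed.

End not_lattice.

Section swap_small.
Context d (S : measurableType d) {R : realType} d' (Omega : measurableType d').
Variables (P : probability Omega R) (X : nat -> Omega -> S).
Hypothesis mX : forall n, measurable_fun [set: Omega] (X n).
Hypothesis iidX : iid P X.
Notation mu := (law0 P mX).
Variable y : S -> R.
Hypothesis my : measurable_fun [set: S] y.
Hypothesis acy : has_ac_component (fun A => mu (y @^-1` A)).

(** By [swap_bound] it is enough to bound the expectation of a product of N
    cosines. When Psi is frozen at t0 this expectation is rho^N with rho < 1.
    Freezing is legitimate off an event of small probability, because the 2 N
    observations involved are bounded in probability and their number does not
    depend on s or n. *)
Lemma swap_small (t0 e : R) : t0 != 0 -> 0 < e -> exists N, exists2 dl : R, 0 < dl &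
  forall s n (Psi psi H : n.-tuple S -> R) (G : set Omega),
    (N <= s)%N -> (s + N <= n)%N ->
    measurable_fun [set: n.-tuple S] Psi -> measurable_fun [set: n.-tuple S] psi ->
    measurable_fun [set: n.-tuple S] H -> (forall t, `|H t| <= 1) ->
    swap_invariant s N Psi -> swap_invariant s N psi -> swap_invariant s N H ->
    measurable G -> fine (P (~` G)) <= dl ->
    (forall w, G w -> `|Psi (obs X n w) - t0| <= dl) ->
    `|\int[P]_w (cos (Psi (obs X n w) * (\sum_(k < s) coord y k (obs X n w)) +
        psi (obs X n w)) * H (obs X n w))| <= e.
Proof.
move=> t00 e0; have e40 : 0 < e / 4 by rewrite divr_gt0.
pose rho := \int[mu]_x' \int[mu]_x `|cos (t0 * (y x - y x') / 2)|.
have rho1 : rho < 1 by exact: expect_cos_diff_lt1.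
have rho0 : 0 <= rho by apply: Rintegral_ge0 => x' _; apply: Rintegral_ge0 => x _.
have [N rhoN] : exists N, rho ^+ N <= e / 4.
  have : (fun n => rho ^+ n) @ \oo --> (0 : R) by apply: cvg_expr; rewrite ger0_norm.
  move/cvgrPdist_le => /(_ _ e40)[N _ /(_ N (leqnn N))] /=.
  by rewrite sub0r normrN ger0_norm ?exprn_ge0// => h; exists N.
have N1 : 0 < N%:R + 1 :> R by rewrite ltr_wpDl.
have eN : 0 < e / (8 * (N%:R + 1)) by rewrite divr_gt0// mulr_gt0.
have [A A0 HA] := tight_one mu my eN.
(* The first bound is for probabilities; the second one makes N cosines whose
   arguments move by at most dl * A change by at most e / 4 in total. *)
pose dl := Num.min (e / 4) (e / (4 * (N%:R + 1) * A)).
have dl0 : 0 < dl by rewrite lt_min e40 divr_gt0// !mulr_gt0.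
exists N, dl => // s n Psi psi H G Ns sNn mPsi mpsi mH H1 sPsi spsi sH mG PG GPsi.
have dle : dl <= e / 4 by rewrite ge_min lexx.
have dlA : dl * (4 * (N%:R + 1) * A) <= e.
  by rewrite -ler_pdivlMr ?ge_min ?lexx ?orbT// !mulr_gt0.
apply: (le_trans (swap_bound mX iidX my Ns sNn mPsi mpsi mH H1 sPsi spsi sH)).
pose B k := [set w | A < `|y (X k w)|].
have mB k : measurable (B k).
  apply: measurable_lt_set => //.
  by apply: measurableT_comp => //; exact: measurableT_comp.
have PB k : fine (P (B k)) <= e / (8 * (N%:R + 1)).
  have [idX _] := iidX.
  rewrite (_ : P (B k) = P (X 0%N @^-1` [set p | A < `|y p|])).
    exact: HA.
  rewrite -(idX k)//.
  apply: measurable_lt_set => //.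
  by apply: measurableT_comp.
pose Bad := \bigcup_(k in [set k | (k < N)%N]) (B k `|` B (s + k)%N).
have mBad : measurable Bad.
  by apply: fin_bigcup_measurable; [exact: finite_II|move=> k _; exact: measurableU].
have PBad : fine (P Bad) <= e / 4.
  have H0 : (P Bad <= \sum_(k < N) P (B k `|` B (s + k)%N))%E.
    rewrite /Bad bigcup_mkord.
    have mBk k : (k < N)%N -> measurable (B k `|` B (s + k)%N).
      by move=> _; exact: measurableU.
    exact: (Boole_inequality P mBk).
  have H2 k : (P (B k `|` B (s + k)%N) <= (2 * (e / (8 * (N%:R + 1))))%:E)%E.
    rewrite (le_trans (measureU2 _ _ _))// mulrDl mul1r EFinD.
    by apply: leeD; rewrite -[leLHS]fineK ?fin_num_measure// lee_fin; exact: PB.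
  rewrite -lee_fin fineK ?fin_num_measure// (le_trans H0)//.
  apply: (@le_trans _ _ (\sum_(k < N) (2 * (e / (8 * (N%:R + 1))))%:E)%E).
    by apply: lee_sum => k _; exact: H2.
  rewrite sumEFin lee_fin sumr_const card_ord -[_ *+ N]mulr_natl.
  rewrite (_ : N%:R * (2 * (e / (8 * (N%:R + 1)))) = (e / 4) * (N%:R / (N%:R + 1))); last first.
    by field; rewrite gt_eqF.
  by rewrite ler_piMr ?(ltW e40)// ler_pdivrMr// mul1r lerDl.
have bPsi : bmeas (fun w => \prod_(j < N) `|cos (Psi (obs X n w) * (y (X j w) - y (X (s + j) w)) / 2)|).
  apply: bmeas_prod => j; apply: bmeas_norm; apply: bmeas_cos.
  apply: measurable_funM => //; apply: measurable_funM.
    by apply: measurableT_comp => //; exact: measurable_obs.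
  by apply: measurable_funB; apply: (measurableT_comp my).
have bt0 : bmeas (fun w => \prod_(j < N) `|cos (t0 * (y (X j w) - y (X (s + j) w)) / 2)|).
  apply: bmeas_prod => j; apply: bmeas_norm; apply: bmeas_cos.
  apply: measurable_funM => //; apply: measurable_funM => //.
  by apply: measurable_funB; apply: (measurableT_comp my).
have p01 (a : 'I_N -> R) : 0 <= \prod_(j < N) `|cos (a j)| <= 1.
  rewrite prodr_ge0//=.
  by rewrite prodr_ile1// => j _; rewrite normr_ge0 cos_max.
have mE : measurable (G `&` ~` Bad) by apply: measurableI => //; exact: measurableC.
have := @bmeas_near_le _ _ _ P _ _ _ (N%:R * (dl * A)) 1 bPsi bt0 mE _ _ _.
have -> : \int[P]_w \prod_(j < N) `|cos (t0 * (y (X j w) - y (X (s + j) w)) / 2)| = rho ^+ N.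
  apply: (expect_pair_product mX iidX (g := fun x x' => `|cos (t0 * (y x - y x') / 2)|)) => //.
    by move=> x x'; rewrite normr_ge0 cos_max.
  have [] // : bmeas (fun p : S * S => `|cos (t0 * (y p.1 - y p.2) / 2)|).
  apply: bmeas_norm; apply: bmeas_cos; apply: measurable_funM => //; apply: measurable_funM => //.
  by apply: measurable_funB; apply: (measurableT_comp my).
have PE : fine (P (~` (G `&` ~` Bad))) <= e / 4 + e / 4.
  rewrite setCI setCK -lee_fin fineK; last first.
    by rewrite fin_num_measure//; apply: measurableU => //; exact: measurableC.
  rewrite (le_trans (measureU2 _ _ _))//; first exact: measurableC.
  rewrite EFinD; apply: leeD; rewrite -[leLHS]fineK ?lee_fin ?fin_num_measure//.
    exact: le_trans dle.
  exact: measurableC.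
have NdA : N%:R * (dl * A) <= e / 4.
  rewrite (@le_trans _ _ ((N%:R + 1) * (dl * A)))//.
    by rewrite ler_wpM2r ?mulr_ge0 ?(ltW dl0) ?(ltW A0)// lerDl.
  by lra.
move=> h; have {}h := h _ _ _.
have : `|\int[P]_w \prod_(j < N) `|cos (Psi (obs X n w) * (y (X j w) - y (X (s + j) w)) / 2)|
    - rho ^+ N| <= N%:R * (dl * A) + 1 * fine (P (~` (G `&` ~` Bad))).
  apply: h.
  - by rewrite !mulr_ge0// ltW.
  - move=> w [Gw nBad].
    have := @norm_prod_sub_le R 'I_N (index_enum 'I_N)
      (fun j => `|cos (Psi (obs X n w) * (y (X j w) - y (X (s + j) w)) / 2)|)
      (fun j => `|cos (t0 * (y (X j w) - y (X (s + j) w)) / 2)|) (dl * A).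
    rewrite (_ : size (index_enum 'I_N) = N); last by rewrite [index_enum _](_ : _ = enum 'I_N) ?size_enum_ord// enumT.
    apply.
    + by move=> j; rewrite normr_ge0 cos_max.
    + by move=> j; rewrite normr_ge0 cos_max.
    + move=> j; rewrite (le_trans (ler_dist_dist _ _))// (le_trans (norm_cos_sub_le _ _))//.
      rewrite (_ : _ - _ = (Psi (obs X n w) - t0) * ((y (X j w) - y (X (s + j) w)) / 2)); last by ring.
      rewrite normrM ler_pM// ?GPsi// normrM [X in _ * X]ger0_norm// ler_pdivrMr//.
      have nb k : (k < N)%N -> ~ (B k `|` B (s + k)%N) w.
        by move=> kN Bk; apply: nBad; exists k.
      have /not_orP[/negP + /negP] := nb j (ltn_ord j).
      rewrite /B /= -!leNgt => h1 h2.
      by rewrite (le_trans (ler_normB _ _))// mulr_natr mulr2n lerD.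
  - move=> w; rewrite ler_norml.
    have /andP[a1 a2] := p01 (fun j => Psi (obs X n w) * (y (X j w) - y (X (s + j) w)) / 2).
    have /andP[a3 a4] := p01 (fun j => t0 * (y (X j w) - y (X (s + j) w)) / 2).
    by apply/andP; split; lra.
by rewrite mul1r ler_norml => /andP[_]; lra.
Qed.

End swap_small.

(** * Equidistribution in the cells of the unit interval *)

Section fractional_cells.
Context {R : realType}.
Implicit Types r v : R.

Lemma fractional_part_itv r : 0 <= fractional_part r < 1.
Proof.
rewrite /fractional_part subr_ge0 floor_le/= ltrBlDr addrC -[X in _ + X]/(1%:~R) -intrD.
exact: floorD1_gt.
Qed.

Lemma measurable_fractional_part : measurable_fun [set: R] (@fractional_part R).
Proof.
apply: measurable_funB => //.
apply: nondecreasing_measurable => // r s rs.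
by rewrite ler_int; exact: le_floor.
Qed.

Lemma norm_sin_pi_addint v (k : int) : `|sin (pi * (v + k%:~R))| = `|sin (pi * v)|.
Proof.
have sk : sin (pi * k%:~R) = 0 :> R by rewrite mulrC sin_intpi.
by rewrite mulrDr sinD sk mulr0 addr0 normrM (sin0cos1 sk) mulr1.
Qed.

Definition cell n m v : bool := (m%:R <= n%:R * v) && (n%:R * v < m.+1%:R).

Lemma measurable_cell n m : measurable_fun [set: R] (fun v => (cell n m v)%:R : R).
Proof.
rewrite (_ : (fun v => _) = \1_[set v : R | cell n m v]).
  apply: measurable_indic.
  rewrite (_ : [set v | _] = [set v | m%:R <= n%:R * v] `&` [set v | n%:R * v < m.+1%:R]).
    apply: measurableI.
      by apply: measurable_le_set => //; exact: measurable_funM.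
    by apply: measurable_lt_set => //; exact: measurable_funM.
  by apply/seteqP; split => v /= /andP.
apply/funext => v; rewrite indicE; congr (_%:R).
by case: (boolP (cell n m v)) => c; apply/esym; [rewrite mem_set|rewrite memNset//; exact/negP].
Qed.

(** The kernels centred at all the grid points add up to L, and those at
    distance at least dl from r, modulo 1, are small. If r lies in the cell, then
    the grid points closer to r all belong to the cell enlarged by dl on both
    sides, which accounts for j * e + 2 * e of them. *)
Lemma cell_le_fejer n m j e r (L := (n * j * e)%N) (dl := (n * j)%:R^-1 : R) :
  (1 < j)%N -> (0 < L)%N ->
  (cell n m (fractional_part r))%:R <=
  L%:R^-1 * (\sum_(i < L | (i < (j + 2) * e)%N) fejer L (r - (m%:R / n%:R - dl + i%:R / L%:R)))
    + 2 / (L%:R * sin (pi * dl) ^+ 2).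
Proof.
move=> j1; rewrite lt0n !muln_eq0 !negb_or -!lt0n => /andP[/andP[n0 j0] e0].
have L0 : (0 < L)%N by rewrite !muln_gt0 n0 j0.
have L0R : 0 < L%:R :> R by rewrite ltr0n.
have nj2 : (2 <= n * j)%N by rewrite (leq_trans j1)// leq_pmull.
have nj0R : 0 < (n * j)%:R :> R by rewrite ltr0n (leq_trans _ nj2).
have dl0 : 0 < dl by rewrite invr_gt0.
have dl2 : dl <= 2^-1 by rewrite lef_pV2 ?posrE// (ler_nat _ 2).
have s0 : 0 < sin (pi * dl).
  by apply: sin_gt0_pi; rewrite mulr_gt0 ?pi_gt0//= gtr_pMr ?pi_gt0//; lra.
have tail0 : 0 <= 2 / (L%:R * sin (pi * dl) ^+ 2).
  by rewrite divr_ge0// mulr_ge0// sqr_ge0.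
case: (boolP (cell _ _ _)) => [/andP[c1 c2]|_]; last first.
  by rewrite addr_ge0// mulr_ge0 ?invr_ge0// sumr_ge0// => i _; exact: fejer_ge0.
rewrite -[leLHS](mulVf (lt0r_neq0 L0R)).
rewrite -[X in _ * X](fejer_grid (r - (m%:R / n%:R - dl)) L0).
rewrite (bigID (fun i : 'I_L => (i < (j + 2) * e)%N))/= mulrDr lerD//.
  rewrite ler_wpM2l ?invr_ge0//; apply: le_of_eq.
  by apply: eq_bigr => i _; congr fejer; ring.
rewrite ler_pdivrMl//.
apply: (@le_trans _ _ (\sum_(i < L) 2 / (L%:R * sin (pi * dl) ^+ 2))); last first.
  by rewrite sumr_const card_ord -[_ *+ L]mulr_natl.
rewrite [leLHS]big_mkcond/=; apply: ler_sum => i _; case: ifPn => // il.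
apply: fejer_le => //.
pose f := fractional_part r.
have rE : r = f + (Num.floor r)%:~R by rewrite /f /fractional_part subrK.
rewrite [X in X - _ - _]rE.
rewrite (_ : _ - _ - _ = (f - (m%:R / n%:R - dl) - i%:R / L%:R) + (Num.floor r)%:~R); last by ring.
rewrite norm_sin_pi_addint.
have n0R : 0 < n%:R :> R by rewrite ltr0n.
have f1 : m%:R / n%:R <= f by rewrite ler_pdivrMr// mulrC.
have f2 : f < m%:R / n%:R + n%:R^-1.
  by rewrite -[X in _ + X]mul1r -mulrDl natr1 ltr_pdivlMr// mulrC.
have i1 : i%:R / L%:R < 1 :> R by rewrite ltr_pdivrMr// mul1r ltr_nat.
have i2 : n%:R^-1 + 2 * dl <= i%:R / L%:R.
  rewrite ler_pdivlMr// (_ : (_ + _) * _ = ((j + 2) * e)%:R).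
    by rewrite ler_nat leqNgt.
  have e0R : 0 < e%:R :> R by rewrite ltr0n.
  have j0R : 0 < j%:R :> R by rewrite ltr0n.
  by rewrite /L /dl !natrM natrD; field; rewrite !gt_eqF.
have h : f - (m%:R / n%:R - dl) - i%:R / L%:R <= - dl by lra.
have h' : dl - 1 <= f - (m%:R / n%:R - dl) - i%:R / L%:R by lra.
by apply: sin_pi_ge => //; rewrite ler0_norm; lra.
Qed.

End fractional_cells.
Section cell_expectation.
Context d (T : measurableType d) {R : realType}.
Variables (P : probability T R) (X H : T -> R).
Hypotheses (mX : measurable_fun [set: T] X) (mH : measurable_fun [set: T] H)
  (H01 : forall w, 0 <= H w <= 1).

Let bH : bmeas H. Proof. exact: bmeas_unit. Qed.

Let bcos (u c : R) : bmeas (fun w => cos (u * X w + c)).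
Proof. by apply: bmeas_cos; apply: measurable_funD => //; exact: measurable_funM. Qed.

(** The diagonal of the double sum gives the expectation of H, and the other
    terms are Fourier coefficients at frequencies below L. *)
Lemma expect_fejer_le L (eta a : R) : (0 < L)%N -> 0 <= eta ->
  (forall k (c : R), (0 < k < L)%N ->
    `|\int[P]_w (cos (2 * pi * k%:R * X w + c) * H w)| <= eta) ->
  \int[P]_w (fejer L (X w - a) * H w) <= \int[P]_w H w + L%:R * eta.
Proof.
move=> L0 eta0 Heta; have L0R : 0 < L%:R :> R by rewrite ltr0n.
have bc (k l : 'I_L) : bmeas (fun w => cos (2 * pi * ((k%:R - l%:R) * (X w - a))) * H w).
  apply: bmeasM => //; apply: bmeas_cos.
  by do 2 apply: measurable_funM => //; exact: measurable_funB.
have E : \int[P]_w (fejer L (X w - a) * H w) = L%:R^-1 * \sum_(k < L) \sum_(l < L)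
    \int[P]_w (cos (2 * pi * ((k%:R - l%:R) * (X w - a))) * H w).
  under [in RHS]eq_bigr do rewrite -expect_sum//.
  rewrite -expect_sum; last by move=> k; exact: bmeas_sum.
  rewrite -expectZ; last by apply: bmeas_sum => k; exact: bmeas_sum.
  apply: eq_Rintegral => w _; rewrite /fejer -mulrA; congr (_ * _).
  by rewrite mulr_suml; apply: eq_bigr => k _; rewrite mulr_suml.
rewrite E ler_pdivrMl//.
apply: (@le_trans _ _ (\sum_(k < L) (\int[P]_w H w + L%:R * eta))); last first.
  by rewrite sumr_const card_ord -[_ *+ L]mulr_natl.
apply: ler_sum => k _; rewrite (bigD1 k)//= lerD//.
  apply: le_of_eq.
  by apply: eq_Rintegral => w _; rewrite subrr mul0r mulr0 cos0 mul1r.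
apply: (@le_trans _ _ (\sum_(l < L | l != k) eta)).
  apply: ler_sum => l lk; apply: le_trans (ler_norm _) _.
  have [kl|kl] := ltnP l k.
    rewrite (_ : \int[P]_w _ = \int[P]_w (cos (2 * pi * (k - l)%:R * X w +
       - (2 * pi * (k - l)%:R * a)) * H w)).
      by apply: Heta; rewrite subn_gt0 kl/= (leq_ltn_trans (leq_subr _ _)).
    apply: eq_Rintegral => w _; congr (cos _ * _).
    by rewrite natrB ?(ltnW kl)//; ring.
  have {}kl : (k < l)%N by rewrite ltn_neqAle kl andbT eq_sym.
  rewrite (_ : \int[P]_w _ = \int[P]_w (cos (2 * pi * (l - k)%:R * X w +
     - (2 * pi * (l - k)%:R * a)) * H w)).
    by apply: Heta; rewrite subn_gt0 kl/= (leq_ltn_trans (leq_subr _ _)).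
  apply: eq_Rintegral => w _; congr (_ * _); rewrite -cosN; congr cos.
  by rewrite natrB ?(ltnW kl)//; ring.
rewrite (@le_trans _ _ (\sum_(l < L) eta))//.
  by rewrite [leLHS]big_mkcond/= ler_sum// => l _; case: ifP.
by rewrite sumr_const card_ord -[_ *+ L]mulr_natl.
Qed.

End cell_expectation.

(** The enlarged cell of [cell_le_fejer] has length 1 / n + 2 / (n j). One
    chooses j to make the enlargement negligible, then the mesh to make the tail
    negligible, then eta; none of them depends on X, H or m, and this uniformity
    in H allows the coordinates to be treated one after the other. *)
Lemma cell_equidistribution (R : realType) n (e : R) : (0 < n)%N -> 0 < e ->
  exists L, exists2 eta : R, 0 < eta &
    forall d (T : measurableType d) (P : probability T R) (X H : T -> R),
      measurable_fun [set: T] X -> measurable_fun [set: T] H ->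
      (forall w, 0 <= H w <= 1) ->
      (forall k (c : R), (0 < k < L)%N ->
        `|\int[P]_w (cos (2 * pi * k%:R * X w + c) * H w)| <= eta) ->
      forall m, \int[P]_w ((cell n m (fractional_part (X w)))%:R * H w) <=
        n%:R^-1 * \int[P]_w H w + e.
Proof.
move=> n0 e0; have n0R : 0 < n%:R :> R by rewrite ltr0n.
have e40 : 0 < e / 4 by rewrite divr_gt0.
pose j := (Num.bound (2 / (n%:R * (e / 4)))).+2.
have jP : 2 / (n * j)%:R <= e / 4.
  have c0 : 0 < n%:R * (e / 4) by rewrite mulr_gt0.
  rewrite natrM ler_pdivrMr ?mulr_gt0 ?ltr0n//.
  rewrite (_ : e / 4 * _ = n%:R * (e / 4) * j%:R); last by ring.
  rewrite -ler_pdivrMl// mulrC ltW// (lt_le_trans (archi_boundP _)) ?divr_ge0 ?(ltW c0)//.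
  by rewrite ler_nat; exact: leqW (leqnSn _).
pose dl := (n * j)%:R^-1 : R.
have nj2 : (2 <= n * j)%N by rewrite (@leq_trans j)// leq_pmull.
have nj0R : 0 < (n * j)%:R :> R by rewrite ltr0n (leq_trans _ nj2).
have dl0 : 0 < dl by rewrite invr_gt0.
have dl2 : dl <= 2^-1 by rewrite lef_pV2 ?posrE// (ler_nat _ 2).
have s0 : 0 < sin (pi * dl).
  by apply: sin_gt0_pi; rewrite mulr_gt0 ?pi_gt0//= gtr_pMr ?pi_gt0//; lra.
pose s := sin (pi * dl).
pose r := (Num.bound (2 / ((n * j)%:R * s ^+ 2 * (e / 4)))).+1.
have rP : 2 / ((n * j * r)%:R * s ^+ 2) <= e / 4.
  have c0 : 0 < (n * j)%:R * s ^+ 2 * (e / 4) by rewrite !mulr_gt0// exprn_gt0.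
  rewrite natrM ler_pdivrMr; last by rewrite !mulr_gt0 ?exprn_gt0// ltr0n.
  rewrite (_ : e / 4 * _ = (n * j)%:R * s ^+ 2 * (e / 4) * r%:R); last by ring.
  rewrite -ler_pdivrMl// mulrC ltW// (lt_le_trans (archi_boundP _)) ?divr_ge0 ?(ltW c0)//.
  by rewrite ler_nat leqnSn.
pose L := (n * j * r)%N.
have L0 : (0 < L)%N by rewrite !muln_gt0 n0.
have L0R : 0 < L%:R :> R by rewrite ltr0n.
exists L, (e / 4 / L%:R) => [|d T P X H mX mH H01 Heta m]; first by rewrite divr_gt0.
have bH : bmeas H by exact: bmeas_unit.
have EH0 : 0 <= \int[P]_w H w.
  by apply: Rintegral_ge0 => w _; have /andP[] := H01 w.
have EH1 : \int[P]_w H w <= 1.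
  rewrite -[leRHS](expect_cst P 1); apply: le_expect => //; first exact: bmeas_cst.
  by move=> w; have /andP[] := H01 w.
pose a i : R := m%:R / n%:R - dl + i%:R / L%:R.
have bF i : bmeas (fun w => fejer L (X w - a i)).
  apply: bmeasM; first exact: bmeas_cst.
  apply: bmeas_sum => k; apply: bmeas_sum => l; apply: bmeas_cos.
  by do 2 apply: measurable_funM => //; exact: measurable_funB.
pose tl := 2 / (L%:R * s ^+ 2).
pose K := ((j + 2) * r)%N.
have tl0 : 0 <= tl by rewrite divr_ge0// mulr_ge0// sqr_ge0.
have bFH i : bmeas (fun w => (i < K)%N%:R * (fejer L (X w - a i) * H w)).
  by apply: bmeasM; [exact: bmeas_cst|exact: bmeasM].
apply: (@le_trans _ _ (\int[P]_w (L%:R^-1 *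
    (\sum_(i < L) (i < K)%N%:R * (fejer L (X w - a i) * H w)) + tl))).
  apply: le_expect.
  - apply: bmeasM => //; split.
      apply: (measurableT_comp (@measurable_cell R n m)).
      exact: measurableT_comp (@measurable_fractional_part R) mX.
    by exists 1 => w; rewrite ger0_norm// lern1 leq_b1.
  - apply: bmeasD; last exact: bmeas_cst.
    by apply: bmeasM; [exact: bmeas_cst|exact: bmeas_sum].
  move=> w; have /andP[h0 h1] := H01 w.
  have := @cell_le_fejer R n m j r (X w) isT L0.
  rewrite -/L -/dl -/s -/tl => h.
  apply: (le_trans (ler_wpM2r h0 h)).
  rewrite mulrDl lerD//; last by rewrite ler_piMr.
  rewrite -mulrA ler_wpM2l ?invr_ge0// mulr_suml [leLHS]big_mkcond/= ler_sum// => i _.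
  by rewrite /K; case: ifP; rewrite ?mul1r ?mul0r.
rewrite expectD; [|by apply: bmeasM; [exact: bmeas_cst|exact: bmeas_sum]|exact: bmeas_cst].
rewrite expectZ; last exact: bmeas_sum.
rewrite expect_sum// expect_cst.
pose E1 := \int[P]_w H w + e / 4.
have step : \sum_(i < L) \int[P]_w ((i < K)%N%:R * (fejer L (X w - a i) * H w)) <= K%:R * E1.
  apply: (@le_trans _ _ (\sum_(i < L) (i < K)%N%:R * E1)).
    apply: ler_sum => i _; rewrite expectZ; last exact: bmeasM.
    rewrite ler_wpM2l//.
    have := @expect_fejer_le _ _ _ P X H mX mH H01 L (e / 4 / L%:R) (a i) L0 _ Heta.
    rewrite divr_ge0 ?(ltW e40)// => /(_ isT) h.
    by rewrite (le_trans h)// /E1 lerD2l mulrC divfK// gt_eqF.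
  rewrite -mulr_suml ler_wpM2r ?addr_ge0 ?(ltW e40)//.
  rewrite -natr_sum ler_nat.
  have cnt p : (\sum_(i < p) (i < K) = minn p K)%N.
    elim: p => [|p IH]; first by rewrite big_ord0 min0n.
    rewrite big_ord_recr/= IH; have [pK|Kp] := ltnP p K.
      by rewrite (minn_idPl pK) addn1.
    by rewrite addn0 (minn_idPr (leqW Kp)).
  by rewrite cnt geq_minr.
have KL : L%:R^-1 * K%:R = n%:R^-1 + 2 / (n * j)%:R :> R.
  have r0R : 0 < r%:R :> R by rewrite ltr0n.
  have j0R : 0 < j%:R :> R by rewrite ltr0n.
  by rewrite /L /K !natrM natrD; field; rewrite !gt_eqF.
have nj1 : 2 / (n * j)%:R <= 1 :> R by rewrite ler_pdivrMr// mul1r (ler_nat _ 2).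
have n1 : n%:R^-1 <= 1 :> R by rewrite invf_le1// ler1n.
apply: (@le_trans _ _ (L%:R^-1 * (K%:R * E1) + e / 4)).
  by rewrite lerD// ler_wpM2l ?invr_ge0.
rewrite mulrA KL /E1 mulrDl mulrDr.
have : 2 / (n * j)%:R * (\int[P]_w H w + e / 4) <= e / 4 * 1 + 1 * (e / 4).
  by rewrite mulrDr lerD//; [rewrite ler_pM|rewrite ler_wpM2r// ltW].
have : n%:R^-1 * (e / 4) <= 1 * (e / 4) by rewrite ler_wpM2r// ltW.
lra.
Qed.

(** * Joint cell bounds for the fractional parts *)

(** Both exchanged indices j and s + j are below m, so the sum is only
    reordered. *)
Lemma sum_coord_swap_invariant d (S : measurableType d) (R : realType) (g : S -> R)
    n s N m : (s + N <= m)%N -> (m <= n)%N ->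
  swap_invariant s N (fun t : n.-tuple S => \sum_(k < m) coord g k t).
Proof.
move=> sNm mn j t jN.
have sj : (s + j < m)%N by rewrite (leq_trans _ sNm)// ltn_add2l.
pose r (k : 'I_m) := Ordinal (swapn_lt sj (ltn_ord k)).
have r_inj : injective r by move=> k k' /(congr1 val)/= /swapn_inj/val_inj.
rewrite [RHS](reindex_inj r_inj)/=; apply: eq_bigr => k _.
by rewrite coord_swap// (leq_trans (ltn_ord k)).
Qed.

Section cell_bound.
Context d (S : measurableType d) {R : realType} d' (Omega : measurableType d').
Variables (P : probability Omega R) (X : nat -> Omega -> S).
Hypothesis mX : forall n, measurable_fun [set: Omega] (X n).
Hypothesis iidX : iid P X.
Variable y : S -> R.
Hypothesis my : measurable_fun [set: S] y.
Hypothesis acy : has_ac_component (fun A => law0 P mX (y @^-1` A)).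

(** Finitely many frequencies are covered by the largest N and the smallest
    tolerance. At frequency k the multiplier Psi is 2 pi k Phi, which stays close
    to 2 pi k phi0 <> 0. *)
Lemma swap_small_freq (phi0 e : R) L : phi0 != 0 -> 0 < e ->
  exists N, exists2 dl : R, 0 < dl &
  forall s n (Phi H : n.-tuple S -> R) (y0 : R) (G : set Omega),
    (N <= s)%N -> (s + N <= n)%N ->
    measurable_fun [set: n.-tuple S] Phi -> measurable_fun [set: n.-tuple S] H ->
    (forall t, `|H t| <= 1) ->
    swap_invariant s N Phi -> swap_invariant s N H ->
    measurable G -> fine (P (~` G)) <= dl ->
    (forall w, G w -> `|Phi (obs X n w) - phi0| <= dl) ->
    forall k (c : R), (0 < k < L)%N ->
    `|\int[P]_w (cos (2 * pi * k%:R * (Phi (obs X n w) *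
        ((\sum_(k < s) coord y k (obs X n w)) + y0)) + c) * H (obs X n w))| <= e.
Proof.
move=> phi00 e0; elim: L => [|L [N1 [dl1 dl10 IH]]].
  by exists 0%N, 1 => // s n Phi H y0 G _ _ _ _ _ _ _ _ _ _ k c; rewrite ltn0 andbF.
have [->|L0] := posnP L.
  by exists 0%N, 1 => // s n Phi H y0 G _ _ _ _ _ _ _ _ _ _ [|k] c.
have t0 : 2 * pi * L%:R * phi0 != 0 :> R.
  by rewrite !mulf_neq0// ?pnatr_eq0 -?lt0n// gt_eqF// pi_gt0.
have [N2 [dl2 dl20 H2]] := swap_small iidX my acy t0 e0.
have u0 : 0 < 2 * pi * L%:R :> R by rewrite !mulr_gt0 ?pi_gt0 ?ltr0n.
pose dl := Num.min (Num.min dl1 dl2) (dl2 / (2 * pi * L%:R)).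
have dle1 : dl <= dl1 by rewrite !ge_min lexx.
have dle2 : dl <= dl2 by rewrite !ge_min lexx orbT.
have dle3 : dl <= dl2 / (2 * pi * L%:R) by rewrite !ge_min lexx orbT.
exists (maxn N1 N2), dl; first by rewrite !lt_min dl10 dl20 divr_gt0.
move=> s n Phi H y0 G Ns sNn mPhi mH H1 sPhi sH mG PG GPhi k c /andP[k0].
have [N1s N2s] : (N1 <= s)%N /\ (N2 <= s)%N by split; apply: leq_trans Ns; rewrite leq_max leqnn ?orbT.
have [sN1 sN2] : (s + N1 <= n)%N /\ (s + N2 <= n)%N.
  by split; apply: leq_trans sNn; rewrite leq_add2l leq_max leqnn ?orbT.
have sub (F : n.-tuple S -> R) N : (N <= maxn N1 N2)%N -> swap_invariant s (maxn N1 N2) F ->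
    swap_invariant s N F.
  by move=> NN sF j t jN; apply: sF; exact: leq_trans NN.
rewrite ltnS leq_eqVlt => /predU1P[->|kL]; last first.
  apply: (IH s n Phi H y0 G) => //; first by apply: sub => //; exact: leq_maxl.
  - by apply: sub => //; exact: leq_maxl.
  - exact: le_trans dle1.
  - by move=> w Gw; exact: le_trans (GPhi w Gw) dle1.
  - by rewrite k0.
have := H2 s n (fun t => 2 * pi * L%:R * Phi t) (fun t => 2 * pi * L%:R * Phi t * y0 + c) H G N2s sN2.
have mp : measurable_fun [set: n.-tuple S] (fun t => 2 * pi * L%:R * Phi t).
  exact: measurable_funM.
move=> /(_ mp) => h.
rewrite (_ : \int[P]_w _ = \int[P]_w (cos (2 * pi * L%:R * Phi (obs X n w) *
  (\sum_(k < s) coord y k (obs X n w)) + (2 * pi * L%:R * Phi (obs X n w) * y0 + c)) *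
  H (obs X n w))); last first.
  by apply: eq_Rintegral => w _; congr (cos _ * _); ring.
apply: h => //.
- by apply: measurable_funD => //; exact: measurable_funM.
- by apply: sub; [exact: leq_maxr|move=> j t jN; rewrite sPhi].
- by apply: sub; [exact: leq_maxr|move=> j t jN; rewrite sPhi].
- by apply: sub; [exact: leq_maxr|].
- exact: le_trans dle2.
- move=> w Gw; rewrite -mulrBr normrM ger0_norm ?(ltW u0)// -ler_pdivlMl// mulrC.
  exact: le_trans (GPhi w Gw) dle3.
Qed.

(** Given all that is invariant under the exchanges, the fractional part puts
    mass at most about 1 / n in each cell. *)
Lemma cell_bound (phi0 e : R) n : phi0 != 0 -> (0 < n)%N -> 0 < e ->
  exists N, exists2 dl : R, 0 < dl &
  forall s len (Phi H : len.-tuple S -> R) (y0 : R) (G : set Omega),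
    (N <= s)%N -> (s + N <= len)%N ->
    measurable_fun [set: len.-tuple S] Phi -> measurable_fun [set: len.-tuple S] H ->
    (forall t, 0 <= H t <= 1) ->
    swap_invariant s N Phi -> swap_invariant s N H ->
    measurable G -> fine (P (~` G)) <= dl ->
    (forall w, G w -> `|Phi (obs X len w) - phi0| <= dl) ->
    forall m,
    \int[P]_w ((cell n m (fractional_part (Phi (obs X len w) *
        ((\sum_(k < s) coord y k (obs X len w)) + y0))))%:R * H (obs X len w)) <=
    n%:R^-1 * \int[P]_w H (obs X len w) + e.
Proof.
move=> phi00 n0 e0.
have [L [eta eta0 HL]] := cell_equidistribution n0 e0.
have [N [dl dl0 HN]] := swap_small_freq L phi00 eta0.
exists N, dl => // s len Phi H y0 G Ns sN mPhi mH H01 sPhi sH mG PG GPhi m.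
apply: (HL _ _ P (fun w => Phi (obs X len w) * ((\sum_(k < s) coord y k (obs X len w)) + y0))
  (fun w => H (obs X len w))).
- have mo := @measurable_obs _ S _ _ X mX len.
  apply: measurable_funM; first exact: measurableT_comp.
  apply: measurable_funD => //; apply: measurable_sum => k.
  exact: (measurableT_comp (@measurable_coord _ S R y my len k)).
- exact: measurableT_comp (@measurable_obs _ S _ _ X mX len).
- by move=> w; exact: H01.
move=> k c kL; apply: (HN s len Phi H y0 G) => //.
by move=> t; have /andP[h0 h1] := H01 t; rewrite ger0_norm.
Qed.

End cell_bound.

Lemma eventually_gap (R : realType) (u v : nat -> nat) (a b : R) N :
  (u M)%:R / M%:R @[M --> \oo] --> a -> (v M)%:R / M%:R @[M --> \oo] --> b -> a < b ->
  \forall M \near \oo, (u M + N <= v M)%N.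
Proof.
move=> cu cv ab; have c0 : 0 < (b - a) / 2 by rewrite divr_gt0// subr_gt0.
have H : (v M)%:R / M%:R - (u M)%:R / M%:R @[M --> \oo] --> b - a by exact: cvgB.
have /(cvgr_gt (b - a))/(_ ((b - a) / 2)) H2 := H.
have lt2 : (b - a) / 2 < b - a by lra.
have {}H2 := H2 lt2.
near=> M.
have M0 : 0 < M%:R :> R by rewrite ltr0n; near: M; exact: nbhs_infty_gt.
have h1 : (b - a) / 2 < (v M)%:R / M%:R - (u M)%:R / M%:R by near: M.
have h2 : N%:R / ((b - a) / 2) <= M%:R by near: M; exact: nbhs_infty_ger.
rewrite -(ler_nat R) natrD -lerBrDl.
rewrite ler_pdivrMr// in h2; apply: (le_trans h2).
by move: h1; rewrite -mulrBl ltr_pdivlMr// mulrC => /ltW.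
Unshelve. all: by end_near. Qed.

Section joint_cells.
Context d (S : measurableType d) {R : realType} d' (Omega : measurableType d').
Variables (P : probability Omega R) (X : nat -> Omega -> S).
Hypothesis mX : forall n, measurable_fun [set: Omega] (X n).
Hypothesis iidX : iid P X.
Notation mu := (law0 P mX).
Variables (y z : S -> R) (mY mZ : R).
Hypotheses (my : measurable_fun [set: S] y) (mz : measurable_fun [set: S] z).
Hypothesis acy : has_ac_component (fun A => mu (y @^-1` A)).
Hypotheses (fY2 : mu.-integrable [set: S] (EFin \o (fun p => (y p - mY) ^+ 2)))
  (fZ2 : mu.-integrable [set: S] (EFin \o (fun p => (z p - mZ) ^+ 2)))
  (fY0 : \int[mu]_p (y p - mY) = 0) (fZ0 : \int[mu]_p (z p - mZ) = 0).
Variables (q : nat) (bM : nat -> 'I_q.+1 -> nat) (b : 'I_q.+1 -> R).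
Hypotheses (b0 : 0 < b ord0) (b_incr : forall i j : 'I_q.+1, (i < j)%N -> b i < b j).
Hypothesis cm : forall i, Num.sqrt M%:R * ((bM M i)%:R / M%:R - b i) @[M --> \oo] --> (0 : R).
Variables (x0 z0 : R) (y0 : 'I_q -> R) (phi : R -> R) (D : R).
Hypotheses (mphi : measurable_fun [set: R] phi)
  (dphi : is_derive (b ord_max * mY) 1 phi D) (phi0 : phi (b ord_max * mY) != 0).

Let m M := bM M ord_max.
Let Phi M w := PhiM X y m x0 phi M w.
Let T M w := TM X y z mY mZ m (b ord_max) x0 z0 phi M w.
Let Rem (i : 'I_q) M w :=
  Phi M w * (\sum_(k < bM M (widen_ord (leqnSn q) i)) y (X k w) + y0 i).

Let b_gt0 i : 0 < b i.
Proof.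
have [->//|i0] := eqVneq i ord0.
by apply: lt_trans b0 (b_incr _); rewrite lt0n.
Qed.

Let ge_bM N i : \forall M \near \oo, (N <= bM M i)%N.
Proof.
apply: (@eventually_gap R (fun=> 0%N) (bM ^~ i) 0 (b i) N) => //.
  by under eq_fun do rewrite mul0r; exact: cvg_cst.
exact: cvg_ratio (cm i).
Qed.

Let gap_bM N (i : 'I_q.+1) : \forall M \near \oo, forall j : 'I_q.+1, (i < j)%N -> (bM M i + N <= bM M j)%N.
Proof.
apply: filter_forall => j.
have [ij|ij] := boolP (i < j)%N; last exact: nearW.
apply: filterS (eventually_gap N (cvg_ratio (cm i)) (cvg_ratio (cm j)) (b_incr ij)).
by [].
Qed.

Let le_bM : \forall M \near \oo, forall i, (bM M i <= m M)%N.
Proof.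
apply: filter_forall => i.
have [->|ij] := eqVneq i ord_max; first exact: nearW.
have {}ij : (i < (ord_max : 'I_q.+1))%N by rewrite ltn_neqAle ij leq_ord.
apply: filterS (gap_bM 0 i) => M /(_ _ ij); by rewrite addn0.
Qed.

(** Phi, T and the remainders as functions of the tuple of the first m M
    observations, on which the exchanges act. *)
Let Phit M (t : (m M).-tuple S) := phi ((\sum_(k < m M) coord y k t + x0) / M%:R).
Let Tt M (t : (m M).-tuple S) := Num.sqrt M%:R *
  (Phit t * ((\sum_(k < m M) coord z k t + z0) / M%:R) -
     phi (b ord_max * mY) * (b ord_max * mZ)).
Let Remt i M (t : (m M).-tuple S) :=
  Phit t * (\sum_(k < bM M (widen_ord (leqnSn q) i)) coord y k t + y0 i).

Let coord_obs (g : S -> R) n k w : (k < n)%N -> coord g k (obs X n w) = g (X k w).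
Proof. by move=> kn; rewrite /coord nth_obs. Qed.

Let PhitE M w : Phit (obs X (m M) w) = Phi M w.
Proof.
rewrite /Phit /Phi /PhiM; congr (phi ((_ + _) / _)).
by apply: eq_bigr => k _; rewrite coord_obs.
Qed.

Let TtE M w : Tt (obs X (m M) w) = T M w.
Proof.
rewrite /Tt /T /TM PhitE; congr (_ * (_ * ((_ + _) / _) - _)).
by apply: eq_bigr => k _; rewrite coord_obs.
Qed.

Let mPhit M : measurable_fun [set: (m M).-tuple S] (@Phit M).
Proof.
apply: (measurableT_comp mphi); apply: measurable_funM => //.
by apply: measurable_funD => //; apply: measurable_sum => k; exact: measurable_coord.
Qed.

Let mTt M : measurable_fun [set: (m M).-tuple S] (@Tt M).
Proof.
apply: measurable_funM => //; apply: measurable_funB => //.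
apply: measurable_funM; first exact: mPhit.
apply: measurable_funM => //.
by apply: measurable_funD => //; apply: measurable_sum => k; exact: measurable_coord.
Qed.

Let mRemt i M : measurable_fun [set: (m M).-tuple S] (@Remt i M).
Proof.
apply: measurable_funM; first exact: mPhit.
by apply: measurable_funD => //; apply: measurable_sum => k; exact: measurable_coord.
Qed.

Let bmeas_frac_cell d1 (T1 : measurableType d1) n l (g : T1 -> R) :
  measurable_fun [set: T1] g -> bmeas (fun t => (cell n l (fractional_part (g t)))%:R : R).
Proof.
move=> mg; split.
  apply: (measurableT_comp (@measurable_cell R n l)).
  exact: measurableT_comp (@measurable_fractional_part R) mg.
by exists 1 => w; rewrite ger0_norm// lern1 leq_b1.
Qed.

(** The cells are removed one coordinate after the other, beginning with the
    first. With s = bM M i, the exchanges alter the i-th remainder but leave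
    Phi, T and the later remainders invariant, as bM M i + N <= bM M i' for
    i < i' and M large; [cell_bound] then trades the i-th cell for a factor
    1 / n. The induction is on the number j of coordinates that are left, which
    are the last ones. *)
Lemma joint_cells n (h : R -> R) (e : R) : (0 < n)%N -> measurable_fun [set: R] h ->
  (forall s, 0 <= h s <= 1) -> 0 < e ->
  \forall M \near \oo, forall c : 'I_q -> nat,
    \int[P]_w (\prod_(i < q) (cell n (c i) (fractional_part (Rem i M w)))%:R * h (T M w)) <=
    n%:R^-1 ^+ q * \int[P]_w h (T M w) + e.
Proof.
move=> n0 mh h01 e0.
have n1 : n%:R^-1 <= 1 :> R by rewrite invf_le1 ?ltr0n// ler1n.
suff H j : (j <= q)%N -> forall e : R, 0 < e -> \forall M \near \oo, forall c : 'I_q -> nat,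
    \int[P]_w (\prod_(i < q | (q - j <= i)%N) (cell n (c i) (fractional_part (Rem i M w)))%:R
      * h (T M w)) <= n%:R^-1 ^+ j * \int[P]_w h (T M w) + e.
  have := H q (leqnn q) e e0; rewrite subnn; apply: filterS => M + c => /(_ c).
  by apply: le_trans; apply: le_of_eq.
elim: j => [|j IH] jq {}e {}e0.
  apply: nearW => M c; rewrite subn0 expr0 mul1r.
  under eq_Rintegral.
    move=> w _; rewrite big_pred0; last by move=> i; rewrite leqNgt ltn_ord.
    rewrite mul1r; over.
  by rewrite lerDl ltW.
have e20 : 0 < e / 2 by rewrite divr_gt0.
have {}IH := IH (ltnW jq) _ e20.
have i0q : (q - j.+1 < q)%N by rewrite ltn_subrL/= (leq_ltn_trans _ jq).
pose i0 := Ordinal i0q; pose i1 := widen_ord (leqnSn q) i0.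
have [N [dl dl0 HN]] := cell_bound iidX my acy phi0 n0 e20.
have G0 := delta_good_event iidX my mz fY2 fZ2 fY0 fZ0 (cm ord_max) x0 z0 dphi dl0.
near=> M => c.
have Nb : (N <= bM M i1)%N by near: M; exact: ge_bM.
have gap : forall j' : 'I_q.+1, (i0 < j')%N -> (bM M i1 + N <= bM M j')%N.
  by near: M; exact: (gap_bM N i1).
have leM : forall i, (bM M i <= m M)%N by near: M; exact: le_bM.
have [G [mG PG HG]] : exists G : set Omega, [/\ measurable G, fine (P (~` G)) <= dl &
    forall w, G w -> `|T M w - nsum X (fun p => phi (b ord_max * mY) * (z p - mZ) + D * (b ord_max * mZ) * (y p - mY)) m M w| <= dl /\
      `|Phi M w - phi (b ord_max * mY)| <= dl] by near: M; exact: G0.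
pose H (t : (m M).-tuple S) :=
  \prod_(i < q | (q - j <= i)%N) (cell n (c i) (fractional_part (Remt i t)))%:R * h (Tt t).
have HE w : H (obs X (m M) w) = \prod_(i < q | (q - j <= i)%N)
    (cell n (c i) (fractional_part (Rem i M w)))%:R * h (T M w).
  rewrite /H TtE; congr (_ * _); apply: eq_bigr => i _; rewrite /Remt PhitE.
  congr ((cell _ _ (fractional_part (_ * (_ + _))))%:R).
  by apply: eq_bigr => k _; rewrite coord_obs// (leq_trans (ltn_ord k)).
have IHM : forall c : 'I_q -> nat, \int[P]_w (\prod_(i < q | (q - j <= i)%N)
    (cell n (c i) (fractional_part (Rem i M w)))%:R * h (T M w)) <=
    n%:R^-1 ^+ j * \int[P]_w h (T M w) + e / 2 by near: M.
have i0m : (i0 < (ord_max : 'I_q.+1))%N by exact: i0q.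
have sPhit : swap_invariant (bM M i1) N (@Phit M).
  move=> k t kN; rewrite /Phit; congr (phi ((_ + _) / _)).
  by apply: (sum_coord_swap_invariant y _ _ t kN) => //; exact: gap.
have := HN (bM M i1) (m M) (@Phit M) H (y0 i0) G Nb (gap _ i0m) (@mPhit M).
have mH : measurable_fun [set: (m M).-tuple S] H.
  apply: measurable_funM; last exact: (measurableT_comp mh (@mTt M)).
  by have [] := @bmeas_prod _ ((m M).-tuple S) R _ (index_enum 'I_q) (fun i : 'I_q => q - j <= i)%N
    (fun i t => (cell n (c i) (fractional_part (Remt i t)))%:R) (fun i => bmeas_frac_cell _ _ (@mRemt i M)).
have H01 t : 0 <= H t <= 1.
  have /andP[h0 h1] := h01 (Tt t).
  have p0 : 0 <= \prod_(i < q | (q - j <= i)%N) (cell n (c i) (fractional_part (Remt i t)))%:R :> R.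
    by rewrite prodr_ge0.
  have p1 : \prod_(i < q | (q - j <= i)%N) (cell n (c i) (fractional_part (Remt i t)))%:R <= 1 :> R.
    by rewrite prodr_ile1// => i _; rewrite ler0n lern1 leq_b1.
  by rewrite /H mulr_ge0//= mulr_ile1.
have sH : swap_invariant (bM M i1) N H.
  move=> k t kN; rewrite /H; congr (_ * h _).
    apply: eq_bigr => i ji; rewrite /Remt sPhit//.
    congr ((cell _ _ (fractional_part (_ * (_ + _))))%:R).
    apply: (sum_coord_swap_invariant y _ _ t kN) => //.
    apply: gap => /=; apply: leq_trans ji.
    by rewrite subnS prednK// subn_gt0.
  rewrite /Tt sPhit//; congr (_ * (_ * ((_ + _) / _) - _)).
  by apply: (sum_coord_swap_invariant z _ _ t kN) => //; exact: gap.
move=> /(_ mH H01 sPhit sH mG PG) h1.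
have HGt w : G w -> `|Phit (obs X (m M) w) - phi (b ord_max * mY)| <= dl.
  by move=> Gw; rewrite PhitE; have [] := HG w Gw.
apply: (@le_trans _ _ (n%:R^-1 * \int[P]_w H (obs X (m M) w) + e / 2)).
  apply: le_trans (h1 HGt (c i0)).
  apply: le_of_eq; apply: eq_Rintegral => w _.
  rewrite HE (bigD1 i0)/=; last by [].
  rewrite -mulrA; congr (_ * _).
    rewrite PhitE; congr ((cell _ _ (fractional_part (_ * (_ + _))))%:R).
    by apply: eq_bigr => k _; rewrite coord_obs// (leq_trans (ltn_ord k)).
  congr (_ * _); apply: eq_bigl => i; rewrite [RHS](_ : _ = (i0 < i)%N).
    by rewrite ltn_neqAle andbC; congr (_ && _); rewrite eq_sym.
  by rewrite /i0/= subnS prednK// subn_gt0.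
under eq_Rintegral do rewrite HE.
apply: (@le_trans _ _ (n%:R^-1 * (n%:R^-1 ^+ j * \int[P]_w h (T M w) + e / 2) + e / 2)).
  by rewrite lerD2r ler_wpM2l ?invr_ge0.
rewrite mulrDr mulrA -exprS -addrA lerD2l.
have : n%:R^-1 * (e / 2) <= 1 * (e / 2) by rewrite ler_wpM2r// ltW.
lra.
Unshelve. all: by end_near. Qed.

End joint_cells.

(** * Test functions and the uniform law on the cube *)

(** Rounding the coordinates down to multiples of 1 / (k + 1) leaves countably
    many values, so that f of the rounded vector is measurable; then k tends to
    infinity. *)
Lemma measurable_continuous_rV d (T : measurableType d) (R : realType) n
    (g : T -> 'rV[R]_n) (f : 'rV[R]_n -> R) :
  (forall i, measurable_fun [set: T] (fun w => g w 0 i)) -> continuous f ->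
  measurable_fun [set: T] (f \o g).
Proof.
move=> mg cf.
pose z k w : 'rV[int]_n := \row_i Num.floor (k.+1%:R * g w 0 i).
pose r k (a : 'rV[int]_n) : 'rV[R]_n := \row_i ((a 0 i)%:~R / k.+1%:R).
apply: (@measurable_fun_cvg _ _ _ _ (fun k w => f (r k (z k w)))) => [k|w _].
  move=> _ B mB; rewrite setTI.
  rewrite (_ : _ @^-1` B = \bigcup_(a : 'rV[int]_n)
     (if pselect (B (f (r k a))) then [set w | z k w = a] else set0)); last first.
    apply/seteqP; split => [w Bw|w [a _]]; first by exists (z k w) => //; case: pselect.
    by case: pselect => //= Ba zwa; rewrite zwa.
  apply: countable_bigcupT_measurable; first exact: countableP.
  move=> a /=; case: pselect => [Ba|nBa] /=; last exact: measurable0.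
  rewrite (_ : [set w | _] = \bigcap_(i in [set: 'I_n])
      [set w | (a 0 i)%:~R <= k.+1%:R * g w 0 i < (a 0 i + 1)%:~R]).
    apply: fin_bigcap_measurable; first exact: finite_finset.
    move=> i _; rewrite (_ : [set w | _] = [set w | (a 0 i)%:~R <= k.+1%:R * g w 0 i] `&`
      [set w | k.+1%:R * g w 0 i < (a 0 i + 1)%:~R]).
      apply: measurableI.
        by apply: measurable_le_set => //; exact: measurable_funM.
      by apply: measurable_lt_set => //; exact: measurable_funM.
    by apply/seteqP; split => w /= /andP.
  apply/seteqP; split => [w /= <- i _ /=|w /= h].
    by rewrite /z mxE floor_le floorD1_gt.
  by apply/rowP => i; rewrite /z mxE; apply: floor_def; exact: h.
apply: (@cvg_comp _ _ _ (fun k => r k (z k w)) f _ (nbhs (g w))); last exact: cf.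
apply/cvg_ballP => e e0; near=> k; split => // i j.
rewrite (ord1 i) /ball/= /r /z !mxE.
have k0 : 0 < k.+1%:R :> R by rewrite ltr0n.
have h1 := floor_le (k.+1%:R * g w 0 j).
have h2 := floorD1_gt (k.+1%:R * g w 0 j).
rewrite intrD in h2.
have ke : k.+1%:R^-1 < e by near: k; exact: near_infty_natSinv_lt (PosNum e0).
rewrite ger0_norm.
  rewrite (lt_trans _ ke)// ltrBlDr -[X in X + _]mul1r -mulrDl ltr_pdivlMr// mulrC.
  by rewrite addrC.
by rewrite subr_ge0 ler_pdivrMr// [leRHS]mulrC.
Unshelve. all: by end_near. Qed.

Section uniform_cube_cells.
Variable R : realType.

Lemma uniform_cube_box n (A : 'I_n -> set (measurableTypeR R)) :
  (forall i, measurable (A i)) ->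
  uniform_cube R n [set t | forall i, A i (tnth t i)] =
    (\prod_(i < n) uniform_prob (@ltr01 R) (A i))%E.
Proof.
elim: n A => [|n IH] A mA /=.
  by rewrite big_ord0 diracE mem_set//= => -[].
rewrite /distribution /pushforward big_ord_recl.
rewrite (_ : _ @^-1` _ = A ord0 `*` [set t | forall i, A (lift ord0 i) (tnth t i)]).
  rewrite [LHS](product_measure1E (uniform_prob (@ltr01 R)) (uniform_cube R n))//; last first.
    by apply: (measurable_box (A := fun i => A (lift ord0 i))) => i; exact: mA.
  by congr (_ * _)%E; exact: (IH (fun i => A (lift ord0 i)) (fun i => mA _)).
apply/seteqP; split => [[x t] /= h|[x t] /= [h0 h] i].
  by split => [|i]; [exact: (h ord0)|have := h (lift ord0 i); rewrite tnthS].
by case: (unliftP ord0 i) => [j ->|->//]; rewrite tnthS.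
Qed.

Lemma uniform_prob_cell n m : (m < n)%N ->
  uniform_prob (@ltr01 R) [set v | cell n m v] = (n%:R^-1)%:E.
Proof.
move=> mn; have n0 : 0 < n%:R :> R by rewrite ltr0n (leq_trans _ mn).
have E : [set v : R | cell n m v] = `[m%:R / n%:R, m.+1%:R / n%:R[%classic.
  apply/seteqP; split => v /=; rewrite in_itv/= /cell ler_pdivrMr// ltr_pdivlMr// mulrC.
    by [].
  by [].
rewrite E /uniform_prob integral_uniform_pdf.
rewrite (_ : _ `&` _ = `[m%:R / n%:R, m.+1%:R / n%:R[%classic); last first.
  apply: setIidl => v /=; rewrite !in_itv/= => /andP[v1 v2].
  rewrite (le_trans _ v1) ?divr_ge0//= (le_trans (ltW v2))// ler_pdivrMr// mul1r.
  by rewrite ler_nat.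
rewrite (eq_integral (fun=> 1%E)); last first.
  move=> v; rewrite inE/= in_itv/= => /andP[v1 v2].
  rewrite /uniform_pdf subr0 invr1 (le_trans _ v1) ?divr_ge0//=.
  by rewrite (le_trans (ltW v2))// ler_pdivrMr// mul1r ler_nat.
rewrite integral_cst//= mul1e lebesgue_measure_itv/= lte_fin.
rewrite ltr_pM2r ?invr_gt0// ltr_nat leqnn -EFinB; congr EFin.
by rewrite -mulrBl -natr1 addrAC subrr add0r mul1r.
Qed.

Lemma expect_uniform_cube_cells n q (c : 'I_q -> nat) : (forall i, (c i < n)%N) ->
  \int[uniform_cube R q]_u \prod_(i < q) (cell n (c i) (tnth u i))%:R = n%:R^-1 ^+ q.
Proof.
move=> cn; pose A i := [set v : measurableTypeR R | cell n (c i) v].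
have mA i : measurable (A i).
  rewrite (_ : A i = [set v | (cell n (c i) v)%:R != 0 :> R]).
    by apply: (@measurable_neq0 R _ (measurableTypeR R)); exact: measurable_cell.
  by apply/seteqP; split => v; rewrite /A/= pnatr_eq0 eqb0 negbK.
transitivity (\int[uniform_cube R q]_u \1_[set t | forall i, A i (tnth t i)] u).
  apply: eq_Rintegral => u _; rewrite indicE.
  have [h|/existsNP[i hi]] := pselect (forall i, A i (tnth u i)).
    by rewrite mem_set// big1// => i _; rewrite (h i).
  rewrite memNset; last by move=> /(_ i).
  by rewrite (bigD1 i)//= (_ : cell _ _ _ = false) ?mul0r//; apply/negbTE/negP.
rewrite expect_indic; last exact: measurable_box.
rewrite uniform_cube_box//.
rewrite (eq_bigr (fun=> (n%:R^-1)%:E)); last by move=> i _; rewrite uniform_prob_cell.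
by rewrite prodEFin/= prodr_const card_ord.
Qed.

End uniform_cube_cells.

(** * From cell bounds to convergence in distribution *)

Section cells_to_law.
Context {R : realType} (q : nat).
Implicit Types (u : 'I_q -> R) (t : R).

Definition cube_point u t : 'rV[R]_(q + 1) := row_mx (\row_(i < q) u i) t%:M.

Lemma cell_inj n m m' (v : R) : cell n m v -> cell n m' v -> m = m'.
Proof.
move=> /andP[h1 h2] /andP[h3 h4]; apply/eqP; rewrite eqn_leq; apply/andP; split.
  by rewrite -ltnS -(ltr_nat R); exact: le_lt_trans h4.
by rewrite -ltnS -(ltr_nat R); exact: le_lt_trans h2.
Qed.

Lemma cell_exists n (v : R) : (0 < n)%N -> 0 <= v < 1 -> exists m : 'I_n, cell n m v.
Proof.
move=> n0 /andP[v0 v1]; have n0R : 0 < n%:R :> R by rewrite ltr0n.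
have nv0 : 0 <= n%:R * v by rewrite mulr_ge0.
have /andP[h1 h2] := truncn_itv nv0.
have mn : (Num.truncn (n%:R * v) < n)%N.
  by rewrite -(ltr_nat R) (le_lt_trans h1)// gtr_pMr.
by exists (Ordinal mn); rewrite /cell/= h1.
Qed.

(** A continuous substitute for the indicator of |t| > A, equal to 1 when
    |t| >= A + 1, so that convergence in law of T controls its tail. *)
Definition cutoff (A t : R) : R := Num.min 1 (Num.max 0 (`|t| - A)).

Lemma cutoff_01 A t : 0 <= cutoff A t <= 1.
Proof. by rewrite /cutoff le_min ler01 le_max lexx ge_min lexx. Qed.

Lemma continuous_cutoff A : continuous (cutoff A).
Proof.
move=> t.
apply: (@continuous_min _ _ (fun=> 1) (fun s => Num.max 0 (`|s| - A)) t); first exact: cvg_cst.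
apply: (@continuous_max _ _ (fun=> 0) (fun s => `|s| - A) t); first exact: cvg_cst.
by apply: cvgB; [exact: norm_continuous|exact: cvg_cst].
Qed.

Variable f : 'rV[R]_(q + 1) -> R.
Hypotheses (cf : continuous f) (f01 : forall v, 0 <= f v <= 1).

Definition grid_value n (c : {ffun 'I_q -> 'I_n}) t : R :=
  f (cube_point (fun i => (c i)%:R / n%:R) t).

(** The step function that replaces u by the lower corner of its cell; it
    vanishes when u lies outside of the half-open cube. *)
Definition grid_sum n u t : R :=
  \sum_(c : {ffun 'I_q -> 'I_n})
    \prod_(i < q) (cell n (c i) (u i))%:R * grid_value c t.

Lemma continuous_grid_value n (c : {ffun 'I_q -> 'I_n}) : continuous (grid_value c).
Proof.
move=> t; apply: (@cvg_comp _ _ _ (fun s => cube_point (fun i => (c i)%:R / n%:R) s) f _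
  (nbhs (cube_point (fun i => (c i)%:R / n%:R) t))); last exact: cf.
apply/cvg_ballP => e e0; near=> s; split => // i j.
rewrite /cube_point !mxE; case: split_ordP => k _; rewrite !mxE; first exact: ballxx.
rewrite (ord1 i) (ord1 k) !mulr1n.
by near: s; exists e.
Unshelve. all: by end_near. Qed.

Lemma grid_sum_cell n u t (c : {ffun 'I_q -> 'I_n}) :
  (forall i, cell n (c i) (u i)) -> grid_sum n u t = grid_value c t.
Proof.
move=> hc; rewrite /grid_sum (bigD1 c)//= big1 ?mul1r; last by move=> i _; rewrite hc.
rewrite big1 ?addr0// => c' c'c.
have [i ci] : exists i, c' i != c i.
  by apply/existsP; rewrite -negb_forall; apply: contra c'c => /forallP h; apply/eqP/ffunP => i; apply/eqP.
rewrite (bigD1 i)//= (_ : cell _ _ _ = false) ?mul0r//.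
by apply/negP => h; move/eqP: ci; apply; apply: val_inj; exact: cell_inj h (hc i).
Qed.

Lemma grid_sum_nocell n u t :
  ~ (exists c : {ffun 'I_q -> 'I_n}, forall i, cell n (c i) (u i)) -> grid_sum n u t = 0.
Proof.
move=> nc; rewrite /grid_sum big1// => c _.
have /existsNP[i ci] : ~ forall i, cell n (c i) (u i) by move=> h; apply: nc; exists c.
by rewrite (bigD1 i)//= (_ : cell _ _ _ = false) ?mul0r//; apply/negP.
Qed.

(** Inside the cube the step function is uniformly close to f when |t| <= A + 1,
    and the cutoff absorbs the rest. The first bound serves for the sequence,
    the second one for the limit, where u may leave the half-open cube. *)
Lemma grid_sum_approx (A e : R) : 0 < A -> 0 < e -> exists2 n, (0 < n)%N &
  forall u t, ((forall i, 0 <= u i < 1) ->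
      f (cube_point u t) <= grid_sum n u t + e + cutoff A t) /\
    grid_sum n u t <= f (cube_point u t) + e + cutoff A t.
Proof.
move=> A0 e0; pose B := A + 1.
have cK : compact [set v : 'rV[R]_(q + 1) | forall i, `[- B, B]%classic (v ord0 i)].
  exact: (@rV_compact _ (q + 1)%N (fun=> `[- B, B]%classic) (fun=> @segment_compact R (- B) B)).
have [r r0 hr] := compact_unif_continuous cK cf e0.
pose n := (Num.bound r^-1).+1.
have n0 : (0 < n)%N by [].
have n0R : 0 < n%:R :> R by rewrite ltr0n.
have nr : n%:R^-1 < r.
  rewrite -[ltRHS]invrK ltf_pV2 ?posrE ?invr_gt0//.
  apply: (@lt_le_trans _ _ (Num.bound r^-1)%:R); last by rewrite ler_nat leqnSn.
  by rewrite archi_boundP// invr_ge0 ltW.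
have n1 : n%:R^-1 <= 1 :> R by rewrite invf_le1// ler1n.
have B1 : 1 <= B by rewrite lerDr ltW.
exists n => // u t.
have main (c : {ffun 'I_q -> 'I_n}) : (forall i, cell n (c i) (u i)) ->
    `|grid_value c t - f (cube_point u t)| <= e + cutoff A t.
  move=> hc; have /andP[ct0 ct1] := cutoff_01 A t.
  have [tB|Bt] := leP `|t| B; last first.
    have -> : cutoff A t = 1.
      apply/eqP; rewrite eq_le ct1/= le_min lexx le_max; apply/orP; right.
      by rewrite lerBrDr addrC ltW.
    have /andP[a1 a2] := f01 (cube_point u t).
    have /andP[a3 a4] := f01 (cube_point (fun i => (c i)%:R / n%:R) t).
    by rewrite /grid_value ler_norml; apply/andP; split; lra.
  rewrite (@le_trans _ _ e) ?lerDl//; apply/ltW/hr.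
    move=> i; rewrite /= in_itv/= /cube_point !mxE; case: split_ordP => k _; rewrite !mxE.
      have c1 : (c k)%:R / n%:R <= 1 :> R by rewrite ler_pdivrMr// mul1r ler_nat ltnW.
      rewrite (le_trans c1 B1) andbT (@le_trans _ _ 0) ?divr_ge0//.
      by rewrite lerNl oppr0 (le_trans _ B1).
    by rewrite (ord1 k) mulr1n -ler_norml.
  split => // i j; rewrite /cube_point !mxE; case: split_ordP => k _; rewrite !mxE.
    have /andP[h1 h2] := hc k.
    rewrite /ball/= distrC ger0_norm.
      rewrite (lt_trans _ nr)// ltrBlDl -[X in _ + X]mul1r -mulrDl natr1.
      by rewrite ltr_pdivlMr// mulrC.
    by rewrite subr_ge0 ler_pdivrMr// mulrC.
  exact: ballxx.
have /andP[f0 f1] := f01 (cube_point u t).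
have /andP[ct0 ct1] := cutoff_01 A t.
split=> [u01|].
  have [c hc] : exists c : {ffun 'I_q -> 'I_n}, forall i, cell n (c i) (u i).
    have /choice[c hc] : forall i, exists m : 'I_n, cell n m (u i).
      by move=> i; exact: cell_exists.
    by exists (finfun c) => i; rewrite ffunE.
  have := main c hc; rewrite (grid_sum_cell t hc) ler_norml => /andP[]; lra.
have [[c hc]|nc] := pselect (exists c : {ffun 'I_q -> 'I_n}, forall i, cell n (c i) (u i)).
  have := main c hc; rewrite (grid_sum_cell t hc) ler_norml => /andP[]; lra.
by rewrite grid_sum_nocell// !addr_ge0// ltW.
Qed.

End cells_to_law.
Lemma expect_prod_indep d1 (T1 : measurableType d1) d2 (T2 : measurableType d2)
    (R : realType) (mu : probability T1 R) (nu : probability T2 R)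
    (a : T1 -> R) (b : T2 -> R) : bmeas a -> bmeas b ->
  \int[(mu \x nu)%E]_p (a p.1 * b p.2) = \int[mu]_x a x * \int[nu]_y b y.
Proof.
move=> ba bb.
have bab : bmeas (fun p : T1 * T2 => a p.1 * b p.2).
  by apply: bmeasM; [exact: bmeas_comp ba measurable_fst|exact: bmeas_comp bb measurable_snd].
have intF := bmeas_integrable (mu \x nu)%E bab.
rewrite /Rintegral -(integral21_prod_meas1 intF).
rewrite -/(Rintegral _ _ _) -[X in _ = fine _ * X]/(Rintegral _ _ _).
have E y : fubini_G mu (EFin \o (fun p : T1 * T2 => a p.1 * b p.2)) y =
    (\int[mu]_x a x * b y)%:E.
  by rewrite /fubini_G/= expectE; [rewrite mulrC -expectZ//; congr EFin; apply: eq_Rintegral => x _; rewrite mulrC|apply: bmeasM => //; exact: bmeas_cst].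
transitivity (\int[nu]_y (\int[mu]_x a x * b y)).
  by rewrite /Rintegral; congr fine; apply: eq_integral => y _; rewrite E.
by rewrite expectZ.
Qed.

Section cells_cvg.
Context d (Omega : measurableType d) {R : realType} (P : probability Omega R) (q : nat).
Variables (u : nat -> Omega -> 'I_q -> R) (T : nat -> Omega -> R).
Variable nu : probability (measurableTypeR R) R.
Hypotheses (mu : forall M i, measurable_fun [set: Omega] (fun w => u M w i))
  (u01 : forall M w i, 0 <= u M w i < 1)
  (mT : forall M, measurable_fun [set: Omega] (T M)).
Hypothesis cT : forall h : R -> R, continuous h -> (forall s, 0 <= h s <= 1) ->
  \int[P]_w h (T M w) @[M --> \oo] --> (\int[nu]_t h t : R).
Hypothesis cell_le : forall n (h : R -> R) (e : R), (0 < n)%N ->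
  measurable_fun [set: R] h -> (forall s, 0 <= h s <= 1) -> 0 < e ->
  \forall M \near \oo, forall c : 'I_q -> nat,
    \int[P]_w (\prod_(i < q) (cell n (c i) (u M w i))%:R * h (T M w)) <=
    n%:R^-1 ^+ q * \int[P]_w h (T M w) + e.

Let P' := (uniform_cube R q \x nu)%E.
Let L (ut : q.-tuple (measurableTypeR R) * measurableTypeR R) : 'rV[R]_(q + 1) :=
  cube_point (tnth ut.1) ut.2.

Let bmeas_X (f : 'rV[R]_(q + 1) -> R) (K : R) M : continuous f -> (forall v, `|f v| <= K) ->
  bmeas (fun w => f (cube_point (u M w) (T M w))).
Proof.
move=> cf fK; split; last by exists K.
apply: (@measurable_continuous_rV _ _ R (q + 1)%N (fun w => cube_point (u M w) (T M w))) => // i.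
rewrite /cube_point; case: (split_ordP i) => k ->.
  by under eq_fun do rewrite row_mxEl mxE; exact: mu.
by under eq_fun do rewrite row_mxEr mxE (ord1 k) mulr1n; exact: mT.
Qed.

Let bmeas_L (f : 'rV[R]_(q + 1) -> R) (K : R) : continuous f -> (forall v, `|f v| <= K) -> bmeas (fun ut => f (L ut)).
Proof.
move=> cf fK; split; last by exists K.
apply: (@measurable_continuous_rV _ _ R (q + 1)%N L) => // i.
rewrite /L /cube_point; case: (split_ordP i) => k ->.
  under eq_fun do rewrite row_mxEl mxE.
  exact: (measurableT_comp (measurable_tnth k) measurable_fst).
by under eq_fun do rewrite row_mxEr mxE (ord1 k) mulr1n; exact: measurable_snd.
Qed.

Let bmeas_01 d1 (T1 : measurableType d1) (h : R -> R) (g : T1 -> R) :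
  measurable_fun [set: R] h -> (forall s, 0 <= h s <= 1) -> measurable_fun [set: T1] g ->
  bmeas (fun w => h (g w)).
Proof.
by move=> mh h01 mg; apply: bmeas_unit => //; exact: measurableT_comp mh mg.
Qed.

Let norm_01 (f : 'rV[R]_(q + 1) -> R) : (forall v, 0 <= f v <= 1) -> forall v, `|f v| <= 1.
Proof. by move=> f01 v; have /andP[f0 f1] := f01 v; rewrite ger0_norm. Qed.

Let bmeas_cells d1 (T1 : measurableType d1) n (c : 'I_q -> nat) (v : T1 -> 'I_q -> R) :
  (forall i, measurable_fun [set: T1] (fun w => v w i)) ->
  bmeas (fun w => \prod_(i < q) (cell n (c i) (v w i))%:R : R).
Proof.
move=> mv; apply: bmeas_prod => i; split.
  exact: measurableT_comp (@measurable_cell R n (c i)) (mv i).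
by exists 1 => w; rewrite ger0_norm// lern1 leq_b1.
Qed.

(** Replace f by its step function, bound each cell by the hypothesis, pass to
    the limit in T, and recognise the expectation of the step function under
    the limit law, in which a cell has mass n^-q. Upper bounds are enough, since
    they can be applied to f and to - f. *)
Lemma limsup_cells (f : 'rV[R]_(q + 1) -> R) (e : R) : continuous f ->
  (forall v, 0 <= f v <= 1) -> 0 < e ->
  \forall M \near \oo, \int[P]_w f (cube_point (u M w) (T M w)) <= \int[P']_ut f (L ut) + e.
Proof.
move=> cf f01 e0; have e70 : 0 < e / 7 by rewrite divr_gt0.
have mid : measurable_fun [set: measurableTypeR R] (@id R) by [].
have [A A0 HA] := tight_one nu mid e70.
have [n n0 Hn] := grid_sum_approx cf f01 A0 e70.
pose tau := cutoff A.
have mtau : measurable_fun [set: R] tau.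
  by apply: continuous_measurable_fun; exact: continuous_cutoff.
have tau01 s : 0 <= tau s <= 1 := cutoff_01 A s.
have btau : bmeas (tau : measurableTypeR R -> R) by exact: (bmeas_01 mtau tau01 mid).
have mA : measurable [set t : measurableTypeR R | A < `|t|].
  by apply: measurable_lt_set => //.
have Etau : \int[nu]_t tau t <= e / 7.
  apply: le_trans HA; rewrite -expect_indic//.
  apply: le_expect => //; first exact: bmeas_indic.
  move=> t; rewrite indicE; have [At|At] := ltP A `|t|.
    by rewrite mem_set//; have /andP[] := tau01 t.
  rewrite memNset /=; last by apply/negP; rewrite -leNgt.
  by rewrite /tau /cutoff ge_min ge_max lexx/= subr_le0 At orbT.
pose C := {ffun 'I_q -> 'I_n}.
pose gv (c : C) := grid_value f c.
have cgv c : continuous (gv c) by exact: continuous_grid_value.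
have gv01 c s : 0 <= gv c s <= 1 by exact: f01.
have mgv c : measurable_fun [set: R] (gv c) by apply: continuous_measurable_fun.
have bgv c : bmeas (gv c : measurableTypeR R -> R) by exact: (bmeas_01 (mgv c) (gv01 c) mid).
have Clim : \sum_(c : C) n%:R^-1 ^+ q * \int[P]_w gv c (T M w) @[M --> \oo] -->
    \sum_(c : C) n%:R^-1 ^+ q * \int[nu]_t gv c t.
  elim: (index_enum C) => [|c s IH].
    by under eq_fun do rewrite big_nil; rewrite big_nil; exact: cvg_cst.
  under eq_fun do rewrite big_cons; rewrite big_cons; apply: cvgD => //.
  by apply: cvgM; [exact: cvg_cst|exact: cT].
have Llow : \sum_(c : C) n%:R^-1 ^+ q * \int[nu]_t gv c t <= \int[P']_ut f (L ut) + e / 7 + e / 7.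
  have mt i : measurable_fun [set: q.-tuple (measurableTypeR R)] (fun v => tnth v i).
    exact: measurable_tnth.
  have bc (c : C) : bmeas (fun v : q.-tuple (measurableTypeR R) => \prod_(i < q) (cell n (c i) (tnth v i))%:R : R).
    exact: (@bmeas_cells _ _ n (fun i => nat_of_ord (c i)) (fun v => tnth v) mt).
  have bcg (c : C) : bmeas (fun ut : q.-tuple (measurableTypeR R) * measurableTypeR R =>
      \prod_(i < q) (cell n (c i) (tnth ut.1 i))%:R * gv c ut.2).
    apply: bmeasM; first exact: (bmeas_comp (bc c) measurable_fst).
    exact: (bmeas_comp (bgv c) measurable_snd).
  have bt2 : bmeas (fun ut : q.-tuple (measurableTypeR R) * measurableTypeR R => tau ut.2).
    exact: (bmeas_comp btau measurable_snd).
  have bfL := bmeas_L cf (norm_01 f01).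
  rewrite (eq_bigr (fun c : C => \int[P']_ut
    (\prod_(i < q) (cell n (c i) (tnth ut.1 i))%:R * gv c ut.2))); last first.
    move=> c _; rewrite (expect_prod_indep _ _ (bc c) (bgv c)); congr (_ * _).
    by rewrite (@expect_uniform_cube_cells R n q (fun i => nat_of_ord (c i))).
  rewrite -expect_sum//.
  apply: (@le_trans _ _ (\int[P']_ut (f (L ut) + e / 7 + tau ut.2))).
    apply: le_expect; first exact: bmeas_sum.
      by do 2 apply: bmeasD => //; exact: bmeas_cst.
    by move=> ut; have [_] := Hn (tnth ut.1) ut.2.
  rewrite expectD//; last by apply: bmeasD => //; exact: bmeas_cst.
  rewrite expectD//; last exact: bmeas_cst.
  rewrite expect_cst lerD2l (_ : \int[P']_ut tau ut.2 = \int[P']_ut (1 * tau ut.2)).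
    have b1 : bmeas (fun _ : q.-tuple (measurableTypeR R) => 1 : R) by exact: bmeas_cst.
    by rewrite (expect_prod_indep (uniform_cube R q) nu b1 btau) expect_cst mul1r.
  by apply: eq_Rintegral => ut _; rewrite mul1r.
have cardC : 0 < #|{: C}|%:R :> R.
  rewrite ltr0n; apply/card_gt0P; exists [ffun=> Ordinal n0].
  by [].
have eC0 : 0 < e / 7 / #|{: C}|%:R by rewrite divr_gt0.
have upper : \forall M \near \oo, forall c : C,
    \int[P]_w (\prod_(i < q) (cell n (c i) (u M w i))%:R * gv c (T M w)) <=
    n%:R^-1 ^+ q * \int[P]_w gv c (T M w) + e / 7 / #|{: C}|%:R.
  apply: filter_forall => c.
  by apply: filterS (cell_le n0 (mgv c) (gv01 c) eC0) => M; exact.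
have sum_lt : \sum_(c : C) n%:R^-1 ^+ q * \int[nu]_t gv c t <
   \sum_(c : C) n%:R^-1 ^+ q * \int[nu]_t gv c t + e / 7 by rewrite ltrDl.
have tau_lt : \int[nu]_t tau t < \int[nu]_t tau t + e / 7 by rewrite ltrDl.
have ctau : continuous tau by exact: continuous_cutoff.
have sum_near : \forall M \near \oo, \sum_(c : C) n%:R^-1 ^+ q * \int[P]_w gv c (T M w) <=
   \sum_(c : C) n%:R^-1 ^+ q * \int[nu]_t gv c t + e / 7 by exact: (cvgr_le _ Clim).
have tau_near : \forall M \near \oo, \int[P]_w tau (T M w) <= \int[nu]_t tau t + e / 7.
  exact: (cvgr_le _ (cT ctau tau01)).
near=> M.
have hC : \sum_(c : C) n%:R^-1 ^+ q * \int[P]_w gv c (T M w) <=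
   \sum_(c : C) n%:R^-1 ^+ q * \int[nu]_t gv c t + e / 7 by near: M.
have htau : \int[P]_w tau (T M w) <= \int[nu]_t tau t + e / 7 by near: M.
have hcell : forall c : C,
    \int[P]_w (\prod_(i < q) (cell n (c i) (u M w i))%:R * gv c (T M w)) <=
    n%:R^-1 ^+ q * \int[P]_w gv c (T M w) + e / 7 / #|{: C}|%:R by near: M.
have bg (c : C) : bmeas (fun w => \prod_(i < q) (cell n (c i) (u M w i))%:R * gv c (T M w)).
  apply: bmeasM; last exact: bmeas_01.
  exact: (@bmeas_cells _ _ n (fun i => nat_of_ord (c i)) (u M) (mu M)).
have bt : bmeas (fun w => tau (T M w)) by exact: bmeas_01.
apply: (@le_trans _ _ (\int[P]_w (grid_sum f n (u M w) (T M w) + e / 7 + tau (T M w)))).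
  apply: le_expect; first exact: bmeas_X (norm_01 f01).
    by apply: bmeasD => //; apply: bmeasD; [exact: bmeas_sum|exact: bmeas_cst].
  by move=> w; have [+ _] := Hn (u M w) (T M w); apply.
rewrite expectD//; last by apply: bmeasD; [exact: bmeas_sum|exact: bmeas_cst].
rewrite expectD//; [|exact: bmeas_sum|exact: bmeas_cst].
rewrite expect_cst expect_sum//.
have : \sum_(c : C) \int[P]_w (\prod_(i < q) (cell n (c i) (u M w i))%:R * gv c (T M w)) <=
    \sum_(c : C) n%:R^-1 ^+ q * \int[P]_w gv c (T M w) + e / 7.
  apply: (@le_trans _ _ (\sum_(c : C) (n%:R^-1 ^+ q * \int[P]_w gv c (T M w) + e / 7 / #|{: C}|%:R))).
    by apply: ler_sum => c _.
  by rewrite big_split/= sumr_const -[X in _ + X]mulr_natl mulrC divfK ?gt_eqF.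
move: Llow hC htau Etau.
rewrite -/C -/gv.
lra.
Unshelve. all: by end_near. Qed.

(** A bounded f and its opposite are brought into [0, 1] by an affine map, and
    [limsup_cells] applied to both gives the two halves of the limit. *)
Lemma cvg_of_cells : cvg_in_distribution P (uniform_cube R q \x nu)%E
  (fun M w => cube_point (u M w) (T M w)) (fun ut => cube_point (tnth ut.1) ut.2).
Proof.
move=> f cf [K fK].
have K0 : 0 <= K by exact: le_trans (normr_ge0 _) (fK 0).
have bX M := bmeas_X M cf fK.
have bL := bmeas_L cf fK.
under eq_fun do rewrite expectE//.
rewrite (expectE P' bL).
have H : \int[P]_w f (cube_point (u M w) (T M w)) @[M --> \oo] --> \int[P']_ut f (L ut); last first.
  by apply: cvg_EFin; [exact: nearW|exact: H].
pose B := K + 1.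
have B0 : 0 < B by rewrite ltr_wpDl.
have B20 : 0 < 2 * B by rewrite mulr_gt0.
(* The two signs make both f and - f accessible to the one-sided bound. *)
have one_sided (s e : R) : `|s| = 1 -> 0 < e -> \forall M \near \oo,
    s * \int[P]_w f (cube_point (u M w) (T M w)) <= s * \int[P']_ut f (L ut) + e.
  move=> s1 e0; pose g v := (2 * B)^-1 * (s * f v + B).
  have sfB v : `|s * f v| <= B.
    by rewrite normrM s1 mul1r (le_trans (fK v))// lerDl.
  have cg : continuous g.
    move=> v; apply: (@continuous_comp _ _ _ f (fun r : R => (2 * B)^-1 * (s * r + B)) v).
      exact: cf.
    apply: (@cvgM _ _ (nbhs (f v)) _ (fun=> _)); first exact: cvg_cst.
    apply: (@cvgD _ _ _ (nbhs (f v)) _ _ (fun=> B)); last exact: cvg_cst.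
    by apply: (@cvgM _ _ (nbhs (f v)) _ (fun=> s)); [exact: cvg_cst|exact: cvg_id].
  have g01 v : 0 <= g v <= 1.
    have := sfB v; rewrite ler_norml => /andP[h1 h2].
    rewrite /g mulr_ge0 ?invr_ge0 ?(ltW B20)//=; last by lra.
    by rewrite ler_pdivrMl// mulr1; lra.
  have eB0 : 0 < (2 * B)^-1 * e by rewrite mulr_gt0// invr_gt0.
  apply: filterS (limsup_cells cg g01 eB0) => M.
  have gE d0 (T0 : measurableType d0) (Q : probability T0 R) (X : T0 -> 'rV[R]_(q + 1)) :
      bmeas (fun w => f (X w)) ->
      \int[Q]_w g (X w) = (2 * B)^-1 * (s * \int[Q]_w f (X w) + B).
    move=> bf; have bsf : bmeas (fun w => s * f (X w)).
      by apply: bmeasM => //; exact: bmeas_cst.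
    rewrite /g expectZ; last by apply: bmeasD => //; exact: bmeas_cst.
    rewrite expectD//; last exact: bmeas_cst.
    by rewrite expectZ// expect_cst.
  rewrite (gE _ _ P _ (bX M)) (gE _ _ P' _ bL) -mulrDr ler_pM2l ?invr_gt0//.
  by rewrite addrAC lerD2r.
apply/cvgrPdist_le => e e0; near=> M.
have h1 : 1 * \int[P]_w f (cube_point (u M w) (T M w)) <= 1 * \int[P']_ut f (L ut) + e.
  by near: M; apply: one_sided => //; rewrite normr1.
have h2 : -1 * \int[P]_w f (cube_point (u M w) (T M w)) <= -1 * \int[P']_ut f (L ut) + e.
  by near: M; apply: one_sided => //; rewrite normrN normr1.
by rewrite ler_norml; apply/andP; split; lra.
Unshelve. all: by end_near. Qed.

End cells_cvg.

(** * Second moments of the observations *)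

Section law0_integrals.
Context d (S : measurableType d) {R : realType} d' (Omega : measurableType d').
Variables (P : probability Omega R) (X : nat -> Omega -> S).
Hypothesis mX : forall n, measurable_fun [set: Omega] (X n).
Variable g : S -> R.
Hypotheses (mg : measurable_fun [set: S] g)
  (ig : P.-integrable [set: Omega] (EFin \o (fun w => g (X 0%N w)))).

Lemma integrable_law0 : (law0 P mX).-integrable [set: S] (EFin \o g).
Proof.
apply/integrableP; split; first exact/measurable_EFinP.
rewrite /law0 ge0_integral_distribution//.
  by have /integrableP[_] := ig.
by apply: measurableT_comp => //; exact/measurable_EFinP.
Qed.

Lemma Rintegral_law0 : \int[law0 P mX]_p g p = \int[P]_w g (X 0%N w).
Proof.
by rewrite /Rintegral /law0 integral_distribution//; exact/measurable_EFinP.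
Qed.

End law0_integrals.

Section moments.
Context d (T : measurableType d) {R : realType} (P : probability T R).

Lemma Lfun2_center (f : T -> R) (c : R) : f \in Lfun P 2%:E -> (fun w => f w - c) \in Lfun P 2%:E.
Proof.
move=> f2; rewrite (_ : (fun w => _) = f - cst c)//.
by rewrite rpredB ?lee1n//= => _; exact: Lfun_cst.
Qed.

Lemma Lfun2_scale (f : T -> R) (c : R) : f \in Lfun P 2%:E -> (fun w => c * f w) \in Lfun P 2%:E.
Proof.
move=> f2; rewrite (_ : (fun w => _) = c \o* f); last by apply/funext => w; rewrite /= mulrC.
by apply: Lfun_scale; rewrite ?ler1n.
Qed.

Lemma Lfun2_Lfun1 (f : T -> R) : f \in Lfun P 2%:E -> f \in Lfun P 1.
Proof. by apply: Lfun_subset12; rewrite fin_num_measure. Qed.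

Lemma Rintegral_centered (f : T -> R) : f \in Lfun P 2%:E ->
  \int[P]_w (f w - fine 'E_P[f]) = 0.
Proof.
move=> f2; have i1 := (Lfun1_integrable P f).1 (Lfun2_Lfun1 f2).
rewrite RintegralB//; last exact: (bmeas_integrable P (bmeas_cst _)).
by rewrite expect_cst /Rintegral unlock subrr.
Qed.

Lemma fine_covariance (f g : T -> R) : fine (covariance P f g) =
  \int[P]_w ((f w - fine 'E_P[f]) * (g w - fine 'E_P[g])).
Proof.
have E (h : T -> R) : ('E_P[h] = \int[P]_w (h w)%:E)%E by rewrite unlock.
by rewrite unlock E.
Qed.

(** Both sides expand into the two variances and the covariance. *)
Lemma variance_linear_combination (f g : T -> R) (a c : R) :
  f \in Lfun P 2%:E -> g \in Lfun P 2%:E ->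
  \int[P]_w ((a * (g w - fine 'E_P[g]) + c * (f w - fine 'E_P[f])) ^+ 2) =
  let S := covariance_matrix P (fun i : 'I_2 => if i == 0 then f else g) in
  let v : 'cV[R]_2 := \col_(i < 2) if i == 0 then c else a in
  (v^T *m S *m v) 0 0.
Proof.
move=> f2 g2 /=.
pose F w := f w - fine 'E_P[f]; pose G w := g w - fine 'E_P[g].
have F2 : F \in Lfun P 2%:E by exact: Lfun2_center.
have G2 : G \in Lfun P 2%:E by exact: Lfun2_center.
have iM (h k : T -> R) : h \in Lfun P 2%:E -> k \in Lfun P 2%:E ->
    P.-integrable [set: T] (EFin \o (fun w => h w * k w)).
  by move=> h2 k2; exact: (Lfun1_integrable P _).1 (Lfun2_mul_Lfun1 h2 k2).
have iZ (r : R) (h : T -> R) : P.-integrable [set: T] (EFin \o h) ->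
    P.-integrable [set: T] (EFin \o (fun w => r * h w)).
  by move=> ih; rewrite (_ : EFin \o _ = (fun w => r%:E * (h w)%:E)%E)//; exact: integrableZl.
have iD (h k : T -> R) : P.-integrable [set: T] (EFin \o h) -> P.-integrable [set: T] (EFin \o k) ->
    P.-integrable [set: T] (EFin \o (fun w => h w + k w)).
  by move=> ih ik; rewrite (_ : EFin \o _ = (fun w => (h w)%:E + (k w)%:E)%E)//; exact: integrableD.
have -> : \int[P]_w ((a * G w + c * F w) ^+ 2) =
    a ^+ 2 * \int[P]_w (G w * G w) + (2 * a * c) * \int[P]_w (F w * G w) +
    c ^+ 2 * \int[P]_w (F w * F w).
  transitivity (\int[P]_w (a ^+ 2 * (G w * G w) + (2 * a * c) * (F w * G w) + c ^+ 2 * (F w * F w))).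
    by apply: eq_Rintegral => w _; ring.
  rewrite RintegralD//; [|by apply: iD; apply: iZ; exact: iM|by apply: iZ; exact: iM].
  rewrite RintegralD//; [|by apply: iZ; exact: iM|by apply: iZ; exact: iM].
  by rewrite !RintegralZl//; exact: iM.
rewrite !mxE !big_ord_recl !big_ord0 !mxE !big_ord_recl !big_ord0 !mxE/=.
rewrite !fine_covariance -/F -/G.
have -> : \int[P]_w (G w * F w) = \int[P]_w (F w * G w).
  by apply: eq_Rintegral => w _; rewrite mulrC.
ring.
Qed.

End moments.

(** * Joint convergence in distribution *)

Theorem theorem1 (R : realType) (d : measure_display) (Omega : measurableType d)
    (P : probability Omega R) (q : nat)
    (Y Z : nat -> {RV P >-> R})
    (bM : nat -> 'I_q.+1 -> nat) (b : 'I_q.+1 -> R)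
    (x z : R) (y : 'I_q -> R) (phi : R -> R) :
  let mY := fine 'E_P[Y 0%N] in
  let mZ := fine 'E_P[Z 0%N] in
  let bq := b ord_max in
  let SY n w := \sum_(k < n) Y k w in
  let SZ n w := \sum_(k < n) Z k w in
  let Phi M w := phi ((SY (bM M ord_max) w + x) / M%:R) in
  let Rem (i : 'I_q) M w := Phi M w * (SY (bM M (widen_ord (leqnSn q) i)) w + y i) in
  let theta := phi (bq * mY) * (bq * mZ) in
  let Sigma := covariance_matrix P (fun i : 'I_2 => if i == 0 then Y 0%N else Z 0%N) in
  let v : 'cV[R]_2 := \col_(i < 2)
    if i == 0 then phi^`()%classic (bq * mY) * (bq * mZ) else phi (bq * mY) in
  let sigmaT2 := bq * (v^T *m Sigma *m v) 0 0 in
  (0 < q)%N ->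
  (forall i, (Y i : Omega -> R) \in Lfun P 2%:E) ->
  (forall i, (Z i : Omega -> R) \in Lfun P 2%:E) ->
  iid P (fun i w => (Y i w, Z i w)) ->
  has_ac_component (distribution P (Y 0%N)) ->
  0 < b ord0 ->
  (forall i j : 'I_q.+1, (i < j)%N -> b i < b j) ->
  (forall i, Num.sqrt M%:R * ((bM M i)%:R / M%:R - b i) @[M --> \oo] --> (0 : R)) ->
  measurable_fun [set: R] phi ->
  derivable phi (bq * mY) 1 ->
  phi (bq * mY) != 0 ->
  (exists Mt : nat,
    (\int[lebesgue_measure]_(u in [set: R])
       ((`|phi (bq * mY + u)| ^+ q.+1)%:E^-1 * (expR (- (Mt%:R * u ^+ 2)))%:E) < +oo)%E) ->
  cvg_in_distribution P (uniform_cube R q \x normal_law 0 sigmaT2)%E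
    (fun M w => row_mx (\row_(i < q) fractional_part (Rem i M w))
      (Num.sqrt M%:R * (Phi M w * ((SZ (bM M ord_max) w + z) / M%:R) - theta))%:M)
    (fun ut => row_mx (\row_(i < q) tnth ut.1 i) (ut.2)%:M : 'rV[R]_(q + 1)).
Proof.
move=> mY mZ bq SY SZ Phi Rem theta Sigma v sigmaT2 q0 Y2 Z2 iidYZ acY b0 b_incr cm
  mphi dphi phi0 _.
pose X i w := (Y i w, Z i w).
have mX i : measurable_fun [set: Omega] (X i).
  by apply: measurable_fun_pair; exact: measurable_funPT.
pose mu := law0 P mX.
pose D := phi^`()%classic (bq * mY).
have is_dphi : is_derive (bq * mY) 1 phi D.
  by rewrite /D derive1E; exact: DeriveDef.
have mfst : measurable_fun [set: R * R] (fst : R * R -> R) by exact: measurable_fst.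
have msnd : measurable_fun [set: R * R] (snd : R * R -> R) by exact: measurable_snd.
have Yc2 := Lfun2_center mY (Y2 0%N).
have Zc2 := Lfun2_center mZ (Z2 0%N).
have iY2 : mu.-integrable [set: R * R] (EFin \o (fun p => (p.1 - mY) ^+ 2)).
  apply: integrable_law0; last exact: Lfun2_integrable_sqr.
  by apply: measurable_funX; exact: measurable_funB.
have iZ2 : mu.-integrable [set: R * R] (EFin \o (fun p => (p.2 - mZ) ^+ 2)).
  apply: integrable_law0; last exact: Lfun2_integrable_sqr.
  by apply: measurable_funX; exact: measurable_funB.
have iYc : P.-integrable [set: Omega] (EFin \o (fun w => Y 0%N w - mY)).
  exact: (Lfun1_integrable P _).1 (Lfun2_Lfun1 Yc2).
have iZc : P.-integrable [set: Omega] (EFin \o (fun w => Z 0%N w - mZ)).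
  exact: (Lfun1_integrable P _).1 (Lfun2_Lfun1 Zc2).
have EY0 : \int[mu]_p (p.1 - mY) = 0.
  rewrite (@Rintegral_law0 _ _ _ _ _ P X mX (fun p => p.1 - mY))//; last exact: measurable_funB.
  exact: (Rintegral_centered (Y2 0%N)).
have EZ0 : \int[mu]_p (p.2 - mZ) = 0.
  rewrite (@Rintegral_law0 _ _ _ _ _ P X mX (fun p => p.2 - mZ))//; last exact: measurable_funB.
  exact: (Rintegral_centered (Z2 0%N)).
have acmu : has_ac_component (fun A => mu (fst @^-1` A)) by exact: acY.
have varE : sigmaT2 = bq * \int[mu]_p ((phi (bq * mY) * (p.2 - mZ) + D * (bq * mZ) * (p.1 - mY)) ^+ 2).
  rewrite /sigmaT2; congr (_ * _).
  transitivity (\int[P]_w ((phi (bq * mY) * (Z 0%N w - mZ) + D * (bq * mZ) * (Y 0%N w - mY)) ^+ 2)).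
    have E := variance_linear_combination (phi (bq * mY)) (D * (bq * mZ)) (Y2 0%N) (Z2 0%N).
    rewrite -/mY -/mZ in E.
    rewrite E (_ : Sigma = covariance_matrix P
      (fun i : 'I_2 => if i == 0 then Y 0%N : Omega -> R else Z 0%N))//.
    by congr covariance_matrix; apply/funext => i; case: ifP.
  apply/esym; apply: (@Rintegral_law0 _ _ _ _ _ P X mX
    (fun p => (phi (bq * mY) * (p.2 - mZ) + D * (bq * mZ) * (p.1 - mY)) ^+ 2)).
    apply: measurable_funX; apply: measurable_funD; apply: measurable_funM => //; exact: measurable_funB.
  apply: Lfun2_integrable_sqr.
  rewrite (_ : (fun w => _) = (fun w => phi (bq * mY) * (Z 0%N w - mZ)) +
    (fun w => D * (bq * mZ) * (Y 0%N w - mY)))//.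
  by rewrite rpredD ?lee1n//= => _; exact: Lfun2_scale.
pose m M := bM M ord_max.
rewrite varE.
apply: (@cvg_of_cells _ _ _ P q (fun M w i => fractional_part (Rem i M w))
  (TM X fst snd mY mZ m bq x z phi)).
- move=> M i; apply: measurableT_comp (@measurable_fractional_part R) _.
  apply: measurable_funM; first exact: (measurable_PhiM mX mfst m x mphi M).
  apply: measurable_funD => //; apply: measurable_sum => k; exact: measurable_funPT.
- by move=> M w i; exact: fractional_part_itv.
- by move=> M; exact: measurable_TM.
- by move=> h ch h01; exact: (clt_TM iidYZ mfst msnd iY2 iZ2 EY0 EZ0 (cm ord_max) x z mphi is_dphi ch h01).
move=> n h e n0 mh h01 e0.
exact: (joint_cells iidYZ mfst msnd acmu iY2 iZ2 EY0 EZ0 b0 b_incr cm x z y mphi is_dphi phi0 n0 mh h01 e0).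
Qed.
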